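(* Let $B\subset A$ be an inclusion of simple unital $C^*$-algebras with a conditional expectation of index-finite type, let $n\ge1$, and let $2\le p\le\infty$ with $\frac1p+\frac1q=1$. (i) For any $x\in B'\cap A_n$, $\ \lVert x\rVert_q\le\lVert\mathcal F_n(x)\rVert_p\le\Big(\dfrac{\delta}{\kappa_{n-1}}\Big)^{1-\frac2p}\lVert x\rVert_q$. (ii) For any $w\in A'\cap A_{n+1}$, $\ \lVert w\rVert_q\le\lVert\mathcal F_n^{-1}(w)\rVert_p\le\Big(\dfrac{\delta}{\kappa_{n-1}}\Big)^{1-\frac2p}\lVert w\rVert_q$.
   Context: Setting. $B\subset A$ is an inclusion of simple unital $C^*$-algebras (common unit) admitting a conditional expectation of index-finite type. A conditional expectation $E:A\to B$ is of index-finite type if it has a quasi-basis, i.e. a finite set $\{\lambda_1,\dots,\lambda_m\}\subset A$ with $x=\sum_i\lambda_iE(\lambda_i^*x)=\sum_iE(x\lambda_i)\lambda_i^*$ for all $x\in A$; its Watatani index is $\sum_i\lambda_i\lambda_i^*$ (a positive scalar here). $E_0:A\to B$ is the minimal conditional expectation (the unique one of smallest index), $[A:B]_0$ is its index, $\tau=[A:B]_0^{-1}$, $\delta=\sqrt{[A:B]_0}$. Put $A_{-1}=B$, $A_0=A$; for $n\ge1$, $A_n$ is the $C^*$-basic construction of $A_{n-2}\subset A_{n-1}$ with respect to $E_{n-1}$, with Jones projection $e_n\in A_n$ (so $e_nxe_n=E_{n-1}(x)e_n$ for $x\in A_{n-1}$ and $A_n=\mathrm{span}\,A_{n-1}e_nA_{n-1}$),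 and $E_n:A_n\to A_{n-1}$ is the dual (minimal) conditional expectation, $E_n(xe_ny)=\tau xy$ for $x,y\in A_{n-1}$. For $C\subset D$, $C'\cap D=\{d\in D: dc=cd\ \forall c\in C\}$; the relative commutants $B'\cap A_n$ are finite-dimensional. $\mathrm{tr}$ is the faithful tracial state on $B'\cap A_n$ given by the restriction of $E_0\circ E_1\circ\cdots\circ E_n$; these are compatible for varying $n$ and are restricted to the subalgebras $A'\cap A_n$. Norms. $\lVert x\rVert_p=\mathrm{tr}(|x|^p)^{1/p}$ for $1\le p<\infty$; $\lVert x\rVert_\infty$ is the operator norm. Fourier transform. $v_n=e_ne_{n-1}\cdots e_1$. $E^{B'\cap A_n}_{A'\cap A_n}$ is the $\mathrm{tr}$-preserving conditional expectation; $E^{B'\cap A_n}_{A'\cap A_n}(x)=\tau\sum_i\lambda_ix\lambda_i^*$ for any quasi-basis $\{\lambda_i\}$ of $E_0$. $\mathcal F_n:B'\cap A_n\to A'\cap A_{n+1}$, $\mathcal F_n(x)=\tau^{-\frac{n+2}{2}}E^{B'\cap A_{n+1}}_{A'\cap A_{n+1}}(xv_{n+1})$, a bijection with inverse $\mathcal F_n^{-1}(w)=\tau^{-\frac{n+2}{2}}E_{n+1}(wv_{n+1}^* )$. Constants. $\kappa_n^+=\min\{\mathrm{tr}(p):p\text{ a nonzero projection in }B'\cap A_n\}$, $\kappa_n^-=\min\{\mathrm{tr}(q):q\text{ a nonzero projection in }A'\cap A_{n+1}\}$, $\kappa_n=\sqrt{\kappa_n^+\kappa_n^-}$. *)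

(* Defs.v *)
From HB Require Import structures.
From mathcomp Require Import all_boot all_order all_algebra.
From mathcomp Require Import complex.
From mathcomp Require Import all_classical all_reals all_analysis.

Set Implicit Arguments.
Unset Strict Implicit.
Unset Printing Implicit Defensive.

Import Order.TTheory GRing.Theory Num.Theory.
Import numFieldNormedType.Exports.

Local Open Scope classical_set_scope.
Local Open Scope complex_scope.
Local Open Scope ring_scope.

(* Unital C*-algebras.  The norm is axiomatised directly, with values in R:
   completeNormedModType R[i] shares no common substructure with the ring
   hierarchy other than the numeric domains, so they cannot be joined here. *)
HB.mixin Record isCStarAlgebra (R : realType) M of GRing.Algebra R[i] M := {
  star : M -> M ;
  cnorm : M -> R ;
  starK : forall x : M, star (star x) = x ;
  starD : forall x y : M, star (x + y) = star x + star y ;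
  starZ : forall (c : R[i]) (x : M), star (c *: x) = c^* *: star x ;
  starM : forall x y : M, star (x * y) = star y * star x ;
  cnorm0_eq0 : forall x : M, cnorm x = 0 -> x = 0 ;
  cnormD : forall x y : M, cnorm (x + y) <= cnorm x + cnorm y ;
  cnormZ : forall (c : R[i]) (x : M),
    cnorm (c *: x) = complex.Re `|c| * cnorm x ;
  cnormM : forall x y : M, cnorm (x * y) <= cnorm x * cnorm y ;
  cnorm_star : forall x : M, cnorm (star x * x) = cnorm x ^+ 2 ;
  cnorm_complete : forall u : nat -> M,
    (forall eps : R, 0 < eps -> exists N : nat, forall m n : nat,
       (N <= m)%N -> (N <= n)%N -> cnorm (u m - u n) < eps) ->
    exists l : M, cnorm (u n - l) @[n --> \oo] --> (0 : R)
}.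

#[short(type="cstarAlgType")]
HB.structure Definition CStarAlgebra (R : realType) :=
  {M of GRing.Algebra R[i] M & isCStarAlgebra R M}.

Section CStar.
Context {R : realType} {M : cstarAlgType R}.
Implicit Types (A B C D I : set M) (a x y : M).

(* All algebras are C*-subalgebras, with common unit, of one C*-algebra M, for
   instance the C*-inductive limit of the Jones tower.  Maps between them are
   functions M -> M; their values outside the source algebra are irrelevant. *)

Definition norm_closed A : Prop :=
  forall (u : nat -> M) (l : M), (forall n, A (u n)) ->
    cnorm (u n - l) @[n --> \oo] --> (0 : R) -> A l.

Record cstar_subalgebra A : Prop := {
  csub_closed : norm_closed A ;
  csub_one : A 1 ;
  csub_add : forall x y, A x -> A y -> A (x + y) ;
  csub_scale : forall (c : R[i]) x, A x -> A (c *: x) ;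
  csub_mul : forall x y, A x -> A y -> A (x * y) ;
  csub_star : forall x, A x -> A (star x)
}.

Record closed_ideal A I : Prop := {
  ideal_sub : I `<=` A ;
  ideal_closed : norm_closed I ;
  ideal_zero : I 0 ;
  ideal_add : forall x y, I x -> I y -> I (x + y) ;
  ideal_scale : forall (c : R[i]) x, I x -> I (c *: x) ;
  ideal_mul : forall a x, A a -> I x -> I (a * x) /\ I (x * a)
}.

Definition simple_algebra A : Prop :=
  forall I, closed_ideal A I -> I = [set 0] \/ I = A.

Definition relcommutant C D : set M :=
  [set d | D d /\ forall c, C c -> d * c = c * d].

Definition projection x : Prop := star x = x /\ x * x = x.

Record cond_exp A B (E : M -> M) : Prop := {
  ce_range : forall x, A x -> B (E x) ;
  ce_linear : forall (c : R[i]) x y, A x -> A y ->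
    E (c *: x + y) = c *: E x + E y ;
  ce_id : forall b, B b -> E b = b ;
  ce_bimod : forall b x b', B b -> A x -> B b' -> E (b * x * b') = b * E x * b' ;
  ce_pos : forall x, A x -> exists2 b, B b & E (star x * x) = star b * b
}.

Definition quasi_basis A (E : M -> M) (l : seq M) : Prop :=
  (forall z, z \in l -> A z) /\
  forall x, A x -> x = \sum_(z <- l) z * E (star z * x) /\
                   x = \sum_(z <- l) E (x * z) * star z.

(* E is of index-finite type and its Watatani index is the scalar r. *)
Definition has_index A (E : M -> M) (r : R) : Prop :=
  exists2 l, quasi_basis A E l & \sum_(z <- l) z * star z = r%:C%:A.

Definition minimal_cond_exp A B (E : M -> M) (r : R) : Prop :=
  [/\ cond_exp A B E, has_index A E r &
      forall (F : M -> M) (s : R), cond_exp A B F -> has_index A F s -> r <= s].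

(* Q is the C*-basic construction of N `<=` P with respect to E : P -> N, with
   Jones projection e: up to an isomorphism pi, Q is the *-algebra of adjointable
   operators on the right Hilbert N-module P, with inner product
   <x, y> = E (star x * y), which is spanned by the operators
   z |-> x * E (y * z); P acts by left multiplication and e acts as E.
   For E of index-finite type P is already complete for the module norm, and the
   span of these operators is already closed. *)
Record basic_construction_action (N P Q : set M) (E : M -> M) (e : M)
    (pi : M -> M -> M) : Prop := {
  bca_range : forall a z, Q a -> P z -> P (pi a z) ;
  bca_linear : forall a (c : R[i]) z z', Q a -> P z -> P z' ->
    pi a (c *: z + z') = c *: pi a z + pi a z' ;
  bca_module : forall a z b, Q a -> P z -> N b -> pi a (z * b) = pi a z * b ;
  bca_lin : forall (c : R[i]) a b z, Q a -> Q b -> P z ->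
    pi (c *: a + b) z = c *: pi a z + pi b z ;
  bca_mul : forall a b z, Q a -> Q b -> P z -> pi (a * b) z = pi a (pi b z) ;
  bca_star : forall a z z', Q a -> P z -> P z' ->
    E (star (pi a z) * z') = E (star z * pi (star a) z') ;
  bca_inj : forall a, Q a -> (forall z, P z -> pi a z = 0) -> a = 0 ;
  bca_left : forall a z, P a -> P z -> pi a z = a * z ;
  bca_proj : forall z, P z -> pi e z = E z ;
  bca_span : forall a, Q a -> exists2 s : seq (M * M),
    forall u, u \in s -> P u.1 /\ P u.2 &
    forall z, P z -> pi a z = \sum_(u <- s) u.1 * E (u.2 * z)
}.

Definition basic_construction (N P Q : set M) (E : M -> M) (e : M) : Prop :=
  [/\ P `<=` Q, Q e & exists pi, basic_construction_action N P Q E e pi].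

(* prev_alg B A n is A_{n-1}, with A_{-1} = B. *)
Definition prev_alg B (A : nat -> set M) (n : nat) : set M :=
  if n is m.+1 then A m else B.

(* The Jones tower of B `<=` A 0; idx is [A:B]_0, E n : A_n -> A_{n-1} and
   e n is the Jones projection e_n, for n >= 1 (e 0 is not used). *)
Record jones_tower B (A : nat -> set M) (E : nat -> M -> M) (e : nat -> M)
    (idx : R) : Prop := {
  jt_B : cstar_subalgebra B ;
  jt_A : forall n, cstar_subalgebra (A n) ;
  jt_sub : B `<=` A 0%N ;
  jt_minimal : minimal_cond_exp (A 0%N) B (E 0%N) idx ;
  jt_basic : forall n,
    basic_construction (prev_alg B A n) (A n) (A n.+1) (E n) (e n.+1) ;
  jt_cond_exp : forall n, cond_exp (A n.+1) (A n) (E n.+1) ;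
  jt_dual : forall n x y, A n x -> A n y ->
    E n.+1 (x * e n.+1 * y) = idx^-1%:C *: (x * y)
}.

(* Continuous functional calculus f(a) for self-adjoint a: the norm limit of
   P(a) as the polynomials P converge to f uniformly on the spectrum of a. *)
Definition real_spectrum a : set R :=
  [set t | ~ exists y, (a - t%:C%:A) * y = 1 /\ y * (a - t%:C%:A) = 1].

Definition is_cfc (f : R -> R) a y : Prop :=
  forall eps : R, 0 < eps -> exists P : {poly R[i]},
    (forall t : R, real_spectrum a t -> `|P.[t%:C] - (f t)%:C| < eps%:C) /\
    cnorm (horner_alg a P - y) < eps.

Definition cfc (f : R -> R) a : M := xget 0 [set y | is_cfc f a y].

Definition abs_elt x : M := cfc Num.sqrt (star x * x).

(* |x|^p *)
Definition abs_pow x (p : R) : M := cfc (fun t => t `^ p) (abs_elt x).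

Section Trace.
Variable E : nat -> M -> M.

(* E_0 o E_1 o ... o E_n *)
Fixpoint comp_exp (n : nat) x : M :=
  if n is m.+1 then comp_exp m (E n x) else E 0%N x.

(* On B' :&: A_n the values of E_0 o ... o E_n are scalars: they lie in the
   centre of the simple algebra B. *)
Definition tr (n : nat) x : R[i] := xget 0 [set c : R[i] | comp_exp n x = c%:A].

(* The operator norm for p = +oo; the value for p = -oo is junk. *)
Definition lpnorm (n : nat) (p : \bar R) x : R :=
  match p with
  | r%:E => complex.Re (tr n (abs_pow x r)) `^ r^-1
  | +oo%E => cnorm x
  | -oo%E => 0
  end.

(* k is the minimal trace of a nonzero projection of D, with D `<=` A_n. *)
Definition min_proj_trace (n : nat) D (k : R) : Prop :=
  (exists x, [/\ D x, projection x, x <> 0 & tr n x = k%:C]) /\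
  forall x, D x -> projection x -> x <> 0 -> k%:C <= tr n x.

(* F is the trace-preserving conditional expectation of C onto D, with
   D `<=` C `<=` A_n. *)
Definition trace_cond_exp (n : nat) C D (F : M -> M) : Prop :=
  cond_exp C D F /\ forall x, C x -> tr n (F x) = tr n x.

End Trace.

Section Fourier.
Variables (e : nat -> M) (tau : R).

(* v_n = e_n e_{n-1} ... e_1 *)
Fixpoint jones_word (n : nat) : M :=
  if n is m.+1 then e n * jones_word m else 1.

(* F_n, where F is the trace-preserving conditional expectation of
   B' :&: A_{n+1} onto A' :&: A_{n+1}. *)
Definition fourier (F : M -> M) (n : nat) x : M :=
  (tau `^ (- (n.+2%:R / 2)))%:C *: F (x * jones_word n.+1).

Definition fourier_inv (E : nat -> M -> M) (n : nat) x : M :=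
  (tau `^ (- (n.+2%:R / 2)))%:C *: E n.+1 (x * star (jones_word n.+1)).

End Fourier.

End CStar.

(* Main.v *)
(* The Fourier transform is an isometry for the 2-norms, and
   x |-> tr (F_n(x) w) is the form c tr (x v_{n+1} w), c = tau^(-(n+2)/2).
   Conjugating by a quasi-basis of the minimal expectation E_0 averages
   B' :&: A_n onto A' :&: A_n without changing the trace; with Cauchy-Schwarz
   this bounds |c tr (u v_{n+1} r)| by (delta / kappa) tr (u^* u) tr (r^* r) for
   partial isometries u and r.  Decomposing x and F_n(x) into partial isometries
   leaves a finite matrix to interpolate between this bound and the 2-norm bound:
   its m-th tensor power is constant on types up to a polynomial number of
   classes, so the polynomial loss disappears in the m-th root.  The lower bounds
   are monotonicity of the norms in p combined with the isometry at p = 2.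

   The finite-dimensionality and traciality behind this come from sphericality:
   minimality of E_0 forces sum_i z_i x z_i^* = idx E_0(x) for x in B' :&: A, a
   property inherited by every E_n and by their composites; it makes the trace
   tracial and bounds the size of orthonormal families in B' :&: A_n. *)
Require Import Defs.
From HB Require Import structures.
From mathcomp Require Import all_boot all_order all_algebra.
From mathcomp Require Import complex.
From mathcomp Require Import all_classical all_reals all_analysis.
From mathcomp Require Import ring lra.

Set Implicit Arguments.
Unset Strict Implicit.
Unset Printing Implicit Defensive.

Import Order.TTheory GRing.Theory Num.Theory.
Import numFieldNormedType.Exports.

Local Open Scope classical_set_scope.
Local Open Scope complex_scope.
Local Open Scope ring_scope.

(** * Noncommutative ring identities *)

(** The algebra is known only through its norm, so positivity is rebuilt from the norm: a
    self-adjoint [a] is in effect positive when it lies within [t] of some scalar [t]. No dimension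
    is ever counted: each element of a relative commutant gets an annihilating polynomial, which
    suffices for spectral projections and singular values. Tensor powers stand in for complex
    interpolation. A vector's power is constant on a type class, so one number per pair of classes
    is to be estimated, and a geometric mean of the two endpoint bounds does it. The endpoint bound
    on partial isometries explains the constant. Cauchy-Schwarz leaves two squares, each containing
    an average of a projection, and that average lies one level lower in the tower; a positive [h]
    there is at most [tr h] divided by the minimal trace of a projection. Hence [kappa_(n-1)] rather
    than [kappa_n], and a geometric mean of two minimal traces. Part (ii) needs no second estimate:
    the inverse transform is the adjoint one, and its form is the conjugate of the first. *)

(* nc_ring proves equations in a noncommutative R[i]-algebra by reflection to lists
   of words; ring only handles the coefficients. *)
Section NoncommutativeRing.
Variables (K : comNzRingType) (T : algType K).

Inductive nc_expr :=
  | NcVar of nat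
  | NcOne
  | NcZero
  | NcMuln of nc_expr & nat
  | NcAdd of nc_expr & nc_expr
  | NcOpp of nc_expr
  | NcMul of nc_expr & nc_expr
  | NcScale of K & nc_expr.

Definition nc_poly := seq (K * seq nat).

Fixpoint nc_eval (env : seq T) (x : nc_expr) : T :=
  match x with
  | NcVar i => nth 0 env i
  | NcOne => 1
  | NcZero => 0
  | NcMuln x n => nc_eval env x *+ n
  | NcAdd x y => nc_eval env x + nc_eval env y
  | NcOpp x => - nc_eval env x
  | NcMul x y => nc_eval env x * nc_eval env y
  | NcScale c x => c *: nc_eval env x
  end.

Definition nc_monom (env : seq T) (m : seq nat) : T :=
  foldr (fun i y => nth 0 env i * y) 1 m.

Definition nc_sum (env : seq T) (P : nc_poly) : T :=
  foldr (fun cm y => cm.1 *: nc_monom env cm.2 + y) 0 P.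

(** [nc_ring] evaluates by [cbv] on an explicit list of constants; private copies of the list
    operations can be unfolded there while the coefficients stay untouched. *)
Fixpoint nc_cat (P Q : nc_poly) : nc_poly :=
  if P is cm :: P' then cm :: nc_cat P' Q else Q.

Fixpoint nc_scale (c : K) (P : nc_poly) : nc_poly :=
  if P is cm :: P' then (c * cm.1, cm.2) :: nc_scale c P' else [::].

Fixpoint nc_app (l m : seq nat) : seq nat :=
  if l is i :: l' then i :: nc_app l' m else m.

Fixpoint nc_mulm (c : K) (m : seq nat) (P : nc_poly) : nc_poly :=
  if P is cm :: P' then (c * cm.1, nc_app m cm.2) :: nc_mulm c m P' else [::].

Fixpoint nc_mul (P Q : nc_poly) : nc_poly :=
  if P is cm :: P' then nc_cat (nc_mulm cm.1 cm.2 Q) (nc_mul P' Q) else [::].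

Fixpoint nc_norm (x : nc_expr) : nc_poly :=
  match x with
  | NcVar i => [:: (1, [:: i])]
  | NcOne => [:: (1, [::])]
  | NcZero => [::]
  | NcMuln x n => nc_scale n%:R (nc_norm x)
  | NcAdd x y => nc_cat (nc_norm x) (nc_norm y)
  | NcOpp x => nc_scale (- 1) (nc_norm x)
  | NcMul x y => nc_mul (nc_norm x) (nc_norm y)
  | NcScale c x => nc_scale c (nc_norm x)
  end.

Fixpoint nc_eqm (l m : seq nat) : bool :=
  match l, m with
  | [::], [::] => true
  | i :: l', j :: m' => if Nat.eqb i j then nc_eqm l' m' else false
  | _, _ => false
  end.

Fixpoint nc_insert (c : K) (m : seq nat) (P : nc_poly) : nc_poly :=
  if P is cm :: P' then
    if nc_eqm m cm.2 then (c + cm.1, cm.2) :: P' else cm :: nc_insert c m P'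
  else [:: (c, m)].

Fixpoint nc_collect (P : nc_poly) : nc_poly :=
  if P is cm :: P' then nc_insert cm.1 cm.2 (nc_collect P') else [::].

(** Vanishing of the coefficients is a proposition and not a test: equality in [K] is left to [ring]
    or [field]. *)
Fixpoint nc_null (P : nc_poly) : Prop :=
  if P is cm :: P' then cm.1 = 0 /\ nc_null P' else True.

Lemma nc_sum_cat env P Q : nc_sum env (nc_cat P Q) = nc_sum env P + nc_sum env Q.
Proof. by elim: P => [|cm P IH] /=; rewrite ?add0r // IH addrA. Qed.

Lemma nc_sum_scale env c P : nc_sum env (nc_scale c P) = c *: nc_sum env P.
Proof.
by elim: P => [|cm P IH] /=; rewrite ?scaler0 // IH scalerDr scalerA.
Qed.

Lemma nc_monom_app env l m :
  nc_monom env (nc_app l m) = nc_monom env l * nc_monom env m.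
Proof. by elim: l => [|i l IH] /=; rewrite ?mul1r // IH mulrA. Qed.

Lemma nc_sum_mulm env c m P :
  nc_sum env (nc_mulm c m P) = (c *: nc_monom env m) * nc_sum env P.
Proof.
elim: P => [|cm P IH] /=; first by rewrite mulr0.
by rewrite IH mulrDr nc_monom_app -scalerAl -scalerAl -scalerAr scalerA.
Qed.

Lemma nc_sum_mul env P Q : nc_sum env (nc_mul P Q) = nc_sum env P * nc_sum env Q.
Proof.
elim: P => [|cm P IH] /=; first by rewrite mul0r.
by rewrite nc_sum_cat nc_sum_mulm IH mulrDl.
Qed.

Lemma nc_sum_norm env x : nc_sum env (nc_norm x) = nc_eval env x.
Proof.
elim: x => [i|||x IH n|x IHx y IHy|x IH|x IHx y IHy|c x IH] /=.
- by rewrite addr0 mulr1 scale1r.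
- by rewrite addr0 scale1r.
- by [].
- by rewrite nc_sum_scale IH scaler_nat.
- by rewrite nc_sum_cat IHx IHy.
- by rewrite nc_sum_scale IH scaleN1r.
- by rewrite nc_sum_mul IHx IHy.
- by rewrite nc_sum_scale IH.
Qed.

Lemma nc_eqmP l m : nc_eqm l m -> l = m.
Proof.
elim: l m => [|i l IH] [|j m] //=.
by case: ifP => // /PeanoNat.Nat.eqb_eq -> /IH ->.
Qed.

Lemma nc_sum_collect env P : nc_sum env (nc_collect P) = nc_sum env P.
Proof.
have ins c m Q : nc_sum env (nc_insert c m Q) = c *: nc_monom env m + nc_sum env Q.
  elim: Q => [|cm Q IH] //=; case: ifP => [/nc_eqmP->|_] /=.
    by rewrite scalerDl addrA.
  by rewrite IH addrCA.
by elim: P => [|cm P IH] //=; rewrite ins IH.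
Qed.

Lemma nc_eval_eq env x y :
  nc_null (nc_collect (nc_norm (NcAdd x (NcOpp y)))) -> nc_eval env x = nc_eval env y.
Proof.
move=> null; apply/subr0_eq.
rewrite -[_ - _]/(nc_eval env (NcAdd x (NcOpp y))) -nc_sum_norm -nc_sum_collect.
by elim: (nc_collect _) null => [|[c m] P IH] //= [-> /IH->]; rewrite scale0r addr0.
Qed.

End NoncommutativeRing.

Ltac nc_lookup x env :=
  lazymatch env with
  | ?y :: ?env' =>
      match env' with
      | _ => let _ := match env' with _ => constr_eq x y end in constr:(O)
      | _ => let i := nc_lookup x env' in constr:(S i)
      end
  end.

Ltac nc_atoms x env :=
  lazymatch x with
  | (?a + ?b)%R => let env := nc_atoms a env in nc_atoms b env
  | (?a * ?b)%R => let env := nc_atoms a env in nc_atoms b env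
  | (- ?a)%R => nc_atoms a env
  | (_ *: ?a)%R => nc_atoms a env
  | (?a *+ _)%R => nc_atoms a env
  | 1%R => env
  | 0%R => env
  | _ => match env with
         | _ => let _ := nc_lookup x env in env
         | _ => constr:(x :: env)
         end
  end.

Ltac nc_reify K x env :=
  lazymatch x with
  | (?a + ?b)%R => let a := nc_reify K a env in let b := nc_reify K b env in
                   constr:(@NcAdd K a b)
  | (?a * ?b)%R => let a := nc_reify K a env in let b := nc_reify K b env in
                   constr:(@NcMul K a b)
  | (- ?a)%R => let a := nc_reify K a env in constr:(@NcOpp K a)
  | (?c *: ?a)%R => let a := nc_reify K a env in constr:(@NcScale K c a)
  | (?a *+ ?n)%R => let a := nc_reify K a env in constr:(@NcMuln K a n)
  | 1%R => constr:(@NcOne K)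
  | 0%R => constr:(@NcZero K)
  | _ => let i := nc_lookup x env in constr:(@NcVar K i)
  end.

Ltac nc_ring :=
  rewrite ?expr2;
  lazymatch goal with
  | |- @eq ?T ?x ?y =>
      let R := lazymatch goal with R : realType |- _ => R end in
      let K := constr:((complex (Real.sort R)) : comNzRingType) in
      let env := nc_atoms x (@nil T) in
      let env := nc_atoms y env in
      let x' := nc_reify K x env in
      let y' := nc_reify K y env in
      refine (@nc_eval_eq K _ env x' y' _);
      cbv [nc_null nc_collect nc_insert nc_norm nc_scale nc_cat nc_app nc_mul
           nc_mulm nc_eqm Nat.eqb fst snd];
      repeat split; try solve [ring | by field]
  end.

(** * Norms, square roots and positivity *)

Section CStarNorm.
Context {R : realType} {M : cstarAlgType R}.
Implicit Types (x y z a h : M) (t : R) (c : R[i]).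

Lemma conj_real t : (t%:C)^* = t%:C :> R[i].
Proof. exact: conjc_real. Qed.

Lemma starZr t x : star (t%:C *: x) = t%:C *: star x.
Proof. by rewrite starZ conj_real. Qed.

Lemma star0 : star (0 : M) = 0.
Proof. by have := starZ 0 (0 : M); rewrite conjC0 !scale0r. Qed.

Lemma starN x : star (- x) = - star x.
Proof. by rewrite -scaleN1r starZ rmorphN1 scaleN1r. Qed.

Lemma starB x y : star (x - y) = star x - star y.
Proof. by rewrite starD starN. Qed.

Lemma star1 : star (1 : M) = 1.
Proof. by rewrite -[RHS]starK -[star 1]mulr1 starM starK mulr1. Qed.

Lemma star_sum I (r : seq I) (P : pred I) (f : I -> M) :
  star (\sum_(i <- r | P i) f i) = \sum_(i <- r | P i) star (f i).
Proof. exact: (big_morph _ starD star0). Qed.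

Lemma cnormZr t x : cnorm (t%:C *: x) = `|t| * cnorm x.
Proof. by rewrite cnormZ normc_def /= expr0n addr0 sqrtr_sqr. Qed.

Lemma cnorm0 : cnorm (0 : M) = 0.
Proof. by rewrite -(scale0r (0 : M)) cnormZ normr0 mul0r. Qed.

Lemma cnormN x : cnorm (- x) = cnorm x.
Proof. by rewrite -scaleN1r cnormZ normrN normr1 mul1r. Qed.

Lemma cnorm_ge0 x : 0 <= cnorm x.
Proof.
have := cnormD x (- x); rewrite subrr cnorm0 cnormN => h.
by rewrite -(pmulrn_lge0 _ (n := 2)) // mulr2n.
Qed.

Lemma cnormB x y : cnorm (x - y) <= cnorm x + cnorm y.
Proof. by rewrite -(cnormN y) cnormD. Qed.

Lemma cnormC x y : cnorm (x - y) = cnorm (y - x).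
Proof. by rewrite -cnormN opprB. Qed.

Lemma cnorm1 : cnorm (1 : M) = 1.
Proof.
have := cnorm_star (1 : M); rewrite star1 mulr1 expr2 => h.
have n0 : cnorm (1 : M) != 0 by apply/eqP => /cnorm0_eq0/eqP; rewrite oner_eq0.
by apply: (mulfI n0); rewrite -h mulr1.
Qed.

Lemma cnorm_scalar t : cnorm (t%:C%:A : M) = `|t|.
Proof. by rewrite cnormZr cnorm1 mulr1. Qed.

Lemma cnorm_starE x : cnorm (star x) = cnorm x.
Proof.
have le y : cnorm y <= cnorm (star y).
  have [->|n0] := eqVneq (cnorm y) 0; first exact: cnorm_ge0.
  have p : 0 < cnorm y by rewrite lt_neqAle eq_sym n0 cnorm_ge0.
  by rewrite -(ler_pM2r p) -expr2 -cnorm_star cnormM.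
by apply/le_anti; rewrite le andbT -{2}(starK x) le.
Qed.

Lemma cnorm_sum I (r : seq I) (P : pred I) (f : I -> M) :
  cnorm (\sum_(i <- r | P i) f i) <= \sum_(i <- r | P i) cnorm (f i).
Proof.
elim/big_rec2 : _ => [|i s x _ h]; first by rewrite cnorm0.
by apply: le_trans (cnormD _ _) _; rewrite lerD2l.
Qed.

Lemma cnorm_small_eq0 x : (forall eps, 0 < eps -> cnorm x <= eps) -> x = 0.
Proof.
move=> h; apply: cnorm0_eq0; apply/le_anti; rewrite cnorm_ge0 andbT.
by apply/ler_addgt0Pr => e e0; rewrite add0r h.
Qed.

Lemma cnorm_sqr_sa a : star a = a -> cnorm (a * a) = cnorm a ^+ 2.
Proof. by move=> sa; rewrite -cnorm_star sa. Qed.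

Lemma scalar_inj c c' : c%:A = c'%:A :> M -> c = c'.
Proof.
move=> /eqP; rewrite -subr_eq0 -scalerBl scaler_eq0 oner_eq0 orbF subr_eq0.
by move/eqP.
Qed.

Lemma sa_re_im x :
  exists h k, [/\ star h = h, star k = k, x = h + 'i *: k,
    h = 2^-1%:C *: (x + star x) & k = (- 'i * 2^-1%:C) *: (x - star x)].
Proof.
have half : 2^-1%:C + 2^-1%:C = 1 :> R[i] by rewrite -rmorphD; have -> : 2^-1 + 2^-1 = 1 :> R by lra.
exists (2^-1%:C *: (x + star x)), ((- 'i * 2^-1%:C) *: (x - star x)); split => //.
- by rewrite starZr starD starK addrC.
- rewrite starZ starB starK -opprB scalerN -scaleNr; congr (_ *: _).
  by rewrite rmorphM rmorphN /= conjCi conj_real opprK mulNr.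
- have i2 : 'i * (- 'i * 2^-1%:C) = 2^-1%:C :> R[i].
    by rewrite mulrA mulrN -expr2 sqrCi opprK mul1r.
  by rewrite scalerA i2 -scalerDr addrACA subrr addr0 scalerDr -scalerDl half scale1r.
Qed.

Lemma cvg_small (u : nat -> M) l :
  cnorm (u n - l) @[n --> \oo] --> (0 : R) ->
  forall eps, 0 < eps -> exists N, forall n, (N <= n)%N -> cnorm (u n - l) < eps.
Proof.
move=> /cvgrPdist_lt h eps e0; have [N _ hN] := h _ e0.
by exists N => n Nn; have := hN _ Nn; rewrite sub0r normrN ger0_norm ?cnorm_ge0.
Qed.

Lemma geometric_cvg (u : nat -> M) (K rho : R) : 0 <= rho -> rho < 1 ->
  (forall n, cnorm (u n.+1 - u n) <= K * rho ^+ n) ->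
  exists l, cnorm (u n - l) @[n --> \oo] --> (0 : R).
Proof.
move=> r0 r1 hu; apply: cnorm_complete => eps e0.
have K0 : 0 <= K by have := le_trans (cnorm_ge0 _) (hu 0%N); rewrite expr0 mulr1.
have r1' : 0 < 1 - rho by rewrite subr_gt0.
have tail m k : cnorm (u (m + k)%N - u m) <= K * rho ^+ m * (1 - rho ^+ k) / (1 - rho).
  elim: k => [|k IH]; first by rewrite addn0 subrr cnorm0 expr0 subrr mulr0 mul0r.
  rewrite addnS -(subrK (u (m + k)%N) (u _.+1)) -addrA.
  apply: le_trans (cnormD _ _) _; apply: le_trans (lerD (hu _) IH) _.
  rewrite le_eqVlt; apply/orP; left; apply/eqP.
  rewrite exprD exprS; have n0 : 1 - rho != 0 by rewrite gt_eqF.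
  by field.
have [N hN] : exists N, K / (1 - rho) * rho ^+ N < eps / 2.
  have /cvgrPdist_lt h : K / (1 - rho) * rho ^+ n @[n --> \oo] --> (0 : R).
    rewrite -[X in _ --> X](mulr0 (K / (1 - rho))); apply: cvgMr.
    by apply: cvg_expr; rewrite ger0_norm.
  have [N _ hN] := h _ (divr_gt0 e0 (ltr0Sn _ 1)); exists N.
  have := hN N (leqnn N); rewrite /= sub0r normrN ger0_norm //.
  by rewrite mulr_ge0 ?exprn_ge0 // divr_ge0 // ltW.
exists N => m n Nm Nn.
have close k : (N <= k)%N -> cnorm (u k - u N) < eps / 2.
  move=> /subnKC <-; apply: le_lt_trans (tail _ _) (le_lt_trans _ hN).
  rewrite [leRHS]mulrAC ler_pM2r ?invr_gt0 // ler_piMr //.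
    by rewrite mulr_ge0 ?exprn_ge0.
  by rewrite lerBlDr lerDl exprn_ge0.
rewrite -(subrK (u N) (u m)) -addrA.
apply: le_lt_trans (cnormD _ _) _; rewrite (splitr eps) ltrD ?close //.
by rewrite cnormC close.
Qed.

End CStarNorm.

(** * Neumann series and square roots near the unit *)

Section Positivity.
Context {R : realType} {M : cstarAlgType R}.
Implicit Types (x y z a h u v g : M) (t eps T : R).

Local Notation scal t := (t%:C%:A : M).

Definition invertible x : Prop := exists y, x * y = 1 /\ y * x = 1.

Lemma star_scal t : star (scal t) = scal t.
Proof. by rewrite starZr star1. Qed.

Lemma scalD t eps : scal (t + eps) = scal t + scal eps.
Proof. by rewrite rmorphD scalerDl. Qed.

Lemma scalN t : scal (- t) = - scal t.
Proof. by rewrite rmorphN scaleNr. Qed.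

Lemma scalB t eps : scal (t - eps) = scal t - scal eps.
Proof. by rewrite scalD scalN. Qed.

Lemma comm_scal t x : x * scal t = scal t * x.
Proof. by rewrite -scalerAl -scalerAr mul1r mulr1. Qed.

Lemma cnormX x n : cnorm (x ^+ n) <= cnorm x ^+ n.
Proof.
elim: n => [|n IH]; first by rewrite !expr0 cnorm1.
rewrite !exprS; apply: le_trans (cnormM _ _) _.
by rewrite ler_wpM2l // cnorm_ge0.
Qed.

Lemma cstar_subalgebraT : cstar_subalgebra [set: M].
Proof. by split. Qed.

Lemma csub0 (S : set M) : cstar_subalgebra S -> S 0.
Proof. by move=> hS; rewrite -(scale0r (1 : M)); apply: csub_scale; last apply: csub_one. Qed.

Lemma csubN (S : set M) x : cstar_subalgebra S -> S x -> S (- x).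
Proof. by move=> hS Sx; rewrite -scaleN1r; apply: csub_scale. Qed.

Lemma csubB (S : set M) x y : cstar_subalgebra S -> S x -> S y -> S (x - y).
Proof. by move=> hS Sx Sy; apply: csub_add => //; apply: csubN. Qed.

Lemma csub_sum (S : set M) I (r : seq I) (P : pred I) (f : I -> M) :
  cstar_subalgebra S -> (forall i, P i -> S (f i)) -> S (\sum_(i <- r | P i) f i).
Proof.
move=> hS hf; elim/big_ind : _ => //; first exact: csub0.
by move=> x y; apply: csub_add.
Qed.

Lemma csubX (S : set M) x n : cstar_subalgebra S -> S x -> S (x ^+ n).
Proof.
move=> hS Sx; elim: n => [|n IH]; first by rewrite expr0; apply: csub_one.
by rewrite exprS; apply: csub_mul.
Qed.

(** The norm limit of the geometric series stays in the closed subalgebra [S]. Membership and the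
    norm bound serve in [minimal_spherical], where such an inverse enters a new quasi-basis. *)
Lemma neumann (S : set M) h : cstar_subalgebra S -> S h -> cnorm h < 1 ->
  exists y, [/\ S y, (1 - h) * y = 1, y * (1 - h) = 1 &
    cnorm y <= (1 - cnorm h)^-1].
Proof.
move=> hS Sh h1; pose u n := \sum_(i < n) h ^+ i.
have uS n : u n.+1 = u n + h ^+ n by rewrite /u big_ord_recr.
have [n|l ul] := @geometric_cvg _ _ u 1 (cnorm h) (cnorm_ge0 _) h1.
  by rewrite uS addrC addKr mul1r cnormX.
have hl n : (1 - h) * u n = 1 - h ^+ n.
  elim: n => [|n IH]; first by rewrite /u big_ord0 mulr0 expr0 subrr.
  by rewrite uS mulrDr IH mulrBl mul1r exprS addrA subrK.
have hr n : u n * (1 - h) = 1 - h ^+ n.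
  elim: n => [|n IH]; first by rewrite /u big_ord0 mul0r expr0 subrr.
  by rewrite uS mulrDl IH mulrBr mulr1 exprSr addrA subrK.
have small eps : 0 < eps ->
    exists n, cnorm (l - u n) < eps /\ cnorm (h ^+ n) < eps.
  move=> e0; have [N1 hN1] := cvg_small ul e0.
  have /cvgrPdist_lt hp : cnorm h ^+ n @[n --> \oo] --> (0 : R).
    by apply: cvg_expr; rewrite ger0_norm ?cnorm_ge0.
  have [N2 _ hN2] := hp _ e0; exists (maxn N1 N2); split.
    by rewrite cnormC hN1 // leq_maxl.
  have := hN2 (maxn N1 N2) (leq_maxr _ _).
  rewrite /= sub0r normrN ger0_norm ?exprn_ge0 ?cnorm_ge0 //.
  exact: le_lt_trans (cnormX _ _).
have C0 : 0 < cnorm (1 - h) + 1 by rewrite ltr_wpDl ?cnorm_ge0.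
have eql : (1 - h) * l = 1.
  apply/subr0_eq/cnorm_small_eq0 => eps e0.
  have [n [h1n h2n]] := small _ (divr_gt0 e0 C0).
  have -> : (1 - h) * l - 1 = (1 - h) * (l - u n) - h ^+ n.
    by rewrite mulrBr hl; nc_ring.
  apply: le_trans (cnormB _ _) (le_trans (lerD (cnormM _ _) (lexx _)) _).
  have := divfK (lt0r_neq0 C0) eps; have := cnorm_ge0 (1 - h).
  by move: h1n h2n; move: (cnorm _) (cnorm _) (cnorm _) (eps / _) => a b c k; nra.
have eqr : l * (1 - h) = 1.
  apply/subr0_eq/cnorm_small_eq0 => eps e0.
  have [n [h1n h2n]] := small _ (divr_gt0 e0 C0).
  have -> : l * (1 - h) - 1 = (l - u n) * (1 - h) - h ^+ n.
    by rewrite mulrBl hr; nc_ring.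
  apply: le_trans (cnormB _ _) (le_trans (lerD (cnormM _ _) (lexx _)) _).
  have := divfK (lt0r_neq0 C0) eps; have := cnorm_ge0 (1 - h).
  by move: h1n h2n; move: (cnorm _) (cnorm _) (cnorm _) (eps / _) => a b c k; nra.
exists l; split => //.
  apply: (csub_closed hS) ul => n.
  by apply: csub_sum => // i _; apply: csubX.
have p : 0 < 1 - cnorm h by rewrite subr_gt0.
rewrite -[leRHS]mul1r ler_pdivlMr // mulrBr mulr1 lerBlDr.
have {1}-> : l = 1 + l * h by rewrite -[X in X + _]eqr mulrBr mulr1 subrK.
by apply: le_trans (cnormD _ _) _; rewrite cnorm1 lerD2l cnormM.
Qed.

(* The iteration u |-> (h + u^2)/2 converges to 1 - sqrt (1 - h). *)
Lemma sqrt_one_sub h : star h = h -> cnorm h < 1 ->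
  exists y, [/\ star y = y, cnorm y <= cnorm h, (1 - y) * (1 - y) = 1 - h &
    forall z, z * h = h * z -> z * y = y * z].
Proof.
move=> sh h1; pose rho := cnorm h; have r0 : 0 <= rho by exact: cnorm_ge0.
pose u n := iter n (fun y => 2^-1%:C *: (h + y * y)) 0.
have uS n : u n.+1 = 2^-1%:C *: (h + u n * u n) by [].
have half0 : 0 <= 2^-1 :> R by rewrite invr_ge0.
have ub n : cnorm (u n) <= rho.
  elim: n => [|n IH]; first by rewrite cnorm0.
  rewrite uS cnormZr ger0_norm //.
  have : cnorm (h + u n * u n) <= rho + rho * rho.
    apply: le_trans (cnormD _ _) _; rewrite lerD2l.
    by apply: le_trans (cnormM _ _) _; rewrite ler_pM ?cnorm_ge0.
  move: (cnorm _) => c; rewrite -/rho in h1; nra.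
have su n : star (u n) = u n.
  elim: n => [|n IH]; first exact: star0.
  by rewrite uS starZr starD starM IH sh.
have cu z : z * h = h * z -> forall n, z * u n = u n * z.
  move=> zh; elim=> [|n IH]; first by rewrite mulr0 mul0r.
  by rewrite uS -scalerAl -scalerAr mulrDr mulrDl zh mulrA IH -mulrA IH mulrA.
have [n|l ul] := @geometric_cvg _ _ u (cnorm (u 1%N - u 0%N)) rho r0 h1.
  elim: n => [|n IH]; first by rewrite expr0 mulr1.
  (* Both iterates have norm at most [rho], so this is at most [rho] times the previous
     difference. *)
  have -> : u n.+2 - u n.+1 =
      2^-1%:C *: ((u n.+1 - u n) * u n.+1 + u n * (u n.+1 - u n)).
    by rewrite !(uS n.+1) (uS n); nc_ring.
  rewrite cnormZr ger0_norm // exprS mulrCA.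
  set d := cnorm (u n.+1 - u n) in IH *.
  have d0 : 0 <= d by exact: cnorm_ge0.
  have : cnorm ((u n.+1 - u n) * u n.+1 + u n * (u n.+1 - u n)) <= d * rho + rho * d.
    apply: le_trans (cnormD _ _) _; apply: lerD; apply: le_trans (cnormM _ _) _.
      by rewrite ler_wpM2l.
    by rewrite ler_wpM2r.
  move: (cnorm _) (_ * rho ^+ n) IH => c b IH; nra.
have small eps : 0 < eps -> exists n, cnorm (l - u n) < eps /\ cnorm (l - u n.+1) < eps.
  move=> e0; have [N hN] := cvg_small ul e0.
  by exists N; rewrite !(cnormC l) !hN.
have lb : cnorm l <= rho.
  apply/ler_addgt0Pr => eps /small[n [hn _]].
  rewrite -(subrK (u n) l) addrC; apply: le_trans (cnormD _ _) _.
  by rewrite lerD // ltW.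
have eq2 : l + l = h + l * l.
  apply/subr0_eq/cnorm_small_eq0 => eps e0.
  have e4 : 0 < eps / 4 by rewrite divr_gt0.
  have [n [hn hn1]] := small _ e4.
  have -> : l + l - (h + l * l) = (l - u n.+1) + (l - u n.+1)
      - ((l - u n) * u n + l * (l - u n)) by rewrite uS; nc_ring.
  apply: le_trans (cnormB _ _) (le_trans (lerD (cnormD _ _) (cnormD _ _)) _).
  have := cnormM (l - u n) (u n); have := cnormM l (l - u n); have := ub n.
  have := cnorm_ge0 (l - u n); rewrite -/rho in h1.
  move: hn hn1 lb (cnorm_ge0 l) (cnorm_ge0 (u n)).
  move: (cnorm (l - u n)) (cnorm (l - u n.+1)) (cnorm l) (cnorm (u n)) => a b c d.
  move: (cnorm _) (cnorm _) => a' b' *; nra.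
have sl : star l = l.
  apply/subr0_eq/cnorm_small_eq0 => eps e0.
  have [n [hn _]] := small _ (divr_gt0 e0 (ltr0Sn _ 1)).
  have -> : star l - l = star (l - u n) - (l - u n) by rewrite starB su; nc_ring.
  apply: le_trans (cnormB _ _) _; rewrite cnorm_starE (splitr eps).
  by rewrite lerD // ltW.
exists l; split => //.
  have -> : (1 - l) * (1 - l) = 1 - (l + l) + l * l by nc_ring.
  by rewrite eq2; nc_ring.
move=> z zh; apply/subr0_eq/cnorm_small_eq0 => eps e0.
have C0 : 0 < cnorm z + cnorm z + 1 by rewrite ltr_wpDl ?addr_ge0 ?cnorm_ge0.
have [n [hn _]] := small _ (divr_gt0 e0 C0).
have -> : z * l - l * z = z * (l - u n) - (l - u n) * z.
  by rewrite mulrBr mulrBl (cu z zh); nc_ring.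
apply: le_trans (cnormB _ _) _.
apply: (le_trans (lerD (cnormM _ _) (cnormM _ _))).
move: hn; rewrite ltr_pdivlMr //.
have := cnorm_ge0 (l - u n); have := cnorm_ge0 z.
move: (cnorm z) (cnorm (l - u n)) => a b *; nra.
Qed.

End Positivity.

(** * Positive elements, up to the positivity of [star x * x] *)

Section PositiveElements.
Context {R : realType} {M : cstarAlgType R}.
Implicit Types (x y z a b h k u v g : M) (t s eps T : R).

Local Notation scal t := (t%:C%:A : M).

(** Roots are asked only of [a + eps], because [sqrt_one_sub] needs a norm strictly below 1. Each
    root commutes with the whole commutant of [a], so that roots of commuting elements commute. *)
Definition cpos a : Prop := star a = a /\ forall eps, 0 < eps ->
  exists k, [/\ star k = k, k * k = a + scal eps & forall z, z * a = a * z -> z * k = k * z].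

Lemma comm_add_scal z a t : z * a = a * z -> z * (a + scal t) = (a + scal t) * z.
Proof. by move=> h; rewrite mulrDr mulrDl h comm_scal. Qed.

Lemma comm_sub_scal z a t : z * a = a * z -> z * (scal t - a) = (scal t - a) * z.
Proof. by move=> h; rewrite mulrBr mulrBl h comm_scal. Qed.

(** With [h = (t - a) / (t + eps)] one has [a + eps = (t + eps) (1 - h)] and [cnorm h < 1]. The last
    clause places the root itself near a scalar, which makes the root positive by [cpos_near]. *)
Lemma sqrt_near a t eps : star a = a -> cnorm (scal t - a) <= t -> 0 < eps ->
  exists k, [/\ star k = k, k * k = a + scal eps,
    forall z, z * a = a * z -> z * k = k * z &
    exists2 r : R, 0 <= r & cnorm (scal r - k) <= r].
Proof.
move=> sa at_le e0; have t0 := le_trans (cnorm_ge0 _) at_le.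
have te0 : 0 < t + eps by lra.
pose h := (t + eps)^-1%:C *: (scal t - a).
have h1 : cnorm h < 1.
  rewrite cnormZr ger0_norm ?invr_ge0 ?ltW // mulrC ltr_pdivrMr // mul1r.
  by apply: le_lt_trans at_le _; rewrite ltrDl.
have sh : star h = h by rewrite starZr starB star_scal sa.
have [y [sy ny y2 cy]] := sqrt_one_sub sh h1.
have r0 : 0 <= Num.sqrt (t + eps) by exact: sqrtr_ge0.
exists ((Num.sqrt (t + eps))%:C *: (1 - y)); split.
- by rewrite starZr starB star1 sy.
- rewrite -scalerAl -scalerAr scalerA -rmorphM -expr2 sqr_sqrtr ?(ltW te0) // y2.
  rewrite scalerBr scalerA -rmorphM divff ?gt_eqF // scalD scale1r.
  by nc_ring.
- move=> z za; rewrite -scalerAl -scalerAr mulrBr mulrBl mulr1 mul1r cy //.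
  by rewrite -scalerAl -scalerAr (comm_sub_scal _ za).
- exists (Num.sqrt (t + eps)) => //.
  rewrite scalerBr opprB addrC subrK cnormZr ger0_norm //.
  by rewrite ler_piMr // (le_trans ny) // ltW.
Qed.

Lemma cpos_near a t : star a = a -> cnorm (scal t - a) <= t -> cpos a.
Proof.
by move=> sa at_le; split => // eps /(sqrt_near sa at_le)[k [? ? ? _]]; exists k.
Qed.

Lemma cpos_scal t : 0 <= t -> cpos (scal t).
Proof.
by move=> t0; apply: (@cpos_near _ t); rewrite ?star_scal // subrr cnorm0.
Qed.

Lemma cpos_cnorm_sub a t : star a = a -> cnorm a <= t -> cpos (scal t - a).
Proof.
move=> sa at_le; apply: (@cpos_near _ t); first by rewrite starB star_scal sa.
by rewrite opprB addrC subrK.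
Qed.

(* |u +- iv|^2 = |u^2 + v^2|, and u is half the sum of u + iv and u - iv. *)
Lemma cnorm_comm_sq u v : star u = u -> star v = v -> u * v = v * u ->
  cnorm u ^+ 2 <= cnorm (u * u + v * v).
Proof.
move=> su sv uv.
have i2 : 'i * 'i = -1 :> R[i] by rewrite -expr2 sqrCi.
have n1 : cnorm (u + 'i *: v) ^+ 2 = cnorm (u * u + v * v).
  rewrite -cnorm_star starD starZ conjCi su sv mulrDl !mulrDr -!scalerAl -!scalerAr.
  by rewrite uv scalerA mulNr i2 opprK scale1r; congr (cnorm _); move: 'i => i; nc_ring.
have n2 : cnorm (u - 'i *: v) ^+ 2 = cnorm (u * u + v * v).
  rewrite -n1 -cnorm_star -[in RHS]cnorm_star; congr (cnorm _).
  rewrite starB starD starZ conjCi su sv.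
  have minus (j : R[i]) : (u - - j *: v) * (u - j *: v) =
    u * u - (j * j) *: (v * v) + j *: (v * u - u * v) by nc_ring.
  have plus (j : R[i]) : (u + - j *: v) * (u + j *: v) =
    u * u - (j * j) *: (v * v) - j *: (v * u - u * v) by nc_ring.
  by rewrite minus plus uv subrr scaler0 addr0 subr0.
have eqn : cnorm (u - 'i *: v) = cnorm (u + 'i *: v).
  by apply/eqP; rewrite -(@eqrXn2 _ 2) ?cnorm_ge0 // n1 n2.
rewrite -n1 ler_pXn2r ?nnegrE ?cnorm_ge0 //.
have : cnorm ((2 : R)%:C *: u) <= cnorm (u + 'i *: v) + cnorm (u - 'i *: v).
  apply: le_trans (cnormD _ _); rewrite le_eqVlt; apply/orP; left; apply/eqP.
  by congr (cnorm _); nc_ring.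
by rewrite eqn cnormZr ger0_norm // mulr_natl mulr2n; lra.
Qed.

(** Scale [h] to [h'] of norm below 1. The root [1 - y] of [1 - h' * h'] commutes with [h'], and the
    two squares add up to 1, so [cnorm_comm_sq] bounds the norm of [1 - h' * h'] by 1. *)
Lemma sq_near h t : star h = h -> cnorm h ^+ 2 <= t -> cnorm (scal t - h * h) <= t.
Proof.
move=> sh; wlog lt : t / cnorm h ^+ 2 < t => [H ht|_].
  apply/ler_addgt0Pr => eps e0; have e2 : 0 < eps / 2 by rewrite divr_gt0.
  have := H (t + eps / 2); have -> : cnorm h ^+ 2 < t + eps / 2 by lra.
  move=> /(_ isT)/(_ (ltW _)) H'.
  have -> : scal t - h * h = (scal (t + eps / 2) - h * h) - scal (eps / 2).
    by rewrite scalD; nc_ring.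
  apply: le_trans (cnormB _ _) _; rewrite cnorm_scalar (gtr0_norm e2).
  have : cnorm h ^+ 2 < t + eps / 2 by lra.
  by move=> /[dup] l /H/(_ (ltW l)); lra.
have t0 : 0 < t by apply: le_lt_trans lt; rewrite exprn_ge0 ?cnorm_ge0.
pose r := (Num.sqrt t)^-1; pose h' := r%:C *: h.
have r2 : r * r = t^-1 by rewrite -invfM -expr2 sqr_sqrtr // ltW.
have sh' : star h' = h' by rewrite starZr sh.
have h'E : h' * h' = t^-1%:C *: (h * h).
  by rewrite -scalerAl -scalerAr scalerA -rmorphM r2.
have lt1 : cnorm (h' * h') < 1.
  rewrite h'E cnormZr cnorm_sqr_sa // gtr0_norm ?invr_gt0 //.
  by rewrite mulrC ltr_pdivrMr // mul1r.
have [|y [sy _ y2 cy]] := @sqrt_one_sub _ _ (h' * h') _ lt1.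
  by rewrite starM sh'.
have sk : star (1 - y) = 1 - y by rewrite starB star1 sy.
have := @cnorm_comm_sq (1 - y) h' sk sh'; rewrite mulrBl mulrBr mul1r mulr1.
rewrite (cy h') ?mulrA // => /(_ erefl); rewrite y2 subrK cnorm1 -cnorm_sqr_sa // y2.
have -> : scal t - h * h = t%:C *: (1 - h' * h').
  by rewrite h'E scalerBr scalerA -rmorphM divff ?gt_eqF // scale1r.
by move=> le1; rewrite cnormZr gtr0_norm // ler_piMr // ltW.
Qed.

Lemma cpos_sq h : star h = h -> cpos (h * h).
Proof.
move=> sh; apply: (@cpos_near _ (cnorm h ^+ 2)); first by rewrite starM sh.
exact: sq_near.
Qed.

(** Converse of [cpos_near]. Being within [t] of the scalar [t] is visibly stable under addition,
    and this is how sums of positive elements become positive. *)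
Lemma cpos_near_cnorm a t : cpos a -> cnorm a <= t -> cnorm (scal t - a) <= t.
Proof.
move=> [sa pa] at_le; apply/ler_addgt0Pr => eps e0.
have [k [sk k2 _]] := pa _ e0.
have -> : scal t - a = scal (t + eps) - k * k by rewrite k2 scalD; nc_ring.
apply: sq_near => //; rewrite -cnorm_sqr_sa // k2.
by apply: le_trans (cnormD _ _) _; rewrite cnorm_scalar gtr0_norm // lerD2r.
Qed.

Lemma cposD a b : cpos a -> cpos b -> cpos (a + b).
Proof.
move=> pa pb; apply: (@cpos_near _ (cnorm a + cnorm b)).
  by rewrite starD pa.1 pb.1.
rewrite scalD opprD addrACA; apply: le_trans (cnormD _ _) _.
by rewrite lerD // cpos_near_cnorm.
Qed.

Lemma cpos_sum I (r : seq I) (f : I -> M) :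
  (forall i, cpos (f i)) -> cpos (\sum_(i <- r) f i).
Proof.
move=> pf; elim/big_ind : _ => // [|a b]; last exact: cposD.
by have := @cpos_scal 0 (lexx _); rewrite rmorph0 scale0r.
Qed.

Lemma cposZ a t : 0 <= t -> cpos a -> cpos (t%:C *: a).
Proof.
move=> t0 pa; apply: (@cpos_near _ (t * cnorm a)); first by rewrite starZr pa.1.
rewrite rmorphM -scalerA -scalerBr cnormZr ger0_norm // ler_wpM2l //.
exact: cpos_near_cnorm.
Qed.

(** Approximate roots [u] of [a] and [v] of [T - a] commute, and [u * u + v * v] is nearly the
    scalar [T]; [cnorm_comm_sq] then compares the norms. *)
Lemma cpos_cnorm_le a T : 0 <= T -> cpos a -> cpos (scal T - a) -> cnorm a <= T.
Proof.
move=> T0 [sa pa] [_ pTa]; apply/ler_addgt0Pr => eps e0.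
have e3 : 0 < eps / 3 by rewrite divr_gt0.
have [u [su u2 cu]] := pa _ e3; have [v [sv v2 cv]] := pTa _ e3.
have uv : u * v = v * u by rewrite cv // comm_sub_scal // -cu.
have := cnorm_comm_sq su sv uv; rewrite -cnorm_sqr_sa // u2 v2.
have -> : a + scal (eps / 3) + (scal T - a + scal (eps / 3)) = scal (T + 2 * (eps / 3)).
  by rewrite scalD mulr2n mulrDl !mul1r scalD; nc_ring.
rewrite cnorm_scalar ger0_norm; last by lra.
have := cnormB (a + scal (eps / 3)) (scal (eps / 3)).
rewrite addrK cnorm_scalar (gtr0_norm e3).
by move: (cnorm _) (cnorm _) => *; lra.
Qed.

Lemma cpos_closed a : (forall eps, 0 < eps -> cpos (a + scal eps)) -> cpos a.
Proof.
move=> pa; split.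
  by have := (pa _ ltr01).1; rewrite starD star_scal => /addIr.
move=> eps e0; have e2 : 0 < eps / 2 by rewrite divr_gt0.
have [k [sk k2 ck]] := (pa _ e2).2 _ e2; exists k; split => //.
  by rewrite k2 -addrA -scalD -splitr.
by move=> z za; apply: ck; apply: comm_add_scal.
Qed.

Lemma cpos_near_cpos a : star a = a ->
  (forall eps, 0 < eps -> exists2 b, cpos b & cnorm (a - b) <= eps) -> cpos a.
Proof.
move=> sa near_a; apply: cpos_closed => eps e0; have [b pb ab] := near_a _ e0.
have -> : a + scal eps = b + (scal eps - (b - a)) by nc_ring.
apply: cposD => //; apply: cpos_cnorm_sub; last by rewrite cnormC.
by rewrite starB pb.1 sa.
Qed.

Lemma cpos_invertible a t : cpos a -> 0 < t -> invertible (a + scal t).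
Proof.
move=> pa t0; have N0 := cnorm_ge0 a; have tN : 0 < t + cnorm a by lra.
pose h := (t + cnorm a)^-1%:C *: (scal (cnorm a) - a).
have h1 : cnorm h < 1.
  rewrite cnormZr ger0_norm ?invr_ge0 ?ltW // mulrC ltr_pdivrMr // mul1r.
  by apply: le_lt_trans (cpos_near_cnorm pa (lexx _)) _; rewrite ltrDr.
have [y [_ y1 y2 _]] := neumann cstar_subalgebraT I h1.
have aE : a + scal t = (t + cnorm a)%:C *: (1 - h).
  rewrite scalerBr scalerA -rmorphM divff ?gt_eqF // scale1r scalD.
  by nc_ring.
exists ((t + cnorm a)^-1%:C *: y); rewrite aE -!scalerAl -!scalerAr !scalerA.
by rewrite -!rmorphM mulfV ?mulVf ?gt_eqF // y1 y2 !scale1r.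
Qed.

Lemma inverse_sa a c : star a = a -> a * c = 1 -> c * a = 1 -> star c = c.
Proof.
move=> sa ac ca; have : star c * a = 1 by rewrite -{1}sa -starM ac star1.
by move=> h; rewrite -[star c]mulr1 -ac mulrA h mul1r.
Qed.

Lemma inverse_comm a c z : a * c = 1 -> c * a = 1 -> z * a = a * z -> z * c = c * z.
Proof.
move=> ac ca za; rewrite -[z * c]mul1r -ca -mulrA (mulrA a) -za.
by rewrite -[z * a * c]mulrA ac mulr1.
Qed.

(** With [c] the inverse of [g] and [d = 1 / (2 cnorm c)], [g - d = g (1 - d c)] is a product of
    commuting factors, the second with a square root and the first with approximate ones. *)
Lemma cpos_invertible_gap g : cpos g -> invertible g ->
  exists2 d : R, 0 < d & cpos (g - scal d).
Proof.
move=> [sg pg] [c [gc cg]]; have sc := inverse_sa sg gc cg.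
have n0 : 0 < cnorm c.
  rewrite lt_neqAle cnorm_ge0 andbT eq_sym; apply/eqP => /cnorm0_eq0 c0.
  by move: gc; rewrite c0 mulr0 => /esym/eqP; rewrite oner_eq0.
pose d := (2 * cnorm c)^-1; have d0 : 0 < d by rewrite invr_gt0 mulr_gt0.
have nd : cnorm (d%:C *: c) = 2^-1.
  by rewrite cnormZr gtr0_norm // /d invfM -mulrA mulVf ?mulr1 // gt_eqF.
have [||y [sy _ y2 cy]] := @sqrt_one_sub _ _ (d%:C *: c).
- by rewrite starZr sc.
- by rewrite nd; lra.
exists d => //; apply: cpos_near_cpos; first by rewrite starB star_scal sg.
move=> eps e0; have e2 : 0 < eps / 2 by rewrite divr_gt0.
have [k [sk k2 ck]] := pg _ e2.
have kc : k * c = c * k by apply: inverse_comm gc cg _; rewrite ck.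
have km : k * (1 - y) = (1 - y) * k.
  by rewrite mulrBr mulrBl mulr1 mul1r cy // -scalerAl -scalerAr kc.
exists (k * (1 - y) * (k * (1 - y))).
  by apply: cpos_sq; rewrite starM starB star1 sy sk.
have -> : k * (1 - y) * (k * (1 - y)) = g - scal d + (eps / 2)%:C *: (1 - d%:C *: c).
  rewrite -mulrA (mulrA (1 - y) k) -km -(mulrA k) mulrA k2 y2.
  by rewrite mulrDl mulrBr mulr1 -scalerAr gc -scalerAl mul1r.
rewrite opprD addrA subrr add0r cnormN cnormZr (gtr0_norm e2).
have := cnormB 1 (d%:C *: c); rewrite nd cnorm1; move: (cnorm _) => w; nra.
Qed.

Lemma invertible_comm_factor u v : u * v = v * u -> invertible (u * v) -> invertible u.
Proof.
move=> uv [y [y1 y2]]; exists (v * y); split; first by rewrite mulrA.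
have yu : y * u = u * y.
  by apply/esym/(inverse_comm y1 y2); rewrite {1}uv mulrA.
by rewrite -mulrA yu mulrA -uv.
Qed.

(* Were t > 0 minimal with a + t positive, a + t - d would be positive too for
   some d > 0, since a + t is invertible. *)
Lemma invertible_cpos a : star a = a ->
  (forall t, 0 < t -> invertible (a + scal t)) -> cpos a.
Proof.
move=> sa inva; pose S := [set t : R | 0 <= t /\ cpos (a + scal t)].
have N0 := cnorm_ge0 a.
have up t s : S t -> t <= s -> S s.
  move=> [t0 pt] ts; split; first exact: le_trans ts.
  rewrite -(subrK t s) scalD addrCA; apply: cposD => //.
  by apply: cpos_scal; rewrite subr_ge0.
have SN : S (cnorm a).
  by split => //; rewrite addrC -[a]opprK; apply: cpos_cnorm_sub; rewrite ?starN ?sa ?cnormN.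
have hS : has_inf S by split; [exists (cnorm a)|exists 0 => t []].
have inf0 : 0 <= inf S by apply: lb_le_inf; [exists (cnorm a)|move=> t []].
have Sinf t : inf S < t -> S t.
  by move=> /(inf_lt hS.1)[s Ss st]; apply: up Ss (ltW st).
have pinf : cpos (a + scal (inf S)).
  apply: cpos_closed => eps e0; rewrite -addrA -scalD.
  by apply: (Sinf _ _).2; rewrite ltrDl.
have [inf_gt0|] := ltP 0 (inf S); last first.
  move=> inf_le0; have inf_eq0 : inf S = 0 by apply/le_anti; rewrite inf0 inf_le0.
  by move: pinf; rewrite inf_eq0 rmorph0 scale0r addr0.
have [d d0 pd] := cpos_invertible_gap pinf (inva _ inf_gt0).
pose d' := Num.min d (inf S); have d'0 : 0 < d' by rewrite lt_min d0 inf_gt0.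
have : S (inf S - d').
  split; first by rewrite subr_ge0 ge_min lexx orbT.
  have -> : a + scal (inf S - d') = (a + scal (inf S) - scal d) + scal (d - d').
    by nc_ring.
  by apply: cposD => //; apply: cpos_scal; rewrite subr_ge0 ge_min lexx.
by move=> /(ge_inf hS.2); move: (inf S) d'0 => T; lra.
Qed.

(** A nonzero self-adjoint element has plus or minus its norm [r] in its spectrum. Otherwise both
    [r - d - z] and [r - d + z] are positive for some [d > 0]; their commuting roots make
    [(r - d)^2 - z^2] nearly positive, so [cnorm z <= r - d]. *)
Lemma sa_norm_spectrum z : star z = z -> invertible (scal (cnorm z) - z) ->
  invertible (scal (cnorm z) + z) -> z = 0.
Proof.
move=> sz inv1 inv2; set r := cnorm z in inv1 inv2.
have r0 : 0 <= r by exact: cnorm_ge0.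
have [r_eq0|rn0] := eqVneq r 0; first exact: cnorm0_eq0.
have p1 : cpos (scal r - z) by apply: cpos_cnorm_sub.
have p2 : cpos (scal r + z).
  by rewrite -[z]opprK; apply: cpos_cnorm_sub; rewrite ?starN ?sz ?cnormN.
have [d1 d10 q1] := cpos_invertible_gap p1 inv1.
have [d2 d20 q2] := cpos_invertible_gap p2 inv2.
pose d := Num.min r (Num.min d1 d2).
have d0 : 0 < d by rewrite !lt_min d10 d20 lt_neqAle eq_sym rn0 r0.
have dr : d <= r by rewrite ge_min lexx.
have dd1 : d <= d1 by rewrite !ge_min lexx orbT.
have dd2 : d <= d2 by rewrite !ge_min lexx !orbT.
have shift w s : cpos (w - scal s) -> d <= s -> cpos (w - scal d).
  move=> pw ds; have -> : w - scal d = (w - scal s) + scal (s - d).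
    by rewrite scalB; nc_ring.
  by apply: cposD => //; apply: cpos_scal; rewrite subr_ge0.
have {q1} [s1 q1] := shift _ _ q1 dd1; have {q2} [s2 q2] := shift _ _ q2 dd2.
suff : r <= r - d by rewrite lerBrDr gerDl leNgt d0.
apply/ler_addgt0Pr => eps e0.
have [u [su u2 cu]] := q1 _ e0; have [v [sv v2 cv]] := q2 _ e0.
have uz : u * z = z * u.
  by apply/esym; rewrite -cu //; nc_ring.
have zv : z * v = v * z by rewrite cv //; nc_ring.
have uv : u * v = v * u by apply: cv; rewrite mulrBr mulrBl mulrDr mulrDl uz !comm_scal.
pose T := r - d + eps; have T0 : 0 <= T by rewrite /T; lra.
rewrite -/T -(@ler_pXn2r _ 2) ?nnegrE // -cnorm_sqr_sa //.
apply: cpos_cnorm_le; [exact: exprn_ge0|exact: cpos_sq|].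
have -> : scal (T ^+ 2) - z * z = u * v * (u * v).
  by rewrite -mulrA (mulrA v) -uv -(mulrA u) mulrA u2 v2 /T; nc_ring.
by apply: cpos_sq; rewrite starM su sv.
Qed.

(** Jacobson's formula: if [c] inverts [x * y + t], then [t^-1 (1 - y c x)] inverts [y * x + t]. *)
Lemma invertible_mulC x y t : t != 0 ->
  invertible (x * y + scal t) -> invertible (y * x + scal t).
Proof.
move=> t0 [c [c1 c2]]; exists (t^-1%:C *: (1 - y * c * x)).
have tt : t^-1%:C * t%:C = 1 :> R[i] by rewrite -rmorphM mulVf.
have d1 : x * y * c = 1 - t%:C *: c.
  by rewrite -c1 mulrDl -scalerAl mul1r addrK.
have d2 : c * (x * y) = 1 - t%:C *: c.
  by rewrite -c2 mulrDr -scalerAr mulr1 addrK.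
split.
  rewrite -scalerAr mulrDl !mulrBr !mulr1 -scalerAl mul1r.
  have -> : y * x * (y * c * x) = y * (x * y * c) * x by nc_ring.
  rewrite d1; set z := (X in _ *: X); have -> : z = scal t by rewrite /z; nc_ring.
  by rewrite scalerA tt scale1r.
rewrite -scalerAl mulrDr !mulrBl !mul1r -scalerAr mulr1.
have -> : y * c * x * (y * x) = y * (c * (x * y)) * x by nc_ring.
rewrite d2; set z := (X in _ *: X); have -> : z = scal t by rewrite /z; nc_ring.
by rewrite scalerA tt scale1r.
Qed.

(** An [eps]-version of Kaplansky's argument. The root [s] of [a * a + eps^2] stands for the
    absolute value of [a], and [w = s - a] for twice its negative part, which has to be small. For
    [y = x * w], [star y * y] is nearly negative since it equals [(eps^2 / 2) w - w^3 / 2]; but it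
    is nearly positive too, by passing to [y * star y] and back. So [w^3] has norm at most
    [2 eps^2 cnorm w], and [w] is small. *)
Theorem cpos_star_mul x : cpos (star x * x).
Proof.
set a := star x * x; have sa : star a = a by rewrite starM starK.
apply: cpos_near_cpos => // eps' e'0; pose eps := eps' / 2.
have e0 : 0 < eps by rewrite divr_gt0.
have e20 : 0 < eps ^+ 2 by rewrite exprn_gt0.
have [s [ss s2 cs [r r0 sr]]] := sqrt_near (cpos_sq sa).1
  (sq_near sa (lexx _)) e20.
have ps : cpos s by apply: cpos_near sr.
exists s => //; have sas : a * s = s * a by apply: cs; rewrite mulrA.
pose w := s - a; have sw : star w = w by rewrite starB ss sa.
have aw : a * w = w * a by rewrite mulrBr mulrBl sas.
(* [w + t] is a commuting factor of [(w + t) (s + a + t) = 2 t s + eps^2 + t^2], which is invertible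
   because [s] is positive. *)
have pw : cpos w.
  apply: invertible_cpos => // t t0.
  apply: (@invertible_comm_factor _ (s + a + scal t)).
    have -> : (s + a + scal t) * (w + scal t) =
        (w + scal t) * (s + a + scal t) + (2%:R : R)%:C *: (a * s - s * a).
      by rewrite /w; nc_ring.
    by rewrite sas subrr scaler0 addr0.
  have -> : (w + scal t) * (s + a + scal t) =
      ((2 * t)%:C *: s) + scal (eps ^+ 2 + t ^+ 2).
    have -> : (w + scal t) * (s + a + scal t) =
        ((2 * t)%:C *: s) + scal (t ^+ 2) + (s * s - a * a) + (s * a - a * s).
      by rewrite /w; nc_ring.
    by rewrite s2 sas subrr addr0; nc_ring.
  apply: cpos_invertible; first by apply: cposZ => //; rewrite mulr_ge0 // ltW.
  by rewrite addr_gt0 // exprn_gt0.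
pose w3 := w * w * w.
have pw3 : cpos w3.
  apply: cpos_near_cpos => [|d d0]; first by rewrite !starM sw mulrA.
  have C0 : 0 < cnorm (w * w) + 1 by rewrite ltr_wpDl ?cnorm_ge0.
  have [k [sk k2 ck]] := pw.2 _ (divr_gt0 d0 C0).
  have kw : w * k = k * w by apply: ck.
  exists (k * w * (k * w)); first by apply: cpos_sq; rewrite starM sk sw.
  rewrite -mulrA (mulrA w) kw -(mulrA k w) mulrA k2.
  have -> : w3 - (w + scal (d / (cnorm (w * w) + 1))) * (w * w) =
      - ((d / (cnorm (w * w) + 1))%:C *: (w * w)) by rewrite /w3; nc_ring.
  rewrite cnormN cnormZr ger0_norm; last exact: ltW (divr_gt0 d0 C0).
  by rewrite mulrAC ler_pdivrMr // ler_pM2l // lerDl.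
pose y := x * w; pose e := eps ^+ 2 / 2.
have e_gt0 : 0 < e by rewrite divr_gt0.
have yy : star y * y = e%:C *: w - 2^-1%:C *: w3.
  have -> : star y * y = w * a * w by rewrite /y starM sw /a; nc_ring.
  have ws : w * (s + a) = scal (eps ^+ 2).
    have -> : w * (s + a) = (s * s - a * a) + (s * a - a * s) by rewrite /w; nc_ring.
    by rewrite s2 sas subrr addr0 addrC addKr.
  have -> : w * a * w = 2^-1%:C *: (w * (s + a) * w) - 2^-1%:C *: w3.
    by rewrite /w3 /w; nc_ring.
  by rewrite ws /e; nc_ring.
have pew : cpos (e%:C *: (scal (cnorm w) - w)).
  by apply: cposZ (ltW e_gt0) _; apply: cpos_cnorm_sub.
have pw3' : cpos (2^-1%:C *: w3) by apply: cposZ => //; rewrite invr_ge0.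
have ew0 : 0 <= e * cnorm w by rewrite mulr_ge0 ?cnorm_ge0 // ltW.
(* The sum [y * star y + star y * y] is [2 (h^2 + k^2)], hence positive, and [- (star y * y)] is
   positive up to the scalar [e * cnorm w]. *)
have p1 : cpos (y * star y + scal (e * cnorm w)).
  have [h [k [sh sk yE _ _]]] := sa_re_im y.
  have i2 : 'i * 'i = -1 :> R[i] by rewrite -expr2 sqrCi.
  have yyE : y * star y = (2%:R : R)%:C *: (h * h + k * k) - star y * y.
    apply/eqP; rewrite eq_sym subr_eq; apply/eqP.
    rewrite yE starD starZ conjCi sh sk.
    have sumE (j : R[i]) : (h + j *: k) * (h + - j *: k) + (h + - j *: k) * (h + j *: k) =
        (2%:R : R)%:C *: (h * h - (j * j) *: (k * k)) by nc_ring.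
    by rewrite sumE i2 scaleN1r opprK.
  have -> : y * star y + scal (e * cnorm w) = (2%:R : R)%:C *: (h * h + k * k) +
      (2^-1%:C *: w3 + e%:C *: (scal (cnorm w) - w)) by rewrite yyE yy; nc_ring.
  apply: cposD; last exact: cposD.
  by apply: cposZ => //; apply: cposD; apply: cpos_sq.
have p2 : cpos (star y * y + scal (e * cnorm w)).
  apply: invertible_cpos => [|t t0]; first by rewrite starD starM starK star_scal.
  rewrite -addrA -scalD; apply: invertible_mulC; first by rewrite gt_eqF // ltr_wpDl.
  by rewrite scalD addrA; apply: cpos_invertible.
have le3 : cnorm (2^-1%:C *: w3) <= 2 * (e * cnorm w).
  apply: cpos_cnorm_le => //; first by rewrite mulr_ge0.
  have -> : scal (2 * (e * cnorm w)) - 2^-1%:C *: w3 = star y * y + scal (e * cnorm w)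
      + e%:C *: (scal (cnorm w) - w) by rewrite yy; nc_ring.
  exact: cposD.
have -> : a - s = - w by rewrite /w opprB.
rewrite cnormN; move: le3; rewrite cnormZr ger0_norm ?invr_ge0 // /e => le3.
have le4 : cnorm w ^+ 4 <= cnorm w3 * cnorm w.
  rewrite (exprM _ 2 2) -!cnorm_sqr_sa //; last by rewrite starM sw.
  by rewrite mulrA cnormM.
rewrite leNgt; apply/negP => lt; have epsE : eps' = 2 * eps by rewrite /eps; lra.
have n0 : 0 < cnorm w by apply: lt_trans lt.
have : cnorm w ^+ 4 <= 2 * eps ^+ 2 * cnorm w ^+ 2.
  by apply: le_trans le4 _; rewrite (expr2 (cnorm w)) mulrA ler_pM2r //; lra.
rewrite (exprD _ 2 2) ler_pM2r ?exprn_gt0 // => le2.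
have : (2 * eps) ^+ 2 < cnorm w ^+ 2 by rewrite ltr_pXn2r ?nnegrE ?cnorm_ge0 ?mulr_ge0 ?ltW // -epsE.
by rewrite exprMn; nra.
Qed.

Lemma cpos_scal_ge0 t : cpos (scal t) -> 0 <= t.
Proof.
move=> pt; rewrite leNgt; apply/negP => t0.
have : cnorm (scal t) <= 0.
  apply: cpos_cnorm_le => //; rewrite -scalB sub0r.
  by apply: cpos_scal; rewrite oppr_ge0 ltW.
by rewrite cnorm_scalar normr_le0 => /eqP t_eq0; move: t0; rewrite t_eq0 ltxx.
Qed.

Lemma cpos_anti a : cpos a -> cpos (- a) -> a = 0.
Proof.
move=> pa pNa; apply: cnorm0_eq0; apply/le_anti; rewrite cnorm_ge0 andbT.
by apply: cpos_cnorm_le => //; rewrite rmorph0 scale0r sub0r.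
Qed.

Lemma star_mul_eq0 x : star x * x = 0 -> x = 0.
Proof.
move=> h; have := cnorm_star x; rewrite h cnorm0 => /esym/eqP.
by rewrite sqrf_eq0 => /eqP/cnorm0_eq0.
Qed.

Lemma sum_star_mul_eq0 (I : eqType) (r : seq I) (f : I -> M) :
  \sum_(i <- r) star (f i) * f i = 0 -> forall i, i \in r -> f i = 0.
Proof.
elim: r => // j r IH; rewrite big_cons => /eqP; rewrite addr_eq0 => /eqP fjE.
have fj0 : star (f j) * f j = 0.
  apply: cpos_anti (cpos_star_mul _) _; rewrite fjE opprK.
  by apply: cpos_sum => i; apply: cpos_star_mul.
move=> i; rewrite inE => /orP[/eqP->|ri]; first exact: star_mul_eq0.
by apply: IH ri; apply/eqP; rewrite -oppr_eq0 -fjE fj0.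
Qed.

End PositiveElements.

(** * Conditional expectations and sphericality *)

Section RelativeCommutant.
Context {R : realType} {M : cstarAlgType R}.
Variables (C D : set M).
Hypothesis hC : cstar_subalgebra C.
Implicit Types (x y b : M).

Lemma relcommM x y : relcommutant D C x -> relcommutant D C y ->
  relcommutant D C (x * y).
Proof.
move=> [Cx xD] [Cy yD]; split; first exact: csub_mul.
by move=> b Db; rewrite -mulrA yD // mulrA xD // mulrA.
Qed.

Lemma relcommD x y : relcommutant D C x -> relcommutant D C y ->
  relcommutant D C (x + y).
Proof.
move=> [Cx xD] [Cy yD]; split; first exact: csub_add.
by move=> b Db; rewrite mulrDl mulrDr xD // yD.
Qed.

Lemma relcommZ c x : relcommutant D C x -> relcommutant D C (c *: x).
Proof.
move=> [Cx xD]; split; first exact: csub_scale.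
by move=> b Db; rewrite -scalerAl -scalerAr xD.
Qed.

Lemma relcommB x y : relcommutant D C x -> relcommutant D C y ->
  relcommutant D C (x - y).
Proof. by move=> hx hy; rewrite -scaleN1r; apply: relcommD => //; apply: relcommZ. Qed.

Lemma relcommS x : cstar_subalgebra D -> relcommutant D C x -> relcommutant D C (star x).
Proof.
move=> hD [Cx xD]; split; first exact: csub_star.
move=> b Db; rewrite -[b]starK -!starM xD //.
exact: csub_star.
Qed.

Lemma relcomm1 : relcommutant D C 1.
Proof. by split => [|b _]; [exact: csub_one|rewrite mul1r mulr1]. Qed.

End RelativeCommutant.

Record expectation {R : realType} {M : cstarAlgType R} (C D : set M) (E : M -> M) : Prop := {
  exp_domain : cstar_subalgebra C ;
  exp_codomain : cstar_subalgebra D ;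
  exp_subset : D `<=` C ;
  exp_cond_exp : cond_exp C D E
}.

Section ConditionalExpectation.
Context {R : realType} {M : cstarAlgType R}.
Variables (C D : set M) (E : M -> M).
Hypothesis hCDE : expectation C D E.
Implicit Types (x y z a b : M).

Let hC : cstar_subalgebra C := exp_domain hCDE.
Let hD : cstar_subalgebra D := exp_codomain hCDE.
Let DC : D `<=` C := exp_subset hCDE.
Let hE : cond_exp C D E := exp_cond_exp hCDE.

Let CM x y : C x -> C y -> C (x * y).
Proof. exact: csub_mul. Qed.
Let CD x y : C x -> C y -> C (x + y).
Proof. exact: csub_add. Qed.
Let CS x : C x -> C (star x).
Proof. exact: csub_star. Qed.
Let CZ c x : C x -> C (c *: x).
Proof. exact: csub_scale. Qed.
Let C1 : C 1.
Proof. exact: csub_one. Qed.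
Let CB x y : C x -> C y -> C (x - y).
Proof. exact: csubB. Qed.
Let D1 : D 1.
Proof. exact: csub_one. Qed.
Let CE x : C x -> C (E x).
Proof. by move=> Cx; apply: DC; apply: (ce_range hE). Qed.

Ltac mem := repeat first [ eassumption | apply CM | apply CB | apply CD | apply CS
  | apply CZ | apply CE | apply C1 ].

Lemma ceD x y : C x -> C y -> E (x + y) = E x + E y.
Proof. by move=> Cx Cy; have := ce_linear hE 1 Cx Cy; rewrite !scale1r. Qed.

Lemma ce0 : E 0 = 0.
Proof. by apply: (ce_id hE); apply: csub0. Qed.

Lemma ceZ c x : C x -> E (c *: x) = c *: E x.
Proof. by move=> Cx; have := ce_linear hE c Cx (csub0 hC); rewrite ce0 !addr0. Qed.

Lemma ceB x y : C x -> C y -> E (x - y) = E x - E y.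
Proof. by move=> Cx Cy; rewrite -scaleN1r ceD ?ceZ ?scaleN1r //; apply: csubN. Qed.

Lemma ce_sum (I : eqType) (r : seq I) (f : I -> M) :
  (forall i, i \in r -> C (f i)) -> E (\sum_(i <- r) f i) = \sum_(i <- r) E (f i).
Proof.
elim: r => [|i r IH] hf; first by rewrite !big_nil ce0.
have Ci : C (f i) by apply: hf; rewrite mem_head.
have hr j : j \in r -> C (f j) by move=> jr; apply: hf; rewrite inE jr orbT.
rewrite !big_cons ceD ?IH // big_seq; apply: csub_sum => // j; exact: hr.
Qed.

Lemma ceMl b x : D b -> C x -> E (b * x) = b * E x.
Proof. by move=> Db Cx; have := ce_bimod hE Db Cx D1; rewrite !mulr1. Qed.

Lemma ceMr x b : C x -> D b -> E (x * b) = E x * b.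
Proof. by move=> Cx Db; have := ce_bimod hE D1 Cx Db; rewrite !mul1r. Qed.

Lemma cpos_ce x : C x -> cpos (E (star x * x)).
Proof. by move=> /(ce_pos hE)[b _ ->]; apply: cpos_star_mul. Qed.

(** Positivity makes [E (star (x + c) * (x + c))] self-adjoint for every scalar [c]; the values at
    [c = 1] and [c = 'i] separate the two mixed terms. *)
Lemma ce_star x : C x -> E (star x) = star (E x).
Proof.
move=> Cx; have Cs := CS Cx.
have sa z : C z -> star (E (star z * z)) = E (star z * z).
  by move=> /cpos_ce[].
have CI c : C (c%:A : M) by apply: CZ.
have EI c : E (c%:A : M) = c%:A by rewrite ceZ // (ce_id hE).
have polar (c : R[i]) : star (c *: E (star x) + c^* *: E x) = c *: E (star x) + c^* *: E x.
  have := sa (x + c%:A) (CD Cx (CI c)).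
  have -> : star (x + c%:A) * (x + c%:A) =
      star x * x + (c *: star x + (c^* *: x + (c^* * c)%:A)).
    by rewrite starD starZ star1; nc_ring.
  have Cxx := CM Cs Cx.
  rewrite ceD; [|by mem..]; rewrite ceD; [|by mem..]; rewrite ceD; [|by mem..].
  rewrite EI ceZ // ceZ // starD (sa _ Cx) => /addrI.
  have cc : (c^* * c)^* = c^* * c by rewrite rmorphM /= conjCK mulrC.
  by rewrite addrA starD (starZ (c^* * c)) star1 cc => /addIr.
have := polar 1; rewrite conjC1 !scale1r starD => e1.
have := polar 'i; rewrite conjCi starD !starZ conjCi rmorphN /= conjCi opprK => e2.
have i2 : 'i * 'i = -1 :> R[i] by rewrite -expr2 sqrCi.
have {}e2 : star (E (star x)) - star (E x) = E x - E (star x).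
  have := congr1 (fun z => 'i *: z) e2; rewrite !scalerDr !scalerA !mulrN i2 opprK !scale1r.
  by rewrite !scaleN1r => ->; rewrite addrC.
have e3 : (2%:R : R[i]) *: E (star x) = (2%:R : R[i]) *: star (E x).
  rewrite !scaler_nat !mulr2n.
  apply: (@addrI _ (star (E (star x)) - star (E x))).
  have -> : star (E (star x)) - star (E x) + (star (E x) + star (E x)) =
     star (E (star x)) + star (E x) by nc_ring.
  by rewrite e1 e2; nc_ring.
apply: (scalerI (a := 2%:R : R[i])) e3; by rewrite pnatr_eq0.
Qed.

Lemma ce_relcomm x : relcommutant D C x -> relcommutant D D (E x).
Proof.
move=> [Cx xD]; split; first exact: (ce_range hE).
by move=> b Db; rewrite -ceMr // -ceMl // xD.
Qed.

Section QuasiBasis.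
Variable l : seq M.
Hypothesis hl : quasi_basis C E l.

Let Cl z : z \in l -> C z.
Proof. exact: hl.1. Qed.

Lemma qb_left x : C x -> \sum_(z <- l) z * E (star z * x) = x.
Proof. by move=> /(hl.2)[]. Qed.

Lemma qb_right x : C x -> \sum_(z <- l) E (x * z) * star z = x.
Proof. by move=> /(hl.2)[_]. Qed.

Lemma qb_eq0 x : C x -> (forall a, C a -> E (a * x) = 0) -> x = 0.
Proof.
move=> Cx h; rewrite -[x]qb_left // big_seq big1 // => z zl.
by rewrite h ?mulr0 //; apply: CS; apply: Cl.
Qed.

(** Parseval's identity for the quasi-basis, from which [ce_faithful] is read off. *)
Lemma ce_star_mulE x y : C x -> C y ->
  E (star x * y) = \sum_(z <- l) star (E (star z * x)) * E (star z * y).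
Proof.
move=> Cx Cy; rewrite -{1}[y]qb_left // mulr_sumr ce_sum; last first.
  by move=> z zl; have Cz := Cl zl; mem.
apply: eq_big_seq => z zl; have Cz := Cl zl.
rewrite mulrA ceMr; [|by mem|by apply: (ce_range hE); mem].
by rewrite -ce_star ?starM ?starK //; mem.
Qed.

Lemma ce_faithful x : C x -> E (star x * x) = 0 -> x = 0.
Proof.
move=> Cx; rewrite ce_star_mulE // => /sum_star_mul_eq0 h.
by rewrite -[x]qb_left // big_seq big1 // => z /h ->; rewrite mulr0.
Qed.

Definition qb_conj x := \sum_(z <- l) z * x * star z.

(** Expand [a * z] in the quasi-basis from the left, move the coefficients, which lie in [D], past
    [x], and resum from the right. Since [x] may lie outside [C], the lemma also applies to the
    higher algebras of the tower. *)
Lemma qb_conj_comm x a : (forall b, D b -> x * b = b * x) -> C a ->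
  a * qb_conj x = qb_conj x * a.
Proof.
move=> xD Ca; rewrite /qb_conj mulr_sumr mulr_suml.
transitivity (\sum_(z <- l) \sum_(w <- l) w * x * (E (star w * a * z) * star z)).
  apply: eq_big_seq => z zl; have Cz := Cl zl.
  rewrite !mulrA -[a * z]qb_left; last exact: CM.
  rewrite !mulr_suml; apply: eq_big_seq => w wl; have Cw := Cl wl.
  have Caz := CM (CS Cw) (CM Ca Cz).
  rewrite -!mulrA; congr (_ * _); rewrite !mulrA -xD //.
  by rewrite -!mulrA; apply: (ce_range hE).
rewrite exchange_big; apply: eq_big_seq => w wl.
by rewrite -mulr_sumr qb_right ?mulrA //; apply: CM => //; apply/CS/Cl.
Qed.

Lemma qb_conj_relcomm x : relcommutant D C x -> relcommutant C C (qb_conj x).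
Proof.
move=> [Cx xD]; split; last by move=> a Ca; rewrite qb_conj_comm.
rewrite /qb_conj big_seq; apply: csub_sum => // z zl.
by apply: CM; [apply: CM => //; apply: Cl|apply/CS/Cl].
Qed.

Section Trace.
Variable K : R.
Hypothesis K0 : K != 0.
Hypothesis spherical : forall x, relcommutant D C x -> qb_conj x = K%:C *: E x.

(* The modular automorphism: E (y a) = E (a (modular y)). *)
Let modular y := \sum_(z <- l) z * E (y * star z).

Let Cmodular y : C y -> C (modular y).
Proof.
move=> Cy; rewrite /modular big_seq; apply: csub_sum => // z zl; have Cz := Cl zl.
by apply: CM => //; apply: CE; apply: CM => //; apply: CS.
Qed.

Let modularE y a : relcommutant D C y -> C a -> E (y * a) = E (a * modular y).
Proof.
move=> [Cy yD] Ca; rewrite -{1}[a]qb_right // !mulr_sumr !ce_sum; last 2 first.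
- by move=> z zl; have Cz := Cl zl; mem.
- by move=> z zl; have Cz := Cl zl; mem.
apply: eq_big_seq => z zl; have Cz := Cl zl; have Cs := CS Cz.
have Daz : D (E (a * z)) by apply: (ce_range hE); apply: CM.
rewrite mulrA yD // -mulrA ceMl //; last by mem.
by rewrite (mulrA a) (@ceMr (a * z)) //; [mem|apply: (ce_range hE); mem].
Qed.

Let modular_relcomm y : relcommutant D C y -> relcommutant D C (modular y).
Proof.
move=> hy; have Cmy := Cmodular hy.1; split => // b Db; have Cb := DC Db.
apply/subr0_eq/qb_eq0; first by apply: CB; apply: CM.
move=> a Ca; have Cab := CM Ca Cb.
rewrite mulrBr ceB; [|by mem..]; rewrite !mulrA ceMr //; last by mem.
by have Cy := hy.1; rewrite -!modularE // mulrA (@ceMr (y * a)) ?subrr //; mem.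
Qed.

(** For any quasi-basis, [qb_conj (x * y) = qb_conj (modular y * x)]. Sphericality turns this into
    [E (x * y) = E (modular y * x) = E (x * modular (modular y))], and faithfulness of [E]
    concludes. *)
Let modular_sqr y : relcommutant D C y -> modular (modular y) = y.
Proof.
move=> hy; have hm := modular_relcomm hy; have hmm := modular_relcomm hm.
have swap x : relcommutant D C x -> qb_conj (x * y) = qb_conj (modular y * x).
  move=> hx; have Cx := hx.1; have Cy := hy.1; rewrite /qb_conj.
  transitivity (\sum_(z <- l) \sum_(w <- l) z * E (star z * w * modular y) * x * star w).
    apply: eq_big_seq => z zl; have Cz := Cl zl; have Cs := CS Cz.
    rewrite -!mulrA -[y * star z]qb_right; last exact: CM.
    rewrite !mulr_sumr; apply: eq_big_seq => w wl; have Cw := Cl wl.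
    rewrite -!mulrA; congr (_ * _); rewrite !mulrA; congr (_ * _).
    rewrite -!mulrA modularE //; last exact: CM.
    rewrite hx.2 ?mulrA //; apply: (ce_range hE); have Cm := hm.1; mem.
  rewrite exchange_big; apply: eq_big_seq => w wl; have Cw := Cl wl.
  rewrite -!mulr_suml.
  under eq_bigr => z _ do rewrite -mulrA.
  by rewrite qb_left ?mulrA //; apply: CM => //; exact: hm.1.
pose d := y - modular (modular y); have hd : relcommutant D C d by apply: relcommB.
suff d0 : d = 0 by apply/esym/subr0_eq.
apply: ce_faithful hd.1 _; have hs := relcommS hC hD hd; have Cs := hs.1.
have EE : E (star d * y) = E (modular y * star d).
  apply: (scalerI (a := K%:C)); first by rewrite fmorph_eq0.
  by rewrite -!spherical ?swap //; apply: relcommM.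
have [Cy Cmm] := (hy.1, hmm.1); rewrite {2}/d mulrBr ceB; [|by mem..].
by rewrite EE modularE // subrr.
Qed.

(* Sphericality makes the modular automorphism an involution; being positive
   for the inner product E (x^* y), it is then trivial. *)
Lemma ce_trace y a : relcommutant D C y -> C a -> E (y * a) = E (a * y).
Proof.
move=> hy Ca; rewrite modularE //; have hm := modular_relcomm hy.
suff -> : modular y = y by [].
apply/esym/subr0_eq; set d := y - modular y.
have hd : relcommutant D C d by apply: relcommB.
have md : modular d = - d.
  have modB u v : C u -> C v -> modular (u - v) = modular u - modular v.
    move=> Cu Cv; rewrite /modular -sumrB; apply: eq_big_seq => z /Cl Cz.
    by rewrite -mulrBr mulrBl ceB //; mem.
  by rewrite modB ?modular_sqr ?opprB //; [exact: hy.1|exact: hm.1].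
have Cs := CS hd.1; apply: ce_faithful hd.1 _.
(* Since [modular d = - d], [E (d * star d) = - E (star d * d)]: both [E (star d * d)] and its
   opposite are positive. *)
apply: cpos_anti; first exact: cpos_ce hd.1.
have := modularE hd Cs; rewrite md mulrN => h.
rewrite -scaleN1r -ceZ; last by apply: CM => //; exact: hd.1.
by rewrite scaleN1r -h -{1}[d]starK; apply: cpos_ce.
Qed.

(** Bessel's inequality for the quasi-basis: with [y z] the residual of [z] after removing its
    components along the [x i], the sum of the [y z * star (y z)] is [K] minus the sum of the
    [x i * star (x i)]. Applying [E] gives [K - N], because [ce_trace] makes each
    [E (x i * star (x i))] equal to 1. *)
Lemma orthonormal_bound (N : nat) (x : 'I_N -> M) :
  (forall i, relcommutant D C (x i)) ->
  (forall i j, E (star (x i) * x j) = (i == j)%:R%:A) ->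
  \sum_(z <- l) z * star z = K%:C%:A -> N%:R <= K.
Proof.
move=> hx ox hK; have Cx i := (hx i).1; have Cs i := CS (Cx i).
pose b z i := E (star z * x i).
pose y z := z - \sum_i x i * star (b z i).
have Cb z i : z \in l -> C (b z i) by move=> /Cl Cz; apply/CE/CM => //; apply: CS.
have Cy z : z \in l -> C (y z).
  move=> zl; apply: CB; first exact: Cl.
  by apply: csub_sum => // i _; apply: CM => //; apply/CS/Cb.
have sumE : \sum_(z <- l) y z * star (y z) = K%:C%:A - \sum_i x i * star (x i).
  have s1 i : \sum_(z <- l) z * b z i = x i by rewrite qb_left.
  have s1' i : \sum_(z <- l) star (b z i) * star z = star (x i).
    by rewrite -[in RHS]s1 star_sum; apply: eq_bigr => z _; rewrite starM.
  have s2 i j : \sum_(z <- l) star (b z i) * b z j = (i == j)%:R%:A.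
    by rewrite -ox ce_star_mulE.
  have -> : \sum_(z <- l) y z * star (y z) =
      \sum_(z <- l) z * star z - \sum_(z <- l) z * (\sum_i b z i * star (x i))
      - \sum_(z <- l) (\sum_i x i * star (b z i)) * star z
      + \sum_(z <- l) (\sum_i x i * star (b z i)) * (\sum_i b z i * star (x i)).
    rewrite -!sumrB -big_split /=; apply: eq_bigr => z _.
    rewrite /y starB star_sum.
    under [X in star z - X]eq_bigr => i _ do rewrite starM starK.
    by move: (\sum_i _) (\sum_i _) => u v; nc_ring.
  have -> : \sum_(z <- l) z * (\sum_i b z i * star (x i)) = \sum_i x i * star (x i).
    under eq_bigr => z _ do rewrite mulr_sumr.
    rewrite exchange_big; apply: eq_bigr => i _.
    transitivity ((\sum_(z <- l) z * b z i) * star (x i)); last by rewrite s1.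
    by rewrite mulr_suml; apply: eq_bigr => z _; rewrite mulrA.
  have -> : \sum_(z <- l) (\sum_i x i * star (b z i)) * star z = \sum_i x i * star (x i).
    under eq_bigr => z _ do rewrite mulr_suml.
    rewrite exchange_big; apply: eq_bigr => i _.
    transitivity (x i * (\sum_(z <- l) star (b z i) * star z)); last by rewrite s1'.
    by rewrite mulr_sumr; apply: eq_bigr => z _; rewrite mulrA.
  have -> : \sum_(z <- l) (\sum_i x i * star (b z i)) * (\sum_i b z i * star (x i)) =
      \sum_i x i * star (x i).
    transitivity (\sum_i \sum_j x i * ((i == j)%:R%:A * star (x j))).
      under eq_bigr => z _ do rewrite mulr_suml.
      rewrite exchange_big; apply: eq_bigr => i _.
      under eq_bigr => z _ do rewrite mulr_sumr.
      rewrite exchange_big; apply: eq_bigr => j _; rewrite -s2 mulr_suml mulr_sumr.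
      by apply: eq_bigr => z _; rewrite !mulrA.
    apply: eq_bigr => i _; rewrite (bigD1 i) //= eqxx scale1r mul1r big1 ?addr0 //.
    by move=> j /negPf; rewrite eq_sym => ->; rewrite scale0r mul0r mulr0.
  by rewrite hK; nc_ring.
have xx i : E (x i * star (x i)) = 1.
  by rewrite ce_trace // ox eqxx scale1r.
have : cpos (E (\sum_(z <- l) y z * star (y z))).
  rewrite ce_sum; last by move=> z /Cy Cyz; mem.
  rewrite big_seq; elim/big_ind : _ => [|u v|z /Cy Cyz]; last 1 first.
  - by rewrite -{1}[y z]starK; apply: cpos_ce; apply: CS.
  - by have := @cpos_scal _ M 0 (lexx _); rewrite rmorph0 scale0r.
  - exact: cposD.
rewrite sumE ceB; [|by mem|by apply: csub_sum => // i _; mem].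
rewrite ceZ // (ce_id hE) // ce_sum; last by move=> i _; mem.
under eq_bigr => i _ do rewrite xx.
rewrite sumr_const card_ord.
have -> : (1 : M) *+ N = (N%:R : R)%:C%:A by rewrite rmorph_nat scaler_nat.
by rewrite -scalerBl -rmorphB => /cpos_scal_ge0; rewrite subr_ge0.
Qed.

End Trace.
End QuasiBasis.
End ConditionalExpectation.

(** * Simplicity gives trivial centres, minimality gives sphericality *)

Section MinimalExpectation.
Context {R : realType} {M : cstarAlgType R}.
Implicit Types (x y z a b : M) (C D : set M) (E : M -> M).

Local Notation scal t := (t%:C%:A : M).

Definition trivial_center D := forall x, relcommutant D D x -> exists c : R[i], x = c%:A.

(** The closure of [z D] is a nonzero closed ideal, so it contains 1. Some [z * d] is then at
    distance less than 1 from 1, hence invertible, and so is its commuting factor [z]. *)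
Lemma simple_central_invertible D z : cstar_subalgebra D -> simple_algebra D ->
  relcommutant D D z -> z <> 0 -> invertible z.
Proof.
move=> hD sD [Dz zD] z0.
pose I := [set x | D x /\ forall eps : R, 0 < eps -> exists2 d, D d & cnorm (x - z * d) < eps].
have Iz : I z.
  split => // eps e0; exists 1; first exact: csub_one.
  by rewrite mulr1 subrr cnorm0.
have idI : closed_ideal D I.
  split.
  - by move=> x [].
  - move=> u l Iu ul; split; first by apply: (csub_closed hD) ul => n; case: (Iu n).
    move=> eps e0; have e2 : 0 < eps / 2 by rewrite divr_gt0.
    have [N hN] := cvg_small ul e2; have [d Dd hd] := (Iu N).2 _ e2.
    exists d => //; rewrite -(subrK (u N) l) -addrA (splitr eps).
    by apply: le_lt_trans (cnormD _ _) _; rewrite ltrD // cnormC hN.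
  - split=> [|eps e0]; first exact: csub0.
    by exists 0; [exact: csub0|rewrite mulr0 subrr cnorm0].
  - move=> x y [Dx hx] [Dy hy]; split=> [|eps e0]; first exact: csub_add.
    have e2 : 0 < eps / 2 by rewrite divr_gt0.
    have [d Dd hd] := hx _ e2; have [d' Dd' hd'] := hy _ e2.
    exists (d + d'); first exact: csub_add.
    rewrite mulrDr opprD addrACA (splitr eps).
    by apply: le_lt_trans (cnormD _ _) _; rewrite ltrD.
  - move=> c x [Dx hx]; split=> [|eps e0]; first exact: csub_scale.
    have C0 : 0 < complex.Re `|c| + 1.
      by rewrite ltr_wpDl // normc_def /= sqrtr_ge0.
    have [d Dd hd] := hx _ (divr_gt0 e0 C0); exists (c *: d); first exact: csub_scale.
    rewrite -scalerAr -scalerBr cnormZ; move: hd; rewrite ltr_pdivlMr // mulrC.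
    by apply: le_lt_trans; rewrite mulrDl mul1r lerDl cnorm_ge0.
  - move=> a x Da [Dx hx].
    have C0 : 0 < cnorm a + 1 by rewrite ltr_wpDl ?cnorm_ge0.
    split; (split; first exact: csub_mul) => eps e0;
      have [d Dd hd] := hx _ (divr_gt0 e0 C0).
    + exists (a * d); first exact: csub_mul.
      rewrite mulrA zD // -mulrA -mulrBr; move: hd; rewrite ltr_pdivlMr // mulrC.
      apply: le_lt_trans; apply: le_trans (cnormM _ _) _.
      by rewrite mulrDl mul1r lerDl cnorm_ge0.
    + exists (d * a); first exact: csub_mul.
      rewrite mulrA -mulrBl; move: hd; rewrite ltr_pdivlMr //.
      apply: le_lt_trans; apply: le_trans (cnormM _ _) _.
      by rewrite mulrDr mulr1 lerDl cnorm_ge0.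
have [I0|ID] := sD _ idI; first by move: Iz; rewrite I0.
have [_ /(_ _ ltr01)[d Dd hd]] : I 1 by rewrite ID; apply: csub_one.
have [y [_ y1 y2 _]] := neumann cstar_subalgebraT (Logic.I : [set: M] _) hd.
apply: (@invertible_comm_factor _ _ _ d); first exact: zD.
by exists y; move: y1 y2; rewrite opprB addrC subrK.
Qed.

(** For a self-adjoint central [z] of norm [r], either one of [r - z], [r + z] is 0, or both are
    invertible and [sa_norm_spectrum] gives [z = 0]. *)
Lemma simple_trivial_center D : cstar_subalgebra D -> simple_algebra D -> trivial_center D.
Proof.
move=> hD sD.
have sa_case z : relcommutant D D z -> star z = z -> exists t : R, z = scal t.
  move=> hz sz; set r := cnorm z.
  have hs c : relcommutant D D (c%:A + z) /\ relcommutant D D (c%:A - z).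
    have hc : relcommutant D D (c%:A : M) by apply: relcommZ => //; apply: relcomm1.
    by split; [apply: relcommD|apply: relcommB].
  have [e1|n1] := pselect (scal r - z = 0).
    by exists r; apply/esym/subr0_eq.
  have [e2|n2] := pselect (scal r + z = 0).
    by exists (- r); rewrite scalN; apply/eqP; rewrite -addr_eq0 addrC e2.
  exists 0; rewrite rmorph0 scale0r; apply: sa_norm_spectrum => //.
    by apply: simple_central_invertible hD sD _ n1; case: (hs r%:C).
  by apply: simple_central_invertible hD sD _ n2; case: (hs r%:C).
move=> x hx; have [h [k [sh sk xE hE kE]]] := sa_re_im x.
have hsx : relcommutant D D (star x) by apply: relcommS.
have [|t1 h1] := sa_case h _ sh.
  by rewrite hE; apply: relcommZ => //; apply: relcommD.
have [|t2 h2] := sa_case k _ sk.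
  by rewrite kE; apply: relcommZ => //; apply: relcommB.
by exists (t1%:C + 'i * t2%:C); rewrite xE h1 h2 scalerA -scalerDl.
Qed.

Lemma sa_scalar (c : R[i]) : star (c%:A : M) = c%:A -> c = (complex.Re c)%:C.
Proof.
rewrite starZ star1 => /scalar_inj; case: c => a b [] /eqP.
rewrite eq_sym -subr_eq0 opprK -mulr2n mulrn_eq0 /= => /eqP b0.
by rewrite b0.
Qed.

Lemma first_order_eq0 (d B e0 : R) : 0 < e0 ->
  (forall e, `|e| <= e0 -> 0 <= 2 * e * d + e ^+ 2 * B) -> d = 0.
Proof.
move=> e0_gt0 h; apply/eqP; apply: contraT => d0.
have dp : 0 < `|d| by rewrite normr_gt0.
have Bp : 0 < `|B| + 1 by rewrite ltr_wpDl.
pose eta := Num.min e0 (`|d| / (`|B| + 1)).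
have eta0 : 0 < eta by rewrite lt_min e0_gt0 divr_gt0.
have etaB : eta * `|B| < `|d|.
  have : eta * (`|B| + 1) <= `|d| by rewrite -ler_pdivlMr // ge_min lexx orbT.
  by rewrite mulrDr mulr1; lra.
have := h (- (Num.sg d * eta)).
rewrite normrN normrM normr_sg d0 mul1r gtr0_norm // ge_min lexx => /(_ isT).
have -> : 2 * - (Num.sg d * eta) * d = - (2 * eta * `|d|).
  by rewrite [`|d|]normrEsg; ring.
rewrite sqrrN exprMn sqr_sg d0 mul1r => le.
have BB : B <= `|B| by exact: ler_norm.
have : eta ^+ 2 * B <= eta * (eta * `|B|).
  by rewrite expr2 -mulrA ler_pM2l // ler_pM2l.
have : eta * (eta * `|B|) < eta * `|d| by rewrite ltr_pM2l.
have : 0 < eta * `|d| by rewrite mulr_gt0.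
by move: (eta * (eta * _)) (eta ^+ 2 * B) le => u v; lra.
Qed.

(** First-order condition for the minimal index: along the perturbation the index is
    [(1 + 2 e al + e^2 al2) rho] with [rho = K - 2 e t + O(e^2)], and it is smallest at [e = 0], so
    its derivative [2 (K al - t)] there is 0. *)
Lemma stationary (K al al2 t B e0 : R) : 0 < e0 ->
  (forall e : R, `|e| <= e0 -> exists rho : R,
     K <= (1 + 2 * e * al + e ^+ 2 * al2) * rho /\
     `|rho - K + 2 * e * t| <= e ^+ 2 * B) -> t = K * al.
Proof.
move=> e0_gt0 h; apply/esym/subr0_eq.
have m0 : 0 < Num.min e0 1 by rewrite lt_min e0_gt0 ltr01.
pose S := 1 + 2 * `|al| + `|al2|.
apply: (@first_order_eq0 _ (`|al2 * K - 4 * al * t| + 2 * `|al2 * t| + S * B) _ m0).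
move=> e; rewrite le_min => /andP[/h[rho [le1 le2]] e1].
set r := rho - K + 2 * e * t in le2; set s := 1 + 2 * e * al + e ^+ 2 * al2 in le1.
have rhoE : rho = K - 2 * e * t + r by rewrite /r; ring.
have e2_ge0 : 0 <= e ^+ 2 by exact: sqr_ge0.
have e2_le1 : e ^+ 2 <= 1 by rewrite -real_normK ?num_real // expr_le1.
have S0 : 0 <= S by rewrite /S !addr_ge0 ?mulr_ge0.
have sS : `|s| <= S.
  apply: le_trans (ler_normD _ _) _; apply: lerD.
    apply: le_trans (ler_normD _ _) _; rewrite normr1 lerD2l !normrM.
    by rewrite ger0_norm // -mulrA ler_pM2l // ler_piMl.
  by rewrite normrM ger0_norm // ler_piMl.
have sr : s * r <= e ^+ 2 * (S * B).
  apply: le_trans (ler_norm _) _; rewrite normrM mulrCA.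
  by apply: ler_pM.
have t1 : e ^+ 2 * (al2 * K - 4 * al * t) <= e ^+ 2 * `|al2 * K - 4 * al * t|.
  by rewrite ler_wpM2l // ler_norm.
have t2 : - (2 * e ^+ 3 * (al2 * t)) <= e ^+ 2 * (2 * `|al2 * t|).
  have -> : - (2 * e ^+ 3 * (al2 * t)) = e ^+ 2 * (2 * - (e * (al2 * t))) by ring.
  rewrite ler_wpM2l // ler_pM2l //; apply: le_trans (ler_norm _) _.
  by rewrite normrN normrM ler_piMl.
have := le1; rewrite rhoE.
have -> : s * (K - 2 * e * t + r) = K + 2 * e * (K * al - t) +
   e ^+ 2 * (al2 * K - 4 * al * t) - 2 * e ^+ 3 * (al2 * t) + s * r by rewrite /s; ring.
by move: sr t1 t2; rewrite !mulrDr; move: (s * r) => w; lra.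
Qed.

Lemma qb_conjD (l : seq M) x y : qb_conj l (x + y) = qb_conj l x + qb_conj l y.
Proof.
by rewrite /qb_conj -big_split; apply: eq_bigr => z _; rewrite mulrDr mulrDl.
Qed.

Lemma qb_conjZ (l : seq M) c x : qb_conj l (c *: x) = c *: qb_conj l x.
Proof.
by rewrite /qb_conj scaler_sumr; apply: eq_bigr => z _; rewrite -scalerAr -scalerAl.
Qed.

Lemma qb_conj_star (l : seq M) x : star (qb_conj l x) = qb_conj l (star x).
Proof.
by rewrite /qb_conj star_sum; apply: eq_bigr => z _; rewrite !starM starK mulrA.
Qed.

Lemma qb_conj1 (l : seq M) : qb_conj l 1 = \sum_(z <- l) z * star z.
Proof. by apply: eq_bigr => z _; rewrite mulr1. Qed.

Lemma cnorm_qb_conj (l : seq M) x :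
  cnorm (qb_conj l x) <= (\sum_(z <- l) cnorm z ^+ 2) * cnorm x.
Proof.
apply: le_trans (cnorm_sum _ _ _) _; rewrite mulr_suml; apply: ler_sum => z _.
apply: le_trans (cnormM _ _) _; rewrite cnorm_starE expr2 mulrAC.
by rewrite ler_wpM2r ?cnorm_ge0 // cnormM.
Qed.

Lemma index_gt0 C E l (K : R) : cstar_subalgebra C -> quasi_basis C E l ->
  \sum_(z <- l) z * star z = scal K -> 0 < K.
Proof.
move=> hC hl hK; have hp : cpos (scal K).
  by rewrite -hK; apply: cpos_sum => z; rewrite -{1}[z]starK; apply: cpos_star_mul.
rewrite lt_neqAle eq_sym (cpos_scal_ge0 hp) andbT; apply/eqP => K0.
have [/eqP] := hl.2 1 (csub_one hC).
rewrite big_seq big1 ?oner_eq0 // => z zl.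
have := @sum_star_mul_eq0 _ _ _ l star; rewrite (eq_bigr (fun z => z * star z)).
  by rewrite hK K0 rmorph0 scale0r => /(_ erefl _ zl) h; rewrite -[z]starK h star0 mul0r.
by move=> w _; rewrite starK.
Qed.

(* E is compared with the expectations x |-> E (g x g) / E (g^2) for g = 1 + eps k,
   whose index is E (g^2) times the sum of the z g^-2 z^*. *)
Lemma minimal_spherical C D E (K : R) l :
  expectation C D E -> trivial_center C -> trivial_center D ->
  quasi_basis C E l -> \sum_(z <- l) z * star z = scal K ->
  (forall (F : M -> M) (s : R), cond_exp C D F -> has_index C F s -> K <= s) ->
  forall x, relcommutant D C x -> qb_conj l x = K%:C *: E x.
Proof.
move=> hCDE tC tD hl hK minK; have [hC hD DC hE] := hCDE.
have Cl z : z \in l -> C z by exact: hl.1.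
have sa_case k : relcommutant D C k -> star k = k -> qb_conj l k = K%:C *: E k.
  move=> hk sk; have Ck := hk.1.
  have real_E y : relcommutant D C y -> star y = y -> exists t : R, E y = scal t.
    move=> hy sy; have [c cE] := tD _ (ce_relcomm hCDE hy).
    exists (complex.Re c); rewrite -sa_scalar // -cE -(ce_star hCDE) ?sy //; exact: hy.1.
  have real_conj y : relcommutant D C y -> star y = y ->
      exists t : R, qb_conj l y = scal t.
    move=> hy sy; have [c cE] := tC _ (qb_conj_relcomm hCDE hl hy).
    by exists (complex.Re c); rewrite -sa_scalar // -cE qb_conj_star sy.
  have hkk : relcommutant D C (k * k) by apply: relcommM.
  have [al alE] := real_E _ hk sk.
  have [al2 al2E] := real_E (k * k) hkk (etrans (starM _ _) (congr2 *%R sk sk)).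
  have [t tE] := real_conj _ hk sk.
  pose L := \sum_(z <- l) cnorm z ^+ 2.
  have L0 : 0 <= L by apply: sumr_ge0 => z _; rewrite exprn_ge0 ?cnorm_ge0.
  have k1 : 0 < cnorm k + 1 by rewrite ltr_wpDl ?cnorm_ge0.
  pose e0 := (2 * (cnorm k + 1))^-1.
  have e0_gt0 : 0 < e0 by rewrite invr_gt0 mulr_gt0.
  suff tK : t = K * al by rewrite tE tK alE rmorphM scalerA.
  (* The constant 16: since [cnorm (c * c) <= 4] and [|e| * cnorm k <= 1/2], the remainder [d] below
     is at most [3 * 4 + 2 * (1/2) * 4] times [cnorm k ^+ 2]; [L] bounds the conjugation
     [qb_conj l]. *)
  apply: (@stationary _ al al2 _ (L * (16 * cnorm k ^+ 2)) _ e0_gt0) => e le_e.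
  have ek : `|e| * cnorm k <= 2^-1.
    have : `|e| * (cnorm k + 1) <= 2^-1.
      by rewrite -ler_pdivlMr // -invfM.
    by rewrite mulrDr mulr1; have := normr_ge0 e; lra.
  pose h := - (e%:C *: k); have nh : cnorm h <= 2^-1 by rewrite cnormN cnormZr.
  have Ch : C h by apply: csubN => //; apply: csub_scale.
  have h1 : cnorm h < 1 by apply: le_lt_trans nh _; lra.
  have [c [Cc gc cg nc]] := neumann hC Ch h1.
  pose g := 1 - h; rewrite -/g in gc cg.
  have gE : g = 1 + e%:C *: k by rewrite /g opprK.
  clearbody g.
  have Cg : C g by rewrite gE; apply: csub_add => //; [exact: csub_one|exact: csub_scale].
  have sg : star g = g by rewrite gE starD star1 starZr sk.
  have sc : star c = c by exact: inverse_sa sg gc cg.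
  have gD b : D b -> b * g = g * b.
    by move=> Db; rewrite gE mulrDr mulrDl mulr1 mul1r -scalerAr -scalerAl hk.2.
  have cD b : D b -> b * c = c * b by move=> Db; apply: inverse_comm gc cg (gD _ Db).
  have nc2 : cnorm c <= 2.
    apply: le_trans nc _; rewrite -[leRHS]invrK lef_pV2 ?posrE ?invr_gt0 ?subr_gt0 //.
    by lra.
  have hcc : relcommutant D C (c * c).
    by apply: relcommM => //; split => // b Db; rewrite cD.
  have [rho rhoE] := real_conj _ hcc (etrans (starM _ _) (congr2 *%R sc sc)).
  exists rho; set s := 1 + 2 * e * al + e ^+ 2 * al2.
  have ggE : E (g * g) = scal s.
    have -> : g * g = 1 + ((2 * e)%:C *: k + (e ^+ 2)%:C *: (k * k)) by rewrite gE; nc_ring.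
    have Ckk := hkk.1; have CZ := csub_scale hC; have CA := csub_add hC.
    have C1 := csub_one hC.
    have -> : E (1 + ((2 * e)%:C *: k + (e ^+ 2)%:C *: (k * k))) =
        1 + ((2 * e)%:C *: E k + (e ^+ 2)%:C *: E (k * k)).
      rewrite (ceD hCDE) ?(ce_id hE (csub_one hD)) //; last by apply: (CA); apply: CZ.
      by rewrite (ceD hCDE) ?(ceZ hCDE) //; apply: CZ.
    by rewrite alE al2E /s; nc_ring.
  have s0 : 0 < s.
    have : cpos (scal s) by rewrite -ggE -{1}sg; apply: cpos_ce hCDE _ Cg.
    move=> /cpos_scal_ge0; rewrite le_eqVlt => /orP[/eqP s_eq0|//].
    have g0 : g = 0 by apply: (ce_faithful hCDE hl Cg); rewrite sg ggE -s_eq0 rmorph0 scale0r.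
    by move: gc; rewrite g0 mul0r => /esym/eqP; rewrite oner_eq0.
  have ss : s^-1%:C * s%:C = 1 :> R[i] by rewrite -rmorphM mulVf // gt_eqF.
  have CM x y : C x -> C y -> C (x * y) by exact: csub_mul.
  have CS x : C x -> C (star x) by exact: csub_star.
  have gbg b x b' : D b -> D b' -> g * (b * x * b') * g = b * (g * x * g) * b'.
    by move=> Db Db'; rewrite !mulrA -gD // -!mulrA gD.
  split.
    apply: (minK (fun x => s^-1%:C *: E (g * x * g))).
      split.
      - move=> x Cx; apply: csub_scale => //; apply: (ce_range hE).
        by apply: (CM) => //; apply: (CM).
      - move=> a x y Cx Cy.
        have -> : g * (a *: x + y) * g = a *: (g * x * g) + g * y * g by nc_ring.
        rewrite (ce_linear hE) ?scalerDr; try by do ?[apply: (CM)].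
        by rewrite !scalerA mulrC.
      - move=> b Db; rewrite -[g * b]gD // -mulrA (ceMl hCDE) ?ggE //; last exact: CM.
        by rewrite -scalerAr mulr1 scalerA ss scale1r.
      - move=> b x b' Db Cx Db'; rewrite gbg // (ce_bimod hE) //.
          by rewrite -scalerAr -scalerAl.
        by apply: (CM) => //; apply: (CM).
      - move=> x Cx; have [b Db bE] := ce_pos hE (CM _ _ Cx Cg).
        exists ((Num.sqrt s^-1)%:C *: b); first exact: csub_scale.
        rewrite starZr -scalerAl -scalerAr scalerA -rmorphM -expr2 sqr_sqrtr ?invr_ge0 ?ltW //.
        by rewrite -bE starM sg !mulrA.
    have rs : Num.sqrt s * Num.sqrt s = s by rewrite -expr2 sqr_sqrtr // ltW.
    (* Quasi-basis of the perturbed expectation: [z g^-1] rescaled by the root of [s = E (g * g)].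
       Its index is [s * rho], because [rho] is the value of [qb_conj l (c * c)]. *)
    pose u z := (Num.sqrt s)%:C *: (z * c).
    have su z : star (u z) = (Num.sqrt s)%:C *: (c * star z) by rewrite starZr starM sc.
    have rsr : (Num.sqrt s)%:C * (s^-1%:C * (Num.sqrt s)%:C) = 1 :> R[i].
      by rewrite mulrCA -rmorphM rs ss.
    exists [seq u z | z <- l].
      split=> [_ /mapP[z /Cl Cz ->]|x Cx]; first by apply: csub_scale => //; apply: CM.
      rewrite !big_map; split.
        transitivity ((\sum_(z <- l) z * E (star z * (x * g))) * c).
          by rewrite (qb_left hl) -?mulrA ?gc ?mulr1 //; apply: CM.
        rewrite mulr_suml; apply: eq_big_seq => z /Cl Cz.
        have Cszxg : C (star z * (x * g)) by apply: (CM); [exact: CS|exact: CM].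
        have -> : g * (star (u z) * x) * g = (Num.sqrt s)%:C *: (star z * (x * g)).
          by rewrite su -scalerAl -scalerAr -scalerAl !mulrA gc mul1r.
        rewrite (ceZ hCDE) // /u -scalerAl -!scalerAr !scalerA -mulrA rsr scale1r -!mulrA.
        by rewrite cD //; apply: (ce_range hE).
      transitivity (c * (\sum_(z <- l) E (g * x * z) * star z)).
        by rewrite (qb_right hl) ?mulrA ?cg ?mul1r //; apply: CM.
      rewrite mulr_sumr; apply: eq_big_seq => z /Cl Cz.
      have Cgxz : C (g * x * z) by do ?[apply: (CM)].
      have -> : g * (x * u z) * g = (Num.sqrt s)%:C *: (g * x * z).
        by rewrite /u -!scalerAr -scalerAl -!mulrA cg mulr1.
      rewrite (ceZ hCDE) // su -!scalerAl -!scalerAr !scalerA -mulrA.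
      rewrite (mulrC _ (Num.sqrt s)%:C) rsr scale1r (mulrA _ c) cD ?mulrA //.
      exact: (ce_range hE).
    rewrite big_map; under eq_bigr => z _ do
      rewrite su -scalerAl -scalerAr scalerA -rmorphM rs mulrA -(mulrA z).
    by rewrite -scaler_sumr -/(qb_conj l (c * c)) rhoE scalerA -rmorphM.
  (* Exact second-order remainder of [(1 + e k)^-2], from [(1 - 2x) (1 + x)^2 = 1 - 3x^2 - 2x^3] at
     [x = e k]. *)
  pose d := (3%:R : R)%:C *: (k * k * (c * c)) + (2 * e)%:C *: (k * k * k * (c * c)).
  have ccE : c * c = 1 - (2 * e)%:C *: k + (e ^+ 2)%:C *: d.
    have : (1 - (2 * e)%:C *: k) * (g * g * (c * c)) = 1 - (2 * e)%:C *: k.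
      by rewrite -(mulrA g) (mulrA g c) gc mul1r gc mulr1.
    move=> <-; rewrite gE /d; nc_ring.
  have -> : `|rho - K + 2 * e * t| = cnorm (scal (rho - K + 2 * e * t)).
    by rewrite cnorm_scalar.
  have -> : scal (rho - K + 2 * e * t) = (e ^+ 2)%:C *: qb_conj l d.
    clearbody d; have := rhoE; rewrite ccE !qb_conjD -scaleNr !qb_conjZ qb_conj1 hK tE => rhoE'.
    rewrite scalD scalB -rhoE'; nc_ring.
  rewrite cnormZr ger0_norm ?sqr_ge0 // ler_wpM2l ?sqr_ge0 //.
  apply: le_trans (cnorm_qb_conj _ _) _; rewrite -/L ler_wpM2l //.
  have kap := cnorm_ge0 k; have kk : cnorm (k * k) <= cnorm k ^+ 2 by rewrite expr2 cnormM.
  have cc4 : cnorm (c * c) <= 4.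
    by apply: le_trans (cnormM _ _) _; have := cnorm_ge0 c; nra.
  apply: le_trans (cnormD _ _) _; rewrite !cnormZr !normrM (ger0_norm (ler0n _ 3)) (ger0_norm (ler0n _ 2)).
  have n1 : cnorm (k * k * (c * c)) <= cnorm k ^+ 2 * 4.
    by apply: le_trans (cnormM _ _) _; apply: ler_pM; rewrite ?cnorm_ge0.
  have n2 : cnorm (k * k * k * (c * c)) <= cnorm k * (cnorm k ^+ 2 * 4).
    rewrite -!(mulrA k); apply: le_trans (cnormM _ _) _; rewrite ler_wpM2l //.
    by rewrite mulrA.
  have : `|e| * cnorm (k * k * k * (c * c)) <= 2^-1 * (cnorm k ^+ 2 * 4).
    apply: le_trans (ler_wpM2l (normr_ge0 _) n2) _; rewrite (mulrA `|e|).
    by rewrite ler_wpM2r // mulr_ge0 // exprn_ge0.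
  rewrite -(mulrA 2); move: n1; move: (cnorm k ^+ 2) (`|e| * _) (cnorm (k * k * _)) => a1 a2 a3; lra.
move=> x hx; have [h [k [sh sk xE hE' kE]]] := sa_re_im x.
have hsx : relcommutant D C (star x) by apply: relcommS.
have hh : relcommutant D C h.
  by rewrite hE'; apply: relcommZ => //; apply: relcommD.
have hk : relcommutant D C k.
  by rewrite kE; apply: relcommZ => //; apply: relcommB.
rewrite xE qb_conjD qb_conjZ !sa_case // (ceD hCDE) ?(ceZ hCDE) //.
- by rewrite scalerDr !scalerA mulrC.
- exact: hk.1.
- exact: hh.1.
- by apply: csub_scale => //; exact: hk.1.
Qed.

End MinimalExpectation.

(** * The Jones tower *)

Section SphericalExpectations.
Context {R : realType} {M : cstarAlgType R}.
Implicit Types (x y z a b : M) (C D : set M) (E F : M -> M) (K : R).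

Definition spherical_basis C D E (l : seq M) K : Prop :=
  [/\ quasi_basis C E l, \sum_(z <- l) z * star z = K%:C%:A &
      forall x, relcommutant D C x -> qb_conj l x = K%:C *: E x].

Lemma expectation_comp C D D' E F :
  expectation C D E -> expectation D D' F -> expectation C D' (fun x => F (E x)).
Proof.
move=> hE hF; have [hC hD DC cE] := hE; have [_ hD' D'D cF] := hF.
split=> //; first by move=> x /D'D /DC.
have rE x : C x -> D (E x) by exact: (ce_range cE).
split.
- by move=> x /rE; apply: (ce_range cF).
- by move=> c x y Cx Cy; rewrite (ce_linear cE) // (ce_linear cF) //; apply: rE.
- by move=> b Db; rewrite (ce_id cE) ?(ce_id cF) //; apply: D'D.
- move=> b x b' Db Cx Db'; have [Db2 Db'2] := (D'D _ Db, D'D _ Db').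
  by rewrite (ce_bimod cE) // (ce_bimod cF) //; apply: rE.
- by move=> x /(ce_pos cE)[b Db ->]; apply: (ce_pos cF).
Qed.

(** Conjugating by the products is conjugating twice. The inner conjugation takes the commutant of
    [D'] into that of [D], so sphericality of [E] applies; [E] then passes inside, because [l2] lies
    in [D], and sphericality of [F] finishes. *)
Lemma spherical_comp C D D' E F l1 l2 K1 K2 :
  expectation C D E -> expectation D D' F ->
  spherical_basis C D E l1 K1 -> spherical_basis D D' F l2 K2 ->
  spherical_basis C D' (fun x => F (E x)) [seq u * v | u <- l1, v <- l2] (K1 * K2).
Proof.
move=> hE hF [q1 i1 s1] [q2 i2 s2]; have [hC hD DC cE] := hE; have [_ hD' D'D cF] := hF.
have rE x : C x -> D (E x) by exact: (ce_range cE).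
have CM x y : C x -> C y -> C (x * y) by exact: csub_mul.
have CS x : C x -> C (star x) by exact: csub_star.
have DS x : D x -> D (star x) by exact: csub_star.
have conjE x : qb_conj [seq u * v | u <- l1, v <- l2] x = qb_conj l1 (qb_conj l2 x).
  rewrite /qb_conj big_allpairs_dep; apply: eq_bigr => u _.
  rewrite mulr_sumr mulr_suml; apply: eq_bigr => v _.
  by rewrite starM !mulrA.
split.
- split.
    move=> z /allpairsP[[u v] /= [/q1.1 Cu /q2.1 Dv ->]].
    by apply: (CM) => //; apply: DC.
  move=> x Cx; rewrite !big_allpairs_dep; split.
    rewrite -[LHS](qb_left q1) //; apply: eq_big_seq => u /q1.1 Cu.
    have Dux : D (E (star u * x)) by apply/rE/CM => //; apply: CS.
    rewrite -[E (star u * x)](qb_left q2) // mulr_sumr.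
    apply: eq_big_seq => v /q2.1 Dv; have [Cv Dsv] := (DC _ Dv, DS _ Dv).
    by rewrite starM -!mulrA (ceMl hE Dsv (CM _ _ (CS _ Cu) Cx)).
  rewrite -[LHS](qb_right q1) //; apply: eq_big_seq => u /q1.1 Cu.
  have Dux : D (E (x * u)) by apply/rE/CM.
  rewrite -[E (x * u)](qb_right q2) // mulr_suml.
  apply: eq_big_seq => v /q2.1 Dv; have [Cv Dsv] := (DC _ Dv, DS _ Dv).
  by rewrite starM !mulrA (ceMr hE (CM _ _ Cx Cu) Dv).
- by rewrite -qb_conj1 conjE qb_conj1 i2 qb_conjZ qb_conj1 i1 scalerA -rmorphM mulrC.
- move=> x [Cx xD']; rewrite conjE.
  have hy : relcommutant D C (qb_conj l2 x).
    split; last by move=> a Da; rewrite (qb_conj_comm hF q2).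
    rewrite /qb_conj big_seq; apply: csub_sum => // z /q2.1 Dz.
    by apply: (CM); [apply: (CM) => //|]; apply: DC => //; apply: DS.
  rewrite s1 // /qb_conj (ce_sum hE); last first.
    by move=> z /q2.1 Dz; apply: (CM); [apply: (CM) => //|]; apply: DC => //; apply: DS.
  have -> : \sum_(z <- l2) E (z * x * star z) = qb_conj l2 (E x).
    by apply: eq_big_seq => z /q2.1 Dz; rewrite (ce_bimod cE) //; apply: DS.
  rewrite s2 ?scalerA ?rmorphM //.
  split; first exact: rE.
  by move=> b Db; rewrite -(ceMr hE) -?(ceMl hE) ?xD' //; apply: D'D.
Qed.

End SphericalExpectations.

(** * One step of the basic construction *)

Section BasicConstruction.
Context {R : realType} {M : cstarAlgType R}.
Variables (N P Q : set M) (E F : M -> M) (e : M) (idx : R) (l : seq M).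
Hypotheses (hE : expectation P N E) (hF : expectation Q P F).
Hypothesis hbc : basic_construction N P Q E e.
Hypothesis dualF : forall x y, P x -> P y -> F (x * e * y) = idx^-1%:C *: (x * y).
Hypothesis hl : quasi_basis P E l.
Hypothesis idx0 : 0 < idx.
Implicit Types (x y z a b : M).

Let hP : cstar_subalgebra P := exp_domain hE.
Let hN : cstar_subalgebra N := exp_codomain hE.
Let hQ : cstar_subalgebra Q := exp_domain hF.
Let NP x : N x -> P x. Proof. exact: (exp_subset hE). Qed.
Let PQ x : P x -> Q x. Proof. exact: (exp_subset hF). Qed.
Let Qe : Q e. Proof. by case: hbc. Qed.
Let P1 : P 1 := csub_one hP.
Let PM x y : P x -> P y -> P (x * y). Proof. exact: csub_mul. Qed.
Let PS x : P x -> P (star x). Proof. exact: csub_star. Qed.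
Let QM x y : Q x -> Q y -> Q (x * y). Proof. exact: csub_mul. Qed.
Let NE x : P x -> N (E x). Proof. exact: (ce_range (exp_cond_exp hE)). Qed.
Let PE x : P x -> P (E x). Proof. by move=> Px; apply/NP/NE. Qed.
Let Pl z : z \in l -> P z. Proof. exact: hl.1. Qed.

(** Equalities in [Q] are tested on the Hilbert module [P], where [x * e * y] acts as a rank-one
    operator. *)
Let bc_action : exists pi, [/\ basic_construction_action N P Q E e pi,
  forall a b, Q a -> Q b -> (forall z, P z -> pi a z = pi b z) -> a = b &
  forall x y z, P x -> P y -> P z -> pi (x * e * y) z = x * E (y * z)].
Proof.
have [_ _ [pi hpi]] := hbc; exists pi; split=> //.
  move=> a b Qa Qb h; apply/subr0_eq/(bca_inj hpi); first exact: csubB.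
  move=> z Pz; have := bca_lin hpi (-1) Qb Qa Pz.
  by rewrite scaleN1r addrC h // scaleN1r addNr.
move=> x y z Px Py Pz; have [[Qx Qy] Pyz] := (PQ Px, PQ Py, PM Py Pz).
rewrite (bca_mul hpi (QM Qx Qe) Qy Pz) (bca_left hpi Py Pz) (bca_mul hpi Qx Qe Pyz).
by rewrite (bca_proj hpi Pyz) (bca_left hpi Px (PE Pyz)).
Qed.

Let pi_sum pi (I : eqType) (r : seq I) (f : I -> M) z :
  basic_construction_action N P Q E e pi -> P z ->
  (forall i, i \in r -> Q (f i)) ->
  pi (\sum_(i <- r) f i) z = \sum_(i <- r) pi (f i) z.
Proof.
move=> hpi Pz; have pi0 : pi 0 z = 0.
  have := bca_lin hpi 1 (csub0 hQ) (csub0 hQ) Pz.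
  by rewrite !scale1r addr0 => /eqP; rewrite -subr_eq0 opprD addrA subrr sub0r oppr_eq0 => /eqP.
elim: r => [|i r IH] hf; first by rewrite !big_nil.
have Qi : Q (f i) by apply: hf; rewrite mem_head.
have hr j : j \in r -> Q (f j) by move=> jr; apply: hf; rewrite inE jr orbT.
have Qr : Q (\sum_(j <- r) f j) by rewrite big_seq; apply: csub_sum => // j; apply: hr.
by rewrite !big_cons -IH // -[f i]scale1r (bca_lin hpi 1 Qi Qr Pz) !scale1r.
Qed.

Lemma bc_span x : Q x -> exists2 s : seq (M * M),
  forall u, u \in s -> P u.1 /\ P u.2 & x = \sum_(u <- s) u.1 * e * u.2.
Proof.
have [pi [hpi inj piE]] := bc_action; move=> Qx.
have [s hs xE] := bca_span hpi Qx; exists s => //.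
have Qs u : u \in s -> Q (u.1 * e * u.2).
  by move=> /hs[/PQ q1 /PQ q2]; apply: (QM) => //; apply: (QM).
apply: inj => //; first by rewrite big_seq; apply: csub_sum.
move=> z Pz; rewrite xE // pi_sum //; apply: eq_big_seq => u /hs[u1 u2].
by rewrite piE.
Qed.

Lemma bc_compress x : P x -> e * x * e = E x * e.
Proof.
have [pi [hpi inj piE]] := bc_action; move=> Px; have Qx := PQ Px.
have Nx := NE Px; have PEx := NP Nx.
have Qex := QM Qe Qx; have QEx := PQ PEx.
apply: inj; do ?[exact: QM].
move=> z Pz; have PEz := PE Pz; have Pez : P (pi e z) by apply: (bca_range hpi).
rewrite (bca_mul hpi Qex Qe Pz) (bca_mul hpi Qe Qx Pez) (bca_mul hpi QEx Qe Pz).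
rewrite !(bca_proj hpi Pz) (bca_left hpi Px PEz) (bca_left hpi PEx PEz).
by rewrite (bca_proj hpi (PM Px PEz)) (ceMr hE) //; apply: NE.
Qed.

Lemma bc_rank_one x y a : P x -> P y -> P a ->
  (forall z, P z -> x * E (y * z) = a * z) -> x * e * y = a.
Proof.
have [pi [hpi inj piE]] := bc_action; move=> Px Py Pa h; have [Qx Qy] := (PQ Px, PQ Py).
apply: inj; [by apply: (QM) => //; apply: QM|exact: PQ|] => z Pz.
by rewrite piE // (bca_left hpi) // h.
Qed.

Lemma bc_idem : e * e = e.
Proof. by have := bc_compress P1; rewrite mulr1 (ce_id (exp_cond_exp hE)) ?mul1r //; apply: csub_one. Qed.

Lemma bc_comm b : N b -> b * e = e * b.
Proof.
have [pi [hpi inj piE]] := bc_action; move=> Nb; have Pb := NP Nb; have Qb := PQ Pb.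
apply: inj; do ?[by apply: (QM)].
move=> z Pz; rewrite (bca_mul hpi Qb Qe Pz) (bca_mul hpi Qe Qb Pz).
rewrite (bca_proj hpi Pz) (bca_left hpi Pb (PE Pz)) (bca_left hpi Pb Pz).
by rewrite (bca_proj hpi (PM Pb Pz)) (ceMl hE).
Qed.

Lemma bc_star : star e = e.
Proof.
have [pi [hpi inj piE]] := bc_action; have Qs : Q (star e) by apply: csub_star.
apply: inj => // z Pz; rewrite (bca_proj hpi) //.
have Pse : P (pi (star e) z) by apply: (bca_range hpi).
apply/subr0_eq/(qb_eq0 hE hl); first by apply: csubB => //; apply: PE.
move=> a Pa; have Psa := PS Pa; rewrite mulrBr (ceB hE); try by apply: (PM) => //; apply: PE.
rewrite -{1}[a]starK -(bca_star hpi Qe Psa Pz) (bca_proj hpi) //.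
rewrite (ce_star hE) // starK (ceMl hE) //; last exact: NE.
by rewrite (ceMr hE) ?subrr //; apply: NE.
Qed.

Lemma bc_inj a : P a -> a * e = 0 -> a = 0.
Proof.
have [pi [hpi inj piE]] := bc_action; move=> Pa ae.
have := piE a 1 1 Pa P1 P1; rewrite !mulr1 ae (ce_id (exp_cond_exp hE)) ?mulr1; last exact: csub_one.
move=> <-; have := bca_lin hpi 1 (csub0 hQ) (csub0 hQ) P1.
by rewrite !scale1r addr0 => /eqP; rewrite -subr_eq0 opprD addrA subrr sub0r oppr_eq0 => /eqP.
Qed.

(** The reconstruction formula of the quasi-basis, read as an identity between operators on [P]. *)
Lemma bc_unit : \sum_(z <- l) z * e * star z = 1.
Proof.
have [pi [hpi inj piE]] := bc_action.
have Qz z : z \in l -> Q (z * e * star z).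
  by move=> /Pl Pz; apply: (QM); [apply: (QM) => //; exact: PQ|apply/PQ/PS].
apply: inj; [by rewrite big_seq; apply: csub_sum|exact: csub_one|].
move=> z Pz; rewrite pi_sum // (bca_left hpi) // mul1r -[RHS](qb_left hl) //.
by apply: eq_big_seq => w /Pl Pw; rewrite piE //; apply: PS.
Qed.

Lemma bc_corner x : Q x -> exists2 c, N c & e * x * e = c * e.
Proof.
move=> /bc_span[s hs ->]; exists (\sum_(u <- s) E u.1 * E u.2).
  rewrite big_seq; apply: csub_sum => // u /hs[u1 u2].
  by apply: csub_mul => //; apply: NE.
rewrite mulr_sumr !mulr_suml; apply: eq_big_seq => u /hs[u1 u2].
rewrite !mulrA bc_compress // -!mulrA (mulrA e) bc_compress //.
Qed.

(** The push-down property: every element of [Q e] is already of the form [y * e] with [y] in [P],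
    namely [y = idx * F (x * e)]. *)
Lemma bc_push_right x : Q x -> F (x * e) * e = idx^-1%:C *: (x * e).
Proof.
move=> /bc_span[s hs ->]; have Qs u : u \in s -> Q (u.1 * e * u.2 * e).
  by move=> /hs[/PQ q1 /PQ q2]; do ?[apply: (QM) => //].
rewrite mulr_suml (ce_sum hF) // mulr_suml scaler_sumr.
apply: eq_big_seq => u /hs[u1 u2]; have PE2 := PE u2.
have -> : u.1 * e * u.2 * e = u.1 * E u.2 * e * 1.
  by rewrite mulr1 -!mulrA (mulrA e) bc_compress.
by rewrite dualF ?mulr1 -?scalerAl //; apply: (PM).
Qed.

Lemma bc_push_left x : Q x -> e * F (e * x) = idx^-1%:C *: (e * x).
Proof.
move=> Qx; have Qs : Q (star x) by apply: csub_star.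
have := congr1 star (bc_push_right Qs).
rewrite starZr !starM bc_star starK -(ce_star hF) ?starM ?starK ?bc_star //.
exact: QM.
Qed.

Lemma bc_expectation_e : F e = idx^-1%:C%:A.
Proof. by have := dualF P1 P1; rewrite !mul1r !mulr1. Qed.

Let tau_idx : idx%:C * idx^-1%:C = 1 :> R[i].
Proof. by rewrite -rmorphM mulfV // gt_eqF. Qed.

Let sqrt_idx : (Num.sqrt idx)%:C * (Num.sqrt idx)%:C = idx%:C :> R[i].
Proof. by rewrite -rmorphM -expr2 sqr_sqrtr // ltW. Qed.

(** The factor [Num.sqrt idx], which occurs twice in each reconstruction term, compensates
    [F e = idx^-1]. *)
Definition dual_basis := [seq (Num.sqrt idx)%:C *: (z * e) | z <- l].

Lemma star_dual z : star ((Num.sqrt idx)%:C *: (z * e)) = (Num.sqrt idx)%:C *: (e * star z).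
Proof. by rewrite starZr starM bc_star. Qed.

Lemma bc_quasi_basis : quasi_basis Q F dual_basis.
Proof.
split.
  by move=> _ /mapP[z /Pl /PQ Qz ->]; apply: csub_scale => //; apply: QM.
move=> x Qx; rewrite !big_map; have [s hs xE] := bc_span Qx.
have Qs u : u \in s -> Q (u.1 * e * u.2).
  by move=> /hs[/PQ q1 /PQ q2]; do ?[apply: (QM) => //].
split.
  have termE z : z \in l -> (Num.sqrt idx)%:C *: (z * e) *
      F (star ((Num.sqrt idx)%:C *: (z * e)) * x) = z * e * star z * x.
    move=> /Pl Pz; have [Qz Qsz] := (PQ Pz, PQ (PS Pz)).
    rewrite star_dual -!scalerAl (ceZ hF); last by do ?[apply: (QM) => //].
    rewrite -scalerAr scalerA sqrt_idx -!mulrA bc_push_left; last exact: QM.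
    by rewrite -scalerAr scalerA tau_idx scale1r.
  by rewrite (eq_big_seq _ termE) -mulr_suml bc_unit mul1r.
have termE z : z \in l -> F (x * ((Num.sqrt idx)%:C *: (z * e))) *
    star ((Num.sqrt idx)%:C *: (z * e)) = x * (z * e * star z).
  move=> /Pl Pz; have [Qz Qsz] := (PQ Pz, PQ (PS Pz)).
  rewrite star_dual -!scalerAr (ceZ hF); last by do ?[apply: (QM) => //].
  rewrite -scalerAl scalerA sqrt_idx !mulrA bc_push_right; last exact: QM.
  by rewrite -!scalerAl scalerA tau_idx scale1r.
by rewrite (eq_big_seq _ termE) -mulr_sumr bc_unit mulr1.
Qed.

(** For [z] central in [Q], the corner gives [z * e = c * e] with [c] central in [N], hence a
    scalar. The conjugates of [e] by the quasi-basis sum to 1, so [z] is that same scalar. *)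
Lemma bc_trivial_center : trivial_center N -> trivial_center Q.
Proof.
move=> tN z [Qz zQ]; have [c Nc cE] := bc_corner Qz.
have ze : z * e = c * e by rewrite -cE -zQ // -mulrA bc_idem.
have hc : relcommutant N N c.
  split=> // b Nb; have Qb := PQ (NP Nb).
  apply/subr0_eq/bc_inj; first by apply: csubB => //; apply/PM; apply: NP.
  rewrite mulrBl -!mulrA bc_comm // !mulrA -ze -!mulrA -(bc_comm Nb).
  by rewrite (mulrA z) zQ // -(mulrA b z) ze subrr.
have [t tE] := tN _ hc; exists t.
have tsum : t%:A = \sum_(w <- l) t *: (w * e * star w) by rewrite -scaler_sumr bc_unit.
have zsum : z = \sum_(w <- l) z * (w * e * star w) by rewrite -mulr_sumr bc_unit mulr1.
rewrite zsum tsum; apply: eq_big_seq => w /Pl Pw; have Qw := PQ Pw.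
have -> : z * (w * e * star w) = w * (z * e) * star w by rewrite !mulrA zQ.
by rewrite ze tE; nc_ring.
Qed.

(** The conjugation by the dual basis sees [x] only through [e * x * e = c * e], where [c] is a
    scalar, and so returns [idx * c]. On the other hand [c = idx * E m] for [m = F (e * x)];
    sphericality of [E] writes this as the conjugation of [m], which equals [F x] because [x]
    commutes with [P]. *)
Lemma bc_spherical : trivial_center N -> spherical_basis P N E l idx ->
  spherical_basis Q P F dual_basis idx.
Proof.
move=> tN [_ iE sE]; have conjE x : qb_conj dual_basis x =
    idx%:C *: (\sum_(z <- l) z * (e * x * e) * star z).
  rewrite /qb_conj big_map scaler_sumr; apply: eq_bigr => z _.
  by rewrite star_dual -!scalerAl -scalerAr scalerA sqrt_idx !mulrA.
split; first exact: bc_quasi_basis.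
  rewrite -qb_conj1 conjE mulr1 bc_idem.
  by rewrite bc_unit.
move=> x [Qx xP]; rewrite conjE; congr (_ *: _).
have [c Nc cE] := bc_corner Qx; rewrite cE.
have hc : relcommutant N N c.
  split=> // b Nb; have Pb := NP Nb.
  apply/subr0_eq/bc_inj; first by apply: csubB => //; apply/PM; apply: NP.
  rewrite mulrBl -!mulrA bc_comm // !mulrA -cE -!mulrA -(bc_comm Nb).
  by rewrite (mulrA x) xP // !mulrA -(bc_comm Nb) -!mulrA (mulrA e) cE subrr.
have [t tE] := tN _ hc; pose m := F (e * x).
have hm : relcommutant N P m.
  split; first by apply: (ce_range (exp_cond_exp hF)); apply: QM.
  move=> b Nb; have Pb := NP Nb; rewrite /m -(ceMr hF (QM Qe Qx) Pb).
  rewrite -(ceMl hF Pb (QM Qe Qx)); congr F.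
  by rewrite -mulrA xP // !mulrA bc_comm.
have exE : e * x = idx%:C *: (e * m).
  by rewrite bc_push_left // scalerA tau_idx scale1r.
have cm : c = idx%:C *: E m.
  apply/subr0_eq/bc_inj.
    by apply: csubB hP (NP Nc) _; apply: (csub_scale hP); exact: PE hm.1.
  by rewrite mulrBl -cE exE -!scalerAl bc_compress ?subrr //; exact: hm.1.
have -> : \sum_(z <- l) z * (c * e) * star z = c.
  rewrite -[RHS]mulr1 -bc_unit mulr_sumr; apply: eq_bigr => z _.
  by rewrite tE !mulrA -!scalerAl -!scalerAr mul1r mulr1 -!scalerAl.
rewrite cm -sE // /qb_conj.
transitivity (F (\sum_(z <- l) z * e * star z * x)).
  rewrite (ce_sum hF).
    apply: eq_big_seq => z /Pl Pz; have Psz := PS Pz; rewrite /m.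
    rewrite -(ce_bimod (exp_cond_exp hF) Pz (QM Qe Qx) Psz); congr F.
    by rewrite -!mulrA xP.
  move=> z /Pl Pz; have [Qz Qsz] := (PQ Pz, PQ (PS Pz)).
  by do ?[apply: (QM) => //].
by rewrite -mulr_suml bc_unit mul1r.
Qed.

End BasicConstruction.

(** * Sphericality along the tower and the Jones relations *)

Section JonesTower.
Context {R : realType} {M : cstarAlgType R}.
Variables (B : set M) (A : nat -> set M) (E : nat -> M -> M) (e : nat -> M) (idx : R).
Hypotheses (hB : simple_algebra B) (hA : simple_algebra (A 0%N)).
Hypothesis hT : jones_tower B A E e idx.
Implicit Types (x y z a b : M) (n m : nat).

Let P := prev_alg B A.

Lemma tower_expectation n : expectation (A n) (P n) (E n).
Proof.
case: n => [|n]; split.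
- exact: jt_A hT _.
- exact: jt_B hT.
- exact: jt_sub hT.
- by case: (jt_minimal hT).
- exact: jt_A hT _.
- exact: jt_A hT _.
- by case: (jt_basic hT n).
- exact: jt_cond_exp hT _.
Qed.

Lemma tower_sub m n : (m <= n)%N -> A m `<=` A n.
Proof.
elim: n => [|n IH]; first by rewrite leqn0 => /eqP->.
rewrite leq_eqVlt => /orP[/eqP->//|/IH mn] x /mn.
exact: (exp_subset (tower_expectation n.+1)).
Qed.

Lemma tower_subB n : B `<=` A n.
Proof. by move=> x /(jt_sub hT); apply: tower_sub. Qed.

Let simple_centers : trivial_center B /\ trivial_center (A 0%N).
Proof.
by split; apply: simple_trivial_center => //; [exact: jt_B hT|exact: jt_A hT _].
Qed.

Lemma tower_base_spherical : exists l, spherical_basis (A 0%N) B (E 0%N) l idx.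
Proof.
have [_ [l hl iE] minE] := jt_minimal hT; exists l; split => //.
exact: (minimal_spherical (tower_expectation 0) simple_centers.2 simple_centers.1 hl iE minE).
Qed.

Lemma idx_gt0 : 0 < idx.
Proof.
by have [l [hl iE _]] := tower_base_spherical; apply: index_gt0 hl iE; apply: jt_A hT _.
Qed.

Lemma tower_spherical n : exists l, spherical_basis (A n) (P n) (E n) l idx.
Proof.
(* Two consecutive centres are carried along, because the basic construction transports triviality
   of the centre from [A_(n-1)] to [A_(n+1)]. *)
suff : [/\ trivial_center (P n), trivial_center (P n.+1) &
    exists l, spherical_basis (A n) (P n) (E n) l idx] by case.
elim: n => [|n [tP tA [l hl]]].
  by have [tB tA] := simple_centers; split => //; apply: tower_base_spherical.
have [hE hF] := (tower_expectation n, tower_expectation n.+1).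
have [ql _ _] := hl; have bc := jt_basic hT n; split => //.
  exact: bc_trivial_center hE hF bc ql tP.
exists (dual_basis (e n.+1) idx l).
by apply: bc_spherical hE hF bc _ ql idx_gt0 tP hl; apply: jt_dual hT _.
Qed.

Lemma comp_exp_expectation n : expectation (A n) B (comp_exp E n).
Proof.
elim: n => [|n IH]; first exact: tower_expectation 0.
exact: expectation_comp (tower_expectation n.+1) IH.
Qed.

Lemma comp_exp_spherical n :
  exists l, spherical_basis (A n) B (comp_exp E n) l (idx ^+ n.+1).
Proof.
elim: n => [|n [l2 h2]]; first by rewrite expr1; exact: tower_base_spherical.
have [l1 h1] := tower_spherical n.+1; exists [seq u * v | u <- l1, v <- l2].
rewrite exprS.
exact: spherical_comp (tower_expectation n.+1) (comp_exp_expectation n) h1 h2.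
Qed.

Let basic n : [/\ expectation (A n) (P n) (E n), expectation (A n.+1) (A n) (E n.+1) &
  basic_construction (P n) (A n) (A n.+1) (E n) (e n.+1)].
Proof.
by split; [exact: tower_expectation|exact: (tower_expectation n.+1)|exact: jt_basic hT n].
Qed.

Lemma jones_mem n : A n.+1 (e n.+1).
Proof. by case: (jt_basic hT n). Qed.

Lemma jones_compress n x : A n x -> e n.+1 * x * e n.+1 = E n x * e n.+1.
Proof. by have [h1 h2 h3] := basic n; exact: (bc_compress h1 h2 h3). Qed.

Lemma jones_idem n : e n.+1 * e n.+1 = e n.+1.
Proof. by have [h1 h2 h3] := basic n; apply: bc_idem h1 h2 h3. Qed.

Lemma jones_comm n b : P n b -> b * e n.+1 = e n.+1 * b.
Proof. by have [h1 h2 h3] := basic n; exact: (bc_comm h1 h2 h3). Qed.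

Lemma jones_star n : star (e n.+1) = e n.+1.
Proof.
have [h1 h2 h3] := basic n; have [l [hl _ _]] := tower_spherical n.
exact: bc_star h1 h2 h3 hl.
Qed.

Lemma jones_push_right n x :
  A n.+1 x -> E n.+1 (x * e n.+1) * e n.+1 = idx^-1%:C *: (x * e n.+1).
Proof.
by have [h1 h2 h3] := basic n; apply: bc_push_right h1 h2 h3 _ _; apply: jt_dual hT _.
Qed.

Lemma jones_push_left n x :
  A n.+1 x -> e n.+1 * E n.+1 (e n.+1 * x) = idx^-1%:C *: (e n.+1 * x).
Proof.
have [h1 h2 h3] := basic n; have [l [hl _ _]] := tower_spherical n.
by apply: bc_push_left h1 h2 h3 _ hl _; apply: jt_dual hT _.
Qed.

Lemma jones_expectation n : E n.+1 (e n.+1) = idx^-1%:C%:A.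
Proof. by have [h1 _ _] := basic n; apply: (bc_expectation_e h1); apply: jt_dual hT _. Qed.

Lemma jones_braid_up n :
  e n.+2 * e n.+1 * e n.+2 = idx^-1%:C *: e n.+2.
Proof.
by rewrite jones_compress ?jones_expectation -?scalerAl ?mul1r //; exact: jones_mem.
Qed.

(** Checked on the module: [e_(n+2)] acts on [A_(n+1)] as [E_(n+1)], and the push-down identity
    turns [e_(n+1) E_(n+1)(e_(n+1) z)] into [idx^-1] times [e_(n+1) z]. *)
Lemma jones_braid_down n :
  e n.+1 * e n.+2 * e n.+1 = idx^-1%:C *: e n.+1.
Proof.
have [h1 h2 h3] := basic n.+1; have Ae := jones_mem n.
apply: (bc_rank_one h1 h2 h3) => //; first by apply: csub_scale => //; exact: jt_A hT _.
by move=> z Az; rewrite jones_push_left // -scalerAl.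
Qed.

Local Notation tau := (idx^-1%:C : R[i]).

Lemma jones_word_mem n : A n (jones_word e n).
Proof.
elim: n => [|n IH] /=; first by apply: csub_one; exact: jt_A hT _.
apply: csub_mul; [exact: jt_A hT _|exact: jones_mem|exact: tower_sub IH].
Qed.

Lemma jones_word_comm n b : B b -> b * jones_word e n = jones_word e n * b.
Proof.
move=> Bb; elim: n => [|n IH] /=; first by rewrite mulr1 mul1r.
rewrite mulrA jones_comm -?mulrA ?IH //.
by case: n {IH} => [|n] //=; apply: tower_subB.
Qed.

Lemma jones_word_mul_star n :
  jones_word e n.+1 * star (jones_word e n.+1) = tau ^+ n *: e n.+1.
Proof.
elim: n => [|n IH] /=; first by rewrite !mulr1 jones_star jones_idem expr0 scale1r.
rewrite starM jones_star -/(jones_word e n.+1) -mulrA (mulrA _ (star _)) IH.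
by rewrite -scalerAl -scalerAr mulrA jones_braid_up scalerA exprSr.
Qed.

Lemma jones_word_star_mul n :
  star (jones_word e n.+1) * jones_word e n.+1 = tau ^+ n *: e 1%N.
Proof.
elim: n => [|n IH]; first by rewrite /= !mulr1 jones_star jones_idem expr0 scale1r.
have -> : star (jones_word e n.+2) * jones_word e n.+2 =
    star (jones_word e n) * (e n.+1 * e n.+2 * e n.+1) * jones_word e n.
  by rewrite /= !starM !jones_star -!mulrA (mulrA (e n.+2) (e n.+2)) jones_idem.
rewrite jones_braid_down -scalerAr -scalerAl -(jones_idem n) exprS -scalerA -IH.
by rewrite /= starM jones_star !mulrA.
Qed.

(** Only [e_1] meets [x], compressing it to [E_0 x]; this lies in [B] and commutes with all further
    projections. *)
Lemma jones_word_conj n x : A 0%N x ->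
  jones_word e n.+1 * x * star (jones_word e n.+1) = tau ^+ n *: (E 0%N x * e n.+1).
Proof.
move=> Ax; have BE : B (E 0%N x) := ce_range (exp_cond_exp (tower_expectation 0)) Ax.
suff -> : jones_word e n.+1 * x * star (jones_word e n.+1) =
    E 0%N x * (jones_word e n.+1 * star (jones_word e n.+1)).
  by rewrite jones_word_mul_star -scalerAr.
elim: n => [|n IH]; first by rewrite /= !mulr1 jones_star jones_compress // jones_idem.
have -> : jones_word e n.+2 * x * star (jones_word e n.+2) =
    e n.+2 * (jones_word e n.+1 * x * star (jones_word e n.+1)) * e n.+2.
  by rewrite /= !starM !jones_star !mulrA.
rewrite IH mulrA -[e n.+2 * E 0%N x]jones_comm; last exact: (tower_subB n).
by rewrite /= !starM !jones_star !mulrA.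
Qed.

End JonesTower.

(** * Finite-dimensional traced algebras *)

Section TracedAlgebra.
Context {R : realType} {M : cstarAlgType R}.
Implicit Types (x y a p : M) (r t s : R) (z : R[i]).

(** Finite-dimensionality enters only through [ta_alg]: a split annihilating polynomial for each
    element, the input of [spectral_theorem]. *)
Record traced_algebra (S : set M) (tr : M -> R[i]) : Prop := {
  ta_one : S 1 ;
  ta_add : forall x y, S x -> S y -> S (x + y) ;
  ta_scale : forall (c : R[i]) x, S x -> S (c *: x) ;
  ta_mul : forall x y, S x -> S y -> S (x * y) ;
  ta_star : forall x, S x -> S (star x) ;
  taD : forall x y, S x -> S y -> tr (x + y) = tr x + tr y ;
  taZ : forall c x, S x -> tr (c *: x) = c * tr x ;
  ta1 : tr 1 = 1 ;
  taC : forall x y, S x -> S y -> tr (x * y) = tr (y * x) ;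
  taS : forall x, S x -> tr (star x) = (tr x)^* ;
  ta_ge0 : forall x, S x -> 0 <= tr (star x * x) ;
  ta_eq0 : forall x, S x -> tr (star x * x) = 0 -> x = 0 ;
  ta_alg : forall x, S x -> exists zs : seq R[i], \prod_(z <- zs) (x - z%:A) = 0
}.

Variables (S : set M) (tr : M -> R[i]).
Hypothesis hS : traced_algebra S tr.

Let Sadd x y : S x -> S y -> S (x + y). Proof. exact: (ta_add hS). Qed.
Let Sscale z x : S x -> S (z *: x). Proof. exact: (ta_scale hS). Qed.
Let Smul x y : S x -> S y -> S (x * y). Proof. exact: (ta_mul hS). Qed.
Let Sstar x : S x -> S (star x). Proof. exact: (ta_star hS). Qed.
Let S1 : S 1. Proof. exact: (ta_one hS). Qed.

Lemma ta0 : S 0.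
Proof. by rewrite -(scale0r (1 : M)); apply: Sscale. Qed.

Lemma taB x y : S x -> S y -> S (x - y).
Proof. by move=> Sx Sy; rewrite -scaleN1r; apply: Sadd => //; apply: Sscale. Qed.

Lemma ta_sum (I : Type) (l : seq I) (Q : pred I) (f : I -> M) :
  (forall i, Q i -> S (f i)) -> S (\sum_(i <- l | Q i) f i).
Proof.
move=> hf; elim/big_rec : _ => [|i x Qi Sx]; first exact: ta0.
by apply: Sadd => //; apply: hf.
Qed.

Lemma ta_tr0 : tr 0 = 0.
Proof. by rewrite -(scale0r (1 : M)) (taZ hS) ?mul0r. Qed.

Lemma ta_trB x y : S x -> S y -> tr (x - y) = tr x - tr y.
Proof.
move=> Sx Sy; rewrite -scaleN1r (taD hS) ?(taZ hS) ?mulN1r //.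
exact: Sscale.
Qed.

Lemma ta_tr_sum (I : Type) (l : seq I) (Q : pred I) (f : I -> M) : (forall i, S (f i)) ->
  tr (\sum_(i <- l | Q i) f i) = \sum_(i <- l | Q i) tr (f i).
Proof.
move=> hf; elim: l => [|i l IH]; first by rewrite !big_nil ta_tr0.
rewrite !big_cons; case: ifP => // _; rewrite (taD hS) ?IH //.
exact: ta_sum.
Qed.

Section SelfAdjoint.
Variable a : M.
Hypotheses (Sa : S a) (sa : star a = a).

Let factor (z : R[i]) := a - z%:A.

Let Sfactor z : S (factor z).
Proof. by apply: taB => //; apply: Sscale. Qed.

Let factorC z z' : factor z * factor z' = factor z' * factor z.
Proof. by rewrite /factor; nc_ring. Qed.

Let factor_prod z (zs : seq R[i]) :
  factor z * \prod_(w <- zs) factor w = (\prod_(w <- zs) factor w) * factor z.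
Proof.
elim: zs => [|w zs IH]; first by rewrite big_nil mulr1 mul1r.
by rewrite big_cons mulrA factorC -mulrA IH mulrA.
Qed.

(** A self-adjoint element has no eigenvector for a nonreal [z], so such factors cancel from the
    annihilating product. *)
Let factor_real z y : factor z * y = 0 -> z^* != z -> y = 0.
Proof.
rewrite /factor mulrBl -scalerAl mul1r => /subr0_eq ay zr.
have ya : star y * a = z^* *: star y.
  by rewrite -sa -starM ay starZ.
have e1 : z^* *: (star y * y) = z *: (star y * y).
  by rewrite scalerAl -ya -mulrA ay -scalerAr.
apply: star_mul_eq0; apply: (scalerI (a := z^* - z)); first by rewrite subr_eq0.
by rewrite scaler0 scalerBl e1 subrr.
Qed.

(** For real [z] the factor is self-adjoint and has the kernel of its square, so repeated factors
    cancel; for nonreal [z] it is injective. *)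
Let factor_sqr z y : factor z * (factor z * y) = 0 -> factor z * y = 0.
Proof.
have [zr|zr] := eqVneq z^* z; last first.
  by move=> /factor_real/(_ zr) ->.
move=> h; apply: star_mul_eq0; rewrite starM starB starZ zr star1 sa -mulrA -/(factor z).
by rewrite h mulr0.
Qed.

Let prod_real (zs : seq R[i]) y : (\prod_(z <- zs) factor z) * y = 0 ->
  (\prod_(z <- zs | z^* == z) factor z) * y = 0.
Proof.
elim: zs y => [|z zs IH] y; first by rewrite !big_nil.
rewrite !big_cons; case: eqP => [zr|/eqP zr] h.
  rewrite -big_filter factor_prod big_filter -mulrA; apply: IH.
  by rewrite mulrA -factor_prod.
by apply: IH; apply: factor_real zr; rewrite mulrA.
Qed.

Let prod_undup (zs : seq R[i]) y : (\prod_(z <- zs) factor z) * y = 0 ->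
  (\prod_(z <- undup zs) factor z) * y = 0.
Proof.
elim: zs y => [|z zs IH] y //=; rewrite big_cons; case: ifP => [zzs|_] h; last first.
  rewrite big_cons factor_prod -mulrA; apply: IH.
  by rewrite mulrA -factor_prod.
apply: IH; move: h; case/path.splitPr: zzs => l1 l2.
rewrite big_cat big_cons /= => h.
have swap v : (\prod_(w <- l1) factor w) * (factor z * \prod_(w <- l2) factor w) * v =
   factor z * ((\prod_(w <- l1) factor w) * (\prod_(w <- l2) factor w) * v).
  by rewrite !mulrA -factor_prod.
by rewrite swap; apply: factor_sqr; rewrite -swap mulrA.
Qed.

Let eigen_decomposition (zs : seq R[i]) : uniq zs -> forall y, S y ->
  (\prod_(z <- zs) factor z) * y = 0 ->
  exists2 f : R[i] -> M, forall z, z \in zs -> S (f z) /\ a * f z = z *: f z &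
    y = \sum_(z <- zs) f z.
Proof.
elim: zs => [_ y _|z zs IH /= /andP[z_zs uzs] y Sy].
  by rewrite big_nil mul1r => ->; exists (fun=> 0) => //; rewrite big_nil.
rewrite big_cons factor_prod -mulrA => /(IH uzs (factor z * y) (Smul (Sfactor z) Sy)).
(* Dividing the [w]-component of [(a - z) y] by [w - z] recovers that of [y]; what remains of [y] is
   annihilated by [a - z]. *)
move=> [f hf yE]; pose g w := (w - z)^-1 *: f w.
have Sg : S (\sum_(w <- zs) g w).
  by rewrite big_seq; apply: ta_sum => w /hf[Sf _]; apply: Sscale.
have gE w : w \in zs -> a * g w = w *: g w /\ factor z * g w = f w.
  move=> wzs; have [Sf af] := hf _ wzs; have ag : a * g w = w *: g w.
    by rewrite /g -scalerAr af !scalerA mulrC.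
  split=> //; rewrite /factor mulrBl ag -scalerAl mul1r -scalerBl scalerA mulfV ?scale1r //.
  by rewrite subr_eq0; apply: contraNneq z_zs => <-.
exists (fun w => if w == z then y - \sum_(w <- zs) g w else g w).
  move=> w; rewrite inE; case: eqP => [->|_] /= => [_|wzs].
    split; first exact: taB.
    set v := y - _; have fv : factor z * v = 0; last first.
      by apply/subr0_eq; rewrite -[RHS]fv /factor mulrBl -scalerAl mul1r.
    rewrite mulrBr yE mulr_sumr; apply/eqP; rewrite subr_eq0; apply/eqP.
    by apply: eq_big_seq => z' z'zs; case: (gE _ z'zs).
  by have [Sf _] := hf _ wzs; split; [exact: Sscale|case: (gE _ wzs)].
rewrite big_cons eqxx -[LHS](subrK (\sum_(w <- zs) g w)); congr (_ + _).
apply: eq_big_seq => w wzs; case: eqP => // wz.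
by move: z_zs; rewrite -wz wzs.
Qed.

(* Since the spectral components y_z of 1 satisfy y_w^* y_z = 0 for w <> z,
   each is y_z = 1^* y_z = y_z^* y_z, a projection. *)
Lemma spectral_theorem : exists d (r : 'I_d -> R) (p : 'I_d -> M),
  [/\ forall i, [/\ S (p i), star (p i) = p i & p i <> 0],
      forall i j, p i * p j = if i == j then p i else 0,
      \sum_i p i = 1 & a = \sum_i (r i)%:C *: p i].
Proof.
have [zs prod0] := ta_alg hS Sa.
pose zs' := undup [seq z <- zs | z^* == z].
have prod0' : (\prod_(z <- zs') factor z) * 1 = 0.
  by apply: prod_undup; rewrite big_filter; apply: prod_real; rewrite mulr1.
have [f hf sum1] := eigen_decomposition (undup_uniq _) S1 prod0'.
have real_zs z : z \in zs' -> z^* = z.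
  by rewrite mem_undup mem_filter => /andP[/eqP].
have orth z w : z \in zs' -> w \in zs' -> z != w -> star (f z) * f w = 0.
  move=> zzs wzs zw; have [_ az] := hf _ zzs; have [_ aw] := hf _ wzs.
  apply: (scalerI (a := z - w)); first by rewrite subr_eq0.
  rewrite scaler0 scalerBl (scalerAr w) -aw mulrA scalerAl.
  by rewrite -{1}(real_zs z zzs) -starZ -az starM sa subrr.
have sqr z : z \in zs' -> star (f z) * f z = f z.
  move=> zzs; rewrite -[RHS]mul1r -star1 sum1 star_sum mulr_suml.
  rewrite (bigD1_seq z) ?undup_uniq //= big_seq_cond big1 ?addr0 //.
  by move=> w /andP[wzs wz]; apply: orth.
have sf z : z \in zs' -> star (f z) = f z.
  by move=> zzs; rewrite -(sqr z zzs) starM starK.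
pose zs'' := [seq z <- zs' | f z != 0].
have mem_zs z : z \in zs'' -> z \in zs' by rewrite mem_filter => /andP[].
have uzs : uniq zs'' by rewrite filter_uniq // undup_uniq.
pose z_ (i : 'I_(size zs'')) := tnth (in_tuple zs'') i.
have z_in i : z_ i \in zs'' by exact: mem_tnth.
exists (size zs''), (fun i => complex.Re (z_ i)), (fun i => f (z_ i)); split.
- move=> i; have zi := mem_zs _ (z_in i); split; [by case: (hf _ zi)|exact: sf|].
  by apply/eqP; have := z_in i; rewrite mem_filter => /andP[].
- move=> i j; have [zi zj] := (mem_zs _ (z_in i), mem_zs _ (z_in j)).
  case: eqP => [<-|/eqP ij]; first by rewrite -{1}sf // sqr.
  rewrite -{1}sf // orth //; apply: contraNneq ij => /eqP.
  by rewrite /z_ !(tnth_nth 0) nth_uniq.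
- rewrite -(big_tnth _ _ zs'' xpredT f) big_filter [RHS]sum1 big_mkcond.
  by apply: eq_bigr => z _; case: eqP => // ->.
- transitivity (\sum_(z <- zs') z *: f z).
    rewrite -[LHS]mulr1 sum1 mulr_sumr; apply: eq_big_seq => z /hf[_ //].
  transitivity (\sum_(z <- zs'') z *: f z).
    by rewrite big_filter [RHS]big_mkcond; apply: eq_bigr => z _; case: eqP => // ->; rewrite scaler0.
  rewrite big_tnth; apply: eq_bigr => i _; congr (_ *: _).
  have := real_zs _ (mem_zs _ (z_in i)); rewrite -/(z_ i); case: (z_ i) => b c [] /eqP.
  by rewrite eq_sym -subr_eq0 opprK -mulr2n mulrn_eq0 /= => /eqP ->.
Qed.

End SelfAdjoint.
End TracedAlgebra.

(** * Functional calculus on a finite spectrum *)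

Section SpectralCalculus.
Context {R : realType} {M : cstarAlgType R}.
Variables (a : M) (d : nat) (r : 'I_d -> R) (p : 'I_d -> M).
Hypotheses (p_star : forall i, star (p i) = p i) (p_neq0 : forall i, p i <> 0).
Hypothesis p_mul : forall i j, p i * p j = if i == j then p i else 0.
Hypotheses (p_sum : \sum_i p i = 1) (aE : a = \sum_i (r i)%:C *: p i).

Lemma spectral_mul (f : 'I_d -> R[i]) j : (\sum_i f i *: p i) * p j = f j *: p j.
Proof.
rewrite mulr_suml (bigD1 j) //= -scalerAl p_mul eqxx big1 ?addr0 // => i ij.
by rewrite -scalerAl p_mul (negPf ij) scaler0.
Qed.

Lemma spectral_mulE (f g : 'I_d -> R[i]) :
  (\sum_i f i *: p i) * (\sum_i g i *: p i) = \sum_i (f i * g i) *: p i.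
Proof.
rewrite mulr_sumr; apply: eq_bigr => j _.
by rewrite -scalerAr spectral_mul scalerA mulrC.
Qed.

Lemma spectral_scalar (c : R[i]) : c%:A = \sum_i c *: p i.
Proof. by rewrite -scaler_sumr p_sum. Qed.

Lemma spectral_horner (P : {poly R[i]}) : horner_alg a P = \sum_i P.[(r i)%:C] *: p i.
Proof.
elim/poly_ind: P => [|P c IH].
  by rewrite rmorph0 big1 // => i _; rewrite horner0 scale0r.
rewrite rmorphD rmorphM /= horner_algX horner_algC IH aE spectral_mulE.
rewrite spectral_scalar -big_split; apply: eq_bigr => i _ /=.
by rewrite hornerMXaddC scalerDl.
Qed.

Lemma spectral_spectrum t : real_spectrum a t <-> exists i, r i = t.
Proof.
split.
  move=> spec; apply: contrapT => nr; apply: spec.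
  have rt i : r i - t != 0.
    by rewrite subr_eq0; apply/eqP => rit; apply: nr; exists i.
  have aE' : a - t%:C%:A = \sum_i (r i - t)%:C *: p i.
    rewrite aE spectral_scalar -sumrB; apply: eq_bigr => i _.
    by rewrite rmorphB scalerBl.
  exists (\sum_i ((r i - t)^-1)%:C *: p i); rewrite aE' !spectral_mulE -p_sum.
  by split; apply: eq_bigr => i _; rewrite -rmorphM ?mulfV ?mulVf ?rmorph1 ?scale1r.
move=> [i <-] [y [_ ya]]; apply: (p_neq0 (i := i)).
rewrite -[p i]mul1r -ya -mulrA mulrBl aE spectral_mul -scalerAl mul1r subrr.
exact: mulr0.
Qed.

Lemma interpolation_poly (f : R -> R) (l : seq R) :
  exists P : {poly R[i]}, forall t, t \in l -> P.[t%:C] = (f t)%:C.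
Proof.
elim: l => [|s l [P hP]]; first by exists 0.
have [sl|sl] := boolP (s \in l).
  by exists P => t; rewrite inE => /orP[/eqP->|]; apply: hP.
pose Q : {poly R[i]} := \prod_(z <- [seq t%:C | t <- l]) ('X - z%:P).
have rootQ t : root Q t%:C = (t \in l).
  by rewrite root_prod_XsubC mem_map //; apply: (@fmorph_inj _ _ (real_complex R)).
have Qs : Q.[s%:C] != 0 by rewrite -/(root Q _) rootQ.
exists (P + (((f s)%:C - P.[s%:C]) / Q.[s%:C]) *: Q) => t; rewrite inE.
rewrite hornerD hornerZ => /orP[/eqP->|tl].
  by rewrite divfK // addrC subrK.
have /rootP -> : root Q t%:C by rewrite rootQ.
by rewrite mulr0 addr0 hP.
Qed.

(** On a finite spectrum an interpolating polynomial agrees with [f] exactly, so [y0] qualifies.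
    Since [cfc] is a choice, uniqueness is needed too: polynomials within [eps] of [f] on the
    spectrum are within [eps] times the sum of the [cnorm (p i)] of [y0]. *)
Lemma spectral_cfc (f : R -> R) : cfc f a = \sum_i (f (r i))%:C *: p i.
Proof.
set y0 := \sum_i _.
have cfc_y0 : is_cfc f a y0.
  have [P hP] := interpolation_poly f [seq r i | i <- enum 'I_d].
  have hPr i : P.[(r i)%:C] = (f (r i))%:C.
    by apply: hP; apply: map_f; rewrite mem_enum.
  move=> eps e0; exists P; split.
    by move=> t /spectral_spectrum[i <-]; rewrite hPr subrr normr0 ltcR.
  rewrite spectral_horner /y0 -sumrB big1 ?cnorm0 // => i _.
  by rewrite hPr subrr.
rewrite /cfc; case: xgetP => [y _ cfc_y|/(_ y0)//].
apply/subr0_eq; rewrite -opprB; apply/eqP; rewrite oppr_eq0; apply/eqP.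
apply: cnorm_small_eq0 => eps e0; pose N := \sum_i cnorm (p i).
have N0 : 0 < N + 1 by rewrite ltr_wpDl // sumr_ge0 // => i _; apply: cnorm_ge0.
have [P [P1 P2]] := cfc_y _ (divr_gt0 e0 N0).
rewrite -(subrK (horner_alg a P) y0) -addrA.
apply: le_trans (cnormD _ _) _.
have le1 : cnorm (y0 - horner_alg a P) <= eps / (N + 1) * N.
  rewrite spectral_horner /y0 -sumrB mulr_sumr.
  apply: le_trans (cnorm_sum _ _ _) _; apply: ler_sum => i _.
  rewrite -scalerBl cnormZ ler_wpM2r ?cnorm_ge0 //.
  have /P1 : real_spectrum a (r i) by apply/spectral_spectrum; exists i.
  rewrite distrC; move: (_ - _) => z; rewrite normc_def ltcR /=.
  exact: ltW.
apply: le_trans (lerD le1 (ltW P2)) _.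
by rewrite -[X in _ + X]mulr1 -mulrDr divfK // gt_eqF.
Qed.

Lemma spectral_sa : star a = a.
Proof. by rewrite aE star_sum; apply: eq_bigr => i _; rewrite starZr p_star. Qed.

Lemma spectral_cnorm_ge i : `|r i| <= cnorm a.
Proof.
have n0 : 0 < cnorm (p i).
  rewrite lt_neqAle cnorm_ge0 andbT eq_sym; apply/eqP => /cnorm0_eq0; exact: p_neq0.
by rewrite -(ler_pM2r n0) -cnormZr -(spectral_mul (fun i => (r i)%:C)) -aE cnormM.
Qed.

(** [b] is the root of [T^2 - a^2]; it commutes with [a], and [a * a + b * b = T^2], so
    [cnorm_comm_sq] applies. *)
Lemma spectral_cnorm_le T : 0 <= T -> (forall i, `|r i| <= T) -> cnorm a <= T.
Proof.
move=> T0 rT; pose b := \sum_i (Num.sqrt (T ^+ 2 - r i ^+ 2))%:C *: p i.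
have sb : star b = b.
  by rewrite star_sum; apply: eq_bigr => i _; rewrite starZr p_star.
have ab : a * b = b * a.
  by rewrite aE !spectral_mulE; apply: eq_bigr => i _; rewrite mulrC.
have := cnorm_comm_sq spectral_sa sb ab.
have -> : a * a + b * b = (T ^+ 2)%:C%:A.
  rewrite aE !spectral_mulE -big_split spectral_scalar; apply: eq_bigr => i _ /=.
  rewrite -scalerDl -!rmorphM -rmorphD -!expr2 sqr_sqrtr; first by rewrite addrC subrK.
  by rewrite subr_ge0 -(real_normK (num_real (r i))) ler_pXn2r ?nnegrE.
by rewrite cnorm_scalar ger0_norm ?exprn_ge0 // ler_pXn2r ?nnegrE ?cnorm_ge0.
Qed.

End SpectralCalculus.

(** * Singular value decomposition in a traced algebra *)

Section SingularValues.
Context {R : realType} {M : cstarAlgType R}.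
Variables (S : set M) (tr : M -> R[i]).
Hypothesis hS : traced_algebra S tr.
Implicit Types (x y : M).

(** The polar decomposition cut along the spectral projections of the modulus. In the one
    constructed below, [s i = 0] forces [u i = 0], so the kernel of [x] is missing from the total
    weight in [sv_weight]. The guard in [sv_cnorm_le] lets [dual_upper_sup] divide by the weight of
    [u i]. *)
Record singular_decomposition x d (s : 'I_d -> R) (u : 'I_d -> M) : Prop := {
  sv_ge0 : forall i, 0 <= s i ;
  sv_mem : forall i, S (u i) ;
  sv_partial_isometry : forall i, u i * star (u i) * u i = u i ;
  sv_initial : forall i j, i != j -> u i * star (u j) = 0 ;
  sv_final : forall i j, i != j -> star (u i) * u j = 0 ;
  sv_sum : x = \sum_i (s i)%:C *: u i ;
  sv_abs_pow : forall q, 0 < q ->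
    abs_pow x q = \sum_i (s i `^ q)%:C *: (star (u i) * u i) ;
  sv_weight : \sum_i tr (star (u i) * u i) <= 1 ;
  sv_cnorm_ge : forall i, s i <= cnorm x ;
  sv_cnorm_le : forall T, 0 <= T -> (forall i, u i <> 0 -> s i <= T) -> cnorm x <= T
}.

Lemma ge0_real_complex (z : R[i]) : 0 <= z -> z = (complex.Re z)%:C.
Proof. by case: z => a b; rewrite lecE /= => /andP[/eqP -> _]. Qed.

Lemma ta_trace_real x : S x -> tr (star x * x) = (complex.Re (tr (star x * x)))%:C.
Proof. by move=> /(ta_ge0 hS)/ge0_real_complex. Qed.

Lemma singular_value_decomposition x : S x ->
  exists d (s : 'I_d -> R) (u : 'I_d -> M), singular_decomposition x s u.
Proof.
move=> Sx; pose b := star x * x.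
have Sb : S b by apply: (ta_mul hS) => //; apply: (ta_star hS).
have sb : star b = b by rewrite starM starK.
have [d [r [p [hp pm p1 bE]]]] := spectral_theorem hS Sb sb.
have Sp i : S (p i) by case: (hp i).
have sp i : star (p i) = p i by case: (hp i).
have p0 i : p i <> 0 by case: (hp i).
have xx i j : star (x * p i) * (x * p j) = (r j)%:C *: (if i == j then p i else 0).
  rewrite starM sp -mulrA (mulrA _ x) -/b {1}bE (spectral_mul pm).
  by rewrite -scalerAr pm.
have pp i : p i * p i = p i by rewrite pm eqxx.
have trp i : 0 < tr (p i).
  have -> : p i = star (p i) * p i by rewrite sp pp.
  rewrite lt_neqAle (ta_ge0 hS) // andbT eq_sym; apply/eqP => /(ta_eq0 hS (Sp i)).
  exact: p0.
have r0 i : 0 <= r i.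
  have := ta_ge0 hS (ta_mul hS Sx (Sp i)); rewrite xx eqxx (taZ hS) //.
  by rewrite pmulr_lge0 // ler0c.
pose s i := Num.sqrt (r i); pose u i := (s i)^-1%:C *: (x * p i).
have ss i : s i * s i = r i by rewrite -expr2 sqr_sqrtr.
have s0 i : 0 <= s i by exact: sqrtr_ge0.
have xp0 i : s i = 0 -> x * p i = 0.
  move=> si0; apply: star_mul_eq0; rewrite xx eqxx -ss si0 mulr0 rmorph0.
  exact: scale0r.
have su i : (s i)%:C *: u i = x * p i.
  rewrite /u scalerA -rmorphM; have [si0|n0] := eqVneq (s i) 0.
    by rewrite xp0 // scaler0.
  by rewrite mulfV // scale1r.
have uu i j : star (u i) * u j = if i == j then (s i != 0)%:R *: p i else 0.
  rewrite /u starZr -scalerAl -scalerAr scalerA xx scalerA -!rmorphM.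
  case: eqP => [<-|_]; last by rewrite scaler0.
  congr (_ *: _); rewrite -ss; have [->|n0] := eqVneq (s i) 0.
    by rewrite mul0r mulr0.
  by rewrite mulrACA mulVf // mulr1 -/(1 : R[i]) -(rmorph1 (real_complex R)).
have up i : u i * p i = u i by rewrite /u -scalerAl -mulrA pp.
exists d, s, u; split.
- by [].
- by move=> i; apply: (ta_scale hS); apply: (ta_mul hS).
- move=> i; rewrite -mulrA uu eqxx -scalerAr up.
  have [si0|_] := eqVneq (s i) 0; last by rewrite scale1r.
  by rewrite /u xp0 // !scaler0.
- move=> i j ij; rewrite -(up i) -(up j) starM sp mulrA -(mulrA (u i)) pm (negPf ij).
  by rewrite mulr0 mul0r.
- by move=> i j ij; rewrite uu (negPf ij).
- under eq_bigr => i _ do rewrite su.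
  by rewrite -mulr_sumr p1 mulr1.
- move=> q q0; have absE : abs_elt x = \sum_i (s i)%:C *: p i.
    by rewrite /abs_elt -/b (spectral_cfc p0 pm p1 bE).
  rewrite /abs_pow (spectral_cfc p0 pm p1 absE); apply: eq_bigr => i _.
  rewrite uu eqxx; have [->|_] := eqVneq (s i) 0; last by rewrite scale1r.
  by rewrite powR0 ?gt_eqF // rmorph0 !scale0r.
- rewrite -(ta1 hS) -p1 (ta_tr_sum hS) //; apply: ler_sum => i _.
  rewrite uu eqxx (taZ hS) //; have [_|_] := eqVneq (s i) 0.
    by rewrite mul0r ltW.
  by rewrite mul1r.
- move=> i; rewrite -(@ler_pXn2r _ 2) ?nnegrE ?cnorm_ge0 // expr2 ss -cnorm_star -/b.
  by apply: le_trans (ler_norm _) (spectral_cnorm_ge p0 pm bE i).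
- move=> T T0 hT; rewrite -(@ler_pXn2r _ 2) ?nnegrE ?cnorm_ge0 // -cnorm_star -/b.
  apply: (spectral_cnorm_le sp pm p1 bE); first exact: exprn_ge0.
  move=> i; rewrite ger0_norm // -ss -expr2.
  have [ui0|ui0] := pselect (u i = 0); last by rewrite ler_pXn2r ?nnegrE // hT.
  have : star (x * p i) * (x * p i) = 0 by rewrite -su ui0 scaler0 mulr0.
  rewrite xx eqxx => /eqP; rewrite scaler_eq0 => /orP[|/eqP/p0//].
  by rewrite expr2 ss fmorph_eq0 => /eqP ->; apply: exprn_ge0.
Qed.

End SingularValues.

(** * The trace on the relative commutants, and their finiteness *)

Section TowerTrace.
Context {R : realType} {M : cstarAlgType R}.
Variables (B : set M) (A : nat -> set M) (E : nat -> M -> M) (e : nat -> M) (idx : R).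
Hypotheses (hB : simple_algebra B) (hA : simple_algebra (A 0%N)).
Hypothesis hT : jones_tower B A E e idx.
Implicit Types (x y z a b : M) (n m : nat).

Local Notation N n := (relcommutant B (A n)).

Lemma tr_unique n x c : comp_exp E n x = c%:A -> tr E n x = c.
Proof.
move=> xc; rewrite /tr; case: xgetP => [c' _ /= h|/(_ c)/(_ xc)//].
by apply: (@scalar_inj _ M); rewrite -h -xc.
Qed.

Lemma trE n x : N n x -> comp_exp E n x = (tr E n x)%:A.
Proof.
move=> hx; have h := ce_relcomm (comp_exp_expectation hT n) hx.
have [c cE] := simple_trivial_center (jt_B hT) hB h.
by rewrite (tr_unique cE).
Qed.

Lemma trS n x : A n x -> tr E n.+1 x = tr E n x.
Proof.
move=> Ax; rewrite /tr; congr xget; apply/seteqP; split=> c /=;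
  by rewrite (ce_id (jt_cond_exp hT n)).
Qed.

Let hN n : cstar_subalgebra (A n) := jt_A hT n.

Section Level.
Variable n : nat.

Let hE : expectation (A n) B (comp_exp E n) := comp_exp_expectation hT n.

Lemma trD x y : N n x -> N n y -> tr E n (x + y) = tr E n x + tr E n y.
Proof.
move=> hx hy; apply: tr_unique; rewrite scalerDl -!trE //.
by rewrite (ceD hE) //; [exact: hx.1|exact: hy.1].
Qed.

Lemma trZ c x : N n x -> tr E n (c *: x) = c * tr E n x.
Proof.
move=> hx; apply: tr_unique; rewrite -scalerA -trE //.
by rewrite (ceZ hE) //; exact: hx.1.
Qed.

Lemma tr1 : tr E n 1 = 1.
Proof.
by apply: tr_unique; rewrite (ce_id (exp_cond_exp hE)) ?scale1r //; apply: csub_one; apply: jt_B hT.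
Qed.

Lemma trC x a : N n x -> N n a -> tr E n (x * a) = tr E n (a * x).
Proof.
move=> hx ha; rewrite /tr; congr xget; apply/seteqP.
have [l [hl lE sph]] := comp_exp_spherical hB hA hT n.
have K0 : idx ^+ n.+1 != 0 by rewrite gt_eqF // exprn_gt0 // (idx_gt0 hB hA hT).
by split=> c /=; rewrite (ce_trace hE hl K0 sph hx ha.1).
Qed.

Lemma tr_star x : N n x -> tr E n (star x) = (tr E n x)^*.
Proof.
move=> hx; apply: tr_unique; rewrite (ce_star hE) ?trE // ?starZ ?star1 //.
exact: hx.1.
Qed.

Lemma tr_ge0 x : N n x -> 0 <= tr E n (star x * x).
Proof.
move=> hx; have hxx : N n (star x * x).
  by apply: (relcommM (hN n)) => //; apply: (relcommS (hN n) (jt_B hT)).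
have := cpos_ce hE hx.1; rewrite trE // => h.
by have := h; rewrite (sa_scalar h.1) => /cpos_scal_ge0; rewrite ler0c.
Qed.

Lemma tr_eq0 x : N n x -> tr E n (star x * x) = 0 -> x = 0.
Proof.
move=> hx; have hxx : N n (star x * x).
  by apply: (relcommM (hN n)) => //; apply: (relcommS (hN n) (jt_B hT)).
have [l [hl _ _]] := comp_exp_spherical hB hA hT n.
move=> h; apply: (ce_faithful hE hl hx.1).
by rewrite trE // h scale0r.
Qed.

(** If no nonzero polynomial annihilated [x], Gram-Schmidt applied to its powers would yield
    orthonormal families of every size in [B' :&: A_n], whereas [orthonormal_bound] limits the size
    by the composite index [idx ^+ n.+1]. *)
Lemma tower_algebraic x : N n x -> exists zs : seq R[i], \prod_(z <- zs) (x - z%:A) = 0.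
Proof.
move=> hx; have [l [hl lE sph]] := comp_exp_spherical hB hA hT n.
have K0 : idx ^+ n.+1 != 0 by rewrite gt_eqF // exprn_gt0 // (idx_gt0 hB hA hT).
pose ev P := horner_alg x P.
have Nev P : N n (ev P).
  rewrite /ev; elim/poly_ind: P => [|P c IH].
    rewrite rmorph0 -(scale0r (1 : M)).
    by apply: (relcommZ (hN n)); apply: (relcomm1 _ (hN n)).
  rewrite rmorphD rmorphM /= horner_algX horner_algC.
  apply: (relcommD (hN n)); first exact: (relcommM (hN n)).
  by apply: (relcommZ (hN n)); apply: (relcomm1 _ (hN n)).
have [[P P0 evP]|inj] := pselect (exists2 P, P != 0 & ev P = 0).
  have [zs PE] := closed_field_poly_normal P; exists zs.
  have := evP; rewrite /ev PE linearZ /= rmorph_prod => /eqP.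
  rewrite mulr_algl scaler_eq0 lead_coef_eq0 (negPf P0) /= => /eqP <-.
  by apply: eq_bigr => z _; rewrite rmorphB /= horner_algX horner_algC.
exfalso; pose ip P Q := tr E n (star (ev P) * ev Q).
have Nsev P : N n (star (ev P)) by apply: (relcommS (hN n) (jt_B hT)).
have NM y z : N n y -> N n z -> N n (y * z) by exact: (relcommM (hN n)).
have ipD P Q1 Q2 : ip P (Q1 + Q2) = ip P Q1 + ip P Q2.
  by rewrite /ip /ev rmorphD mulrDr trD //; apply: NM.
have ipZ P c Q : ip P (c *: Q) = c * ip P Q.
  by rewrite /ip /ev linearZ /= mulr_algl -scalerAr trZ //; apply: NM.
have ip0 P : ip P 0 = 0 by rewrite -(scale0r 0) ipZ mul0r.
have ip_sum P k (f : 'I_k -> {poly R[i]}) : ip P (\sum_i f i) = \sum_i ip P (f i).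
  by apply: (big_morph (ip P)); [exact: ipD|exact: ip0].
have ipC P Q : ip Q P = (ip P Q)^*.
  by rewrite /ip -tr_star ?starM ?starK //; apply: NM.
have gram k : exists p : nat -> {poly R[i]},
    (forall i, (i < k)%N -> (size (p i) <= k)%N) /\
    (forall i j, (i < k)%N -> (j < k)%N -> ip (p i) (p j) = (i == j)%:R).
  elim: k => [|k [p [szp orth]]]; first by exists (fun=> 0).
  (* The size bound on the earlier polynomials keeps ['X^k] out of their span: the residual [q] has
     coefficient 1 at degree [k], so it is nonzero and so is its value at [x]. *)
  pose q : {poly R[i]} := 'X^k - \sum_(i < k) ip (p i) 'X^k *: p i.
  have szs : (size (\sum_(i < k) ip (p i) 'X^k *: p i)%R <= k)%N.
    apply: (leq_trans (size_sum _ _ _)); apply/bigmax_leqP => i _.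
    by apply: leq_trans (size_scale_leq _ _) (szp i (ltn_ord i)).
  have szq : (size q <= k.+1)%N.
    apply: (leq_trans (size_polyD _ _)); rewrite size_polyXn size_polyN geq_max leqnn.
    exact: leqW.
  have q0 : q != 0.
    apply/eqP => /(congr1 (fun P : {poly R[i]} => P`_k)); rewrite coefB coefXn eqxx coef0.
    by rewrite [X in _ - X]nth_default // subr0 => /eqP; rewrite oner_eq0.
  have evq0 : ev q <> 0 by move=> evq; apply: inj; exists q.
  have nq0 : 0 < ip q q.
    rewrite lt_neqAle tr_ge0 // andbT eq_sym; apply/eqP => /tr_eq0.
    by move=> /(_ (Nev q)).
  have orthq i : (i < k)%N -> ip (p i) q = 0.
    move=> ik; rewrite /q ipD -scaleN1r ipZ ip_sum (bigD1 (Ordinal ik)) //= big1.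
      by rewrite ipZ orth // eqxx mulr1 addr0 mulN1r subrr.
    by move=> j ij; rewrite ipZ orth // eq_sym (negPf (ij : (j : nat) != i)) mulr0.
  pose c := (sqrtC (ip q q))^-1; have c0 : 0 <= c by rewrite invr_ge0 sqrtC_ge0 ltW.
  have cc : c * (c * ip q q) = 1.
    rewrite mulrA -expr2 exprVn sqrtCK mulVf // gt_eqF //.
  exists (fun i => if i == k then c *: q else p i); split.
    move=> i; rewrite ltnS leq_eqVlt; case: eqP => [_ _|_ /= /szp/leqW//].
    exact: leq_trans (size_scale_leq _ _) szq.
  have conj_c : c^* = c by apply: conj_Creal; apply: ger0_real.
  have step i : (i < k)%N -> ip (p i) (c *: q) = 0 by move=> ik; rewrite ipZ orthq // mulr0.
  move=> i j; rewrite 2!ltnS (leq_eqVlt i) (leq_eqVlt j).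
  case: (eqVneq i k) => [->|ik]; case: (eqVneq j k) => [->|jk] //=.
  - by rewrite ipZ (ipC q) ipZ rmorphM /= conj_c -(ipC q) cc.
  - by move=> _ jk'; rewrite ipC step // conjC0.
  - by move=> ik' _; rewrite step // (negPf ik).
  - exact: orth.
have [k] : exists k : nat, idx ^+ n.+1 < k%:R.
  exists (Num.bound (idx ^+ n.+1)); apply: archi_boundP.
  by rewrite exprn_ge0 // ltW // (idx_gt0 hB hA hT).
apply/negP; rewrite -leNgt; have [p [_ orth]] := gram k.
apply: (@orthonormal_bound _ _ _ _ _ hE l hl _ K0 sph k (fun i => ev (p i))) => //.
by move=> i j; rewrite trE -/(ip _ _) ?orth //; apply: NM.
Qed.

Lemma tower_traced : traced_algebra (N n) (tr E n).
Proof.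
split.
- exact: (relcomm1 _ (hN n)).
- exact: (relcommD (hN n)).
- exact: (relcommZ (hN n)).
- exact: (relcommM (hN n)).
- by move=> x; apply: (relcommS (hN n) (jt_B hT)).
- exact: trD.
- exact: trZ.
- exact: tr1.
- exact: trC.
- exact: tr_star.
- exact: tr_ge0.
- exact: tr_eq0.
- exact: tower_algebraic.
Qed.

End Level.

Lemma tower_traced_sub n : traced_algebra (relcommutant (A 0%N) (A n)) (tr E n).
Proof.
have sub x : relcommutant (A 0%N) (A n) x -> N n x.
  by move=> [Ax xA]; split=> // b Bb; apply: xA; apply: jt_sub hT _ Bb.
have [h1 h2 h3 h4 h5 h6 h7 h8 h9 h10 h11 h12 h13] := tower_traced n.
split.
- exact: (relcomm1 _ (hN n)).
- exact: (relcommD (hN n)).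
- exact: (relcommZ (hN n)).
- exact: (relcommM (hN n)).
- by move=> x; apply: (relcommS (hN n) (hN 0)).
- by move=> x y /sub ? /sub; apply: h6.
- by move=> c x /sub; apply: h7.
- exact: h8.
- by move=> x y /sub ? /sub; apply: h9.
- by move=> x /sub; apply: h10.
- by move=> x /sub; apply: h11.
- by move=> x /sub; apply: h12.
- by move=> x /sub; apply: h13.
Qed.

End TowerTrace.

(** * Interpolation *)

Section ComplexModulus.
Context {R : realType}.
Implicit Types (z w : R[i]).

Definition cabs z : R := complex.Re `|z|.

Lemma cabsE z : `|z| = (cabs z)%:C.
Proof. by rewrite /cabs normc_def. Qed.

Lemma cabs_ge0 z : 0 <= cabs z.
Proof. by rewrite -ler0c -cabsE. Qed.

Lemma cabs0 : cabs 0 = 0.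
Proof. by rewrite /cabs normr0. Qed.

Lemma cabs1 : cabs 1 = 1.
Proof. by rewrite /cabs normr1. Qed.

Lemma cabsM z w : cabs (z * w) = cabs z * cabs w.
Proof. by apply: (@complexI R); rewrite rmorphM -!cabsE normrM. Qed.

Lemma cabsD z w : cabs (z + w) <= cabs z + cabs w.
Proof. by rewrite -lecR rmorphD -!cabsE ler_normD. Qed.

Lemma cabs_sum (I : Type) (r : seq I) (P : pred I) (f : I -> R[i]) :
  cabs (\sum_(i <- r | P i) f i) <= \sum_(i <- r | P i) cabs (f i).
Proof.
elim/big_rec2 : _ => [|i y x _ h]; first by rewrite cabs0.
by apply: le_trans (cabsD _ _) _; rewrite lerD2l.
Qed.

Lemma cabsX z n : cabs (z ^+ n) = cabs z ^+ n.
Proof. by elim: n => [|n IH]; rewrite ?expr0 ?cabs1 // !exprS cabsM IH. Qed.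

Lemma cabs_real (t : R) : cabs t%:C = `|t|.
Proof. by apply: (@complexI R); rewrite -cabsE normc_def /= expr0n addr0 sqrtr_sqr. Qed.

Lemma cabs_conj z : cabs z^* = cabs z.
Proof. by apply: (@complexI R); rewrite -!cabsE norm_conjC. Qed.

Lemma cabs_sqr z : (cabs z ^+ 2)%:C = z * z^*.
Proof. by rewrite rmorphXn /= -cabsE normCK. Qed.

End ComplexModulus.

(** * Tensor powers and the method of types *)

Section TensorPower.
Context {R : realType}.
Implicit Types (I J : finType) (m k : nat).

Lemma cauchy_schwarz I (x y : I -> R) :
  (\sum_i x i * y i) ^+ 2 <= (\sum_i x i ^+ 2) * (\sum_i y i ^+ 2).
Proof.
set P := \sum_i _; set X := \sum_i x i ^+ 2; set Y := \sum_i y i ^+ 2.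
have Y0 : 0 <= Y by apply: sumr_ge0 => i _; apply: sqr_ge0.
have [Y_eq0|Yn0] := eqVneq Y 0.
  have y0 i : y i = 0.
    apply/eqP; rewrite -sqrf_eq0; apply/eqP.
    apply: (psumr_eq0P (P := xpredT) (F := fun i => y i ^+ 2)) => // *; exact: sqr_ge0.
  by rewrite Y_eq0 mulr0 /P big1 ?expr0n // => i _; rewrite y0 mulr0.
have Yp : 0 < Y by rewrite lt_neqAle eq_sym Yn0.
have : 0 <= \sum_i (Y * x i - P * y i) ^+ 2 by apply: sumr_ge0 => i _; apply: sqr_ge0.
have -> : \sum_i (Y * x i - P * y i) ^+ 2 = Y * (X * Y - P ^+ 2).
  transitivity (\sum_i (Y ^+ 2 * x i ^+ 2 - 2 * Y * P * (x i * y i) + P ^+ 2 * y i ^+ 2)).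
    by apply: eq_bigr => i _; ring.
  by rewrite big_split sumrB -!mulr_sumr /= -/X -/Y -/P; ring.
by rewrite pmulr_rge0 // subr_ge0.
Qed.

Lemma poly_exp_le (x y : R) k : 0 <= y ->
  (forall m, x ^+ m <= m.+1%:R ^+ k * y ^+ m) -> x <= y.
Proof.
move=> y0 h; rewrite leNgt; apply/negP => xy.
have [y_eq0|yn0] := eqVneq y 0.
  by have := h 1%N; rewrite !expr1 y_eq0 mulr0 leNgt -{1}y_eq0 xy.
have yp : 0 < y by rewrite lt_neqAle eq_sym yn0.
pose d := Num.min 1 (x / y - 1).
have d0 : 0 < d by rewrite lt_min ltr01 subr_gt0 ltr_pdivlMr // mul1r.
have d1 : d <= 1 by rewrite ge_min lexx.
have dx : 1 + d <= x / y by rewrite addrC -lerBrDr ge_min lexx orbT.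
have bernoulli l : l.+1%:R * d <= (x / y) ^+ l.
  have : 1 + l%:R * d <= (x / y) ^+ l.
    elim: l => [|l IH]; first by rewrite mul0r addr0.
    rewrite exprS; apply: (@le_trans _ _ ((1 + d) * (1 + l%:R * d))).
      by rewrite -natr1; have := mulr_ge0 (ler0n R l) (sqr_ge0 d); rewrite expr2; nra.
    by apply: ler_pM => //; rewrite addr_ge0 ?mulr_ge0 // ltW.
  by apply: le_trans; rewrite -natr1 mulrDl mul1r addrC lerD2r.
pose N := k.+1.
(* Bernoulli raised to the power [N = k + 1] beats the polynomial: at [m = l N], [((l + 1) d)^N <=
   (x / y)^m <= (m + 1)^k <= ((l + 1) N)^k], and one factor [l + 1] is left over on the left. *)
have le_l l : l.+1%:R * d ^+ N <= N%:R ^+ k.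
  have l0 : 0 < l.+1%:R ^+ k :> R by rewrite exprn_gt0.
  rewrite -(ler_pM2l l0) mulrA -exprSr -exprMn -exprMn.
  apply: (@le_trans _ _ ((x / y) ^+ (l * N))).
    rewrite exprM; apply: lerXn2r; rewrite ?nnegrE ?bernoulli //; first by rewrite mulr_ge0 // ltW.
    by apply: exprn_ge0; apply: le_trans dx; rewrite addr_ge0 // ltW.
  have := h (l * N)%N; rewrite expr_div_n ler_pdivrMr ?exprn_gt0 //.
  move/le_trans; apply; rewrite ler_pM2r ?exprn_gt0 // -natrM.
  apply: lerXn2r; rewrite ?nnegrE ?ler0n // ler_nat.
  by rewrite mulSn addnC -addn1 leq_add2l.
have := archi_boundP (ltW (divr_gt0 (exprn_gt0 k (ltr0Sn R k)) (exprn_gt0 N d0))).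
set b := Num.bound _; rewrite ltr_pdivrMr ?exprn_gt0 // => lt_b.
have := le_l b; rewrite leNgt (lt_le_trans lt_b) // ler_pM2r ?exprn_gt0 //.
by rewrite ler_nat.
Qed.

(* Tensor powers: pow_fin I m is I^m, on which pow_fun x and pow_ker b are the m-th
   powers of the vector x and of the matrix b. *)
Fixpoint pow_fin I m : finType := if m is m'.+1 then (I * pow_fin I m')%type else unit.

Fixpoint pow_fun (K : comNzRingType) I (x : I -> K) m : pow_fin I m -> K :=
  if m is m'.+1 then fun f => x f.1 * pow_fun x (m := m') f.2 else fun=> 1.

Fixpoint pow_ker (K : comNzRingType) I J (x : I -> J -> K) m : pow_fin I m -> pow_fin J m -> K :=
  if m is m'.+1 then fun f h => x f.1 h.1 * pow_ker x (m := m') f.2 h.2 else fun _ _ => 1.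

Section Powers.
Variables (I J : finType).

Lemma big_unit (K : zmodType) (F : unit -> K) : \sum_f F f = F tt.
Proof. by rewrite (big_pred1 tt) // => -[]. Qed.

Lemma big_prod_fin (K : zmodType) (I1 I2 : finType) (F : I1 * I2 -> K) :
  \sum_f F f = \sum_i \sum_g F (i, g).
Proof. by rewrite pair_bigA; apply: eq_bigr => -[]. Qed.

Lemma pow_sum (K : comNzRingType) (x : I -> K) m :
  (\sum_i x i) ^+ m = \sum_(f : pow_fin I m) pow_fun x f.
Proof.
elim: m => [|m IH]; first by rewrite big_unit.
rewrite exprS IH big_prod_fin mulr_suml; apply: eq_bigr => i _.
by rewrite mulr_sumr.
Qed.

Lemma pow_bilinear (K : comNzRingType) (x : I -> K) (y : J -> K) (b : I -> J -> K) m :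
  (\sum_i \sum_j x i * y j * b i j) ^+ m =
  \sum_(f : pow_fin I m) \sum_(h : pow_fin J m) pow_fun x f * pow_fun y h * pow_ker b f h.
Proof.
elim: m => [|m IH]; first by rewrite !big_unit /= !mulr1.
rewrite exprS IH big_prod_fin mulr_suml; apply: eq_bigr => i _.
rewrite mulr_sumr; apply: eq_bigr => f _.
rewrite big_prod_fin mulr_suml; apply: eq_bigr => j _.
by rewrite mulr_sumr; apply: eq_bigr => h _ /=; ring.
Qed.

Lemma pow_fun_mul (K : comNzRingType) (x y : I -> K) m (f : pow_fin I m) :
  pow_fun (fun i => x i * y i) f = pow_fun x f * pow_fun y f.
Proof. by elim: m f => [|m IH] f /=; rewrite ?mulr1 // IH mulrACA. Qed.

Lemma pow_fun_ge0 (x : I -> R) m (f : pow_fin I m) :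
  (forall i, 0 <= x i) -> 0 <= pow_fun x f.
Proof. by move=> x0; elim: m f => [|m IH] f //=; rewrite mulr_ge0. Qed.

Lemma pow_fun_powR (x : I -> R) q m (f : pow_fin I m) : (forall i, 0 <= x i) ->
  pow_fun x f `^ q = pow_fun (fun i => x i `^ q) f.
Proof.
move=> x0; elim: m f => [|m IH] f /=; first by rewrite powR1.
by rewrite powRM ?IH // pow_fun_ge0.
Qed.

Lemma pow_fun_sqr (x : I -> R) m (f : pow_fin I m) :
  pow_fun x f ^+ 2 = pow_fun (fun i => x i ^+ 2) f.
Proof. by elim: m f => [|m IH] f /=; rewrite ?expr1n // exprMn IH. Qed.

Lemma pow_fun_complex (x : I -> R) m (f : pow_fin I m) :
  pow_fun (fun i => (x i)%:C) f = (pow_fun x f)%:C.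
Proof. by elim: m f => [|m IH] f //=; rewrite IH rmorphM. Qed.

Fixpoint pow_count m : pow_fin I m -> I -> nat :=
  if m is m'.+1 then fun f i => ((f.1 == i) + pow_count (m := m') f.2 i)%N else fun _ _ => 0%N.

Lemma pow_count_le m (f : pow_fin I m) i : (pow_count f i <= m)%N.
Proof. by elim: m f => [|m IH] f //=; rewrite -add1n leq_add // leq_b1. Qed.

Lemma pow_fun_count (K : comNzRingType) (x : I -> K) m (f : pow_fin I m) :
  pow_fun x f = \prod_i x i ^+ pow_count f i.
Proof.
elim: m f => [|m IH] f /=; first by rewrite big1.
rewrite IH; under [RHS]eq_bigr => i _ do rewrite exprD.
rewrite big_split /=; congr (_ * _).
rewrite (bigD1 f.1) //= eqxx expr1 big1 ?mulr1 // => i /negPf.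
by rewrite eq_sym => ->; rewrite expr0.
Qed.

(** [inord] loses nothing, by [pow_count_le]; the codomain ['I_m.+1] fixes the number of types at
    [m.+1 ^ #|I|], polynomial in [m]. *)
Definition pow_type m (f : pow_fin I m) : {ffun I -> 'I_m.+1} :=
  [ffun i => inord (pow_count f i)].

Lemma pow_fun_type (K : comNzRingType) (x : I -> K) m (f : pow_fin I m) :
  pow_fun x f = \prod_i x i ^+ pow_type f i.
Proof.
rewrite pow_fun_count; apply: eq_bigr => i _; rewrite ffunE inordK //.
by rewrite ltnS pow_count_le.
Qed.

(** One coordinate at a time: [g] acts on the first coordinate with the others fixed, then the
    induction hypothesis acts with the first one fixed. *)
Lemma pow_contraction (g : I -> J -> R[i]) :
  (forall y : J -> R[i],
     \sum_i cabs (\sum_j g i j * y j) ^+ 2 <= \sum_j cabs (y j) ^+ 2) ->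
  forall m (y : pow_fin J m -> R[i]),
    \sum_f cabs (\sum_h pow_ker g f h * y h) ^+ 2 <= \sum_h cabs (y h) ^+ 2.
Proof.
move=> hg; elim=> [|m IH] y; first by rewrite !big_unit mul1r.
pose y1 j f := \sum_h pow_ker (m := m) g f h * y (j, h).
have -> : \sum_f cabs (\sum_h pow_ker (m := m.+1) g f h * y h) ^+ 2 =
    \sum_f \sum_i cabs (\sum_j g i j * y1 j f) ^+ 2.
  rewrite big_prod_fin exchange_big; apply: eq_bigr => f _; apply: eq_bigr => i _.
  congr (cabs _ ^+ 2); rewrite big_prod_fin; apply: eq_bigr => j _.
  by rewrite mulr_sumr; apply: eq_bigr => h _ /=; rewrite mulrA.
apply: (@le_trans _ _ (\sum_f \sum_j cabs (y1 j f) ^+ 2)).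
  by apply: ler_sum => f _; apply: hg.
rewrite exchange_big big_prod_fin; apply: ler_sum => j _.
exact: IH.
Qed.

End Powers.

Lemma powR_exp (x r : R) m : 0 <= x -> (x `^ r) ^+ m = (x ^+ m) `^ r.
Proof.
move=> x0; elim: m => [|m IH]; first by rewrite !expr0 powR1.
by rewrite !exprS IH powRM // exprn_ge0.
Qed.

(** After raising to the power [q], the left side is the contribution of the class [S] to the
    expansion of the [m]-th power of the sum of the [a i * x i ^ q], all of whose terms are
    nonnegative. *)
Lemma pow_type_bound (I : finType) (a : I -> R) q m (x : I -> R) (S : {ffun I -> 'I_m.+1}) :
  0 < q -> (forall i, 0 <= a i) -> (forall i, 0 <= x i) ->
  (\prod_i x i ^+ S i) * (\sum_(f | pow_type f == S) pow_fun a f) `^ q^-1 <= ((\sum_i a i * x i `^ q) `^ q^-1) ^+ m.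
Proof.
move=> q0 a0 x0; have p0 : 0 <= \prod_i x i ^+ S i by apply: prodr_ge0 => i _; apply: exprn_ge0.
have sum0 : 0 <= \sum_i a i * x i `^ q by apply: sumr_ge0 => i _; rewrite mulr_ge0 ?powR_ge0.
rewrite powR_exp // pow_sum.
have -> : \prod_i x i ^+ S i = ((\prod_i x i ^+ S i) `^ q) `^ q^-1.
  by rewrite -powRrM mulfV ?gt_eqF // powRr1.
rewrite -powRM ?powR_ge0 //; last by apply: sumr_ge0 => f _; exact: pow_fun_ge0.
apply: ge0_ler_powR.
- by rewrite invr_ge0 ltW.
- rewrite nnegrE mulr_ge0 ?powR_ge0 //; apply: sumr_ge0 => f _; exact: pow_fun_ge0.
- by rewrite nnegrE; apply: sumr_ge0 => f _; apply: pow_fun_ge0 => i; rewrite mulr_ge0 ?powR_ge0.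
rewrite mulr_sumr big_mkcond; apply: ler_sum => f _; case: eqP => [<-|_].
  by rewrite pow_fun_mul -pow_fun_powR // (pow_fun_type x) mulrC.
by apply: pow_fun_ge0 => i; rewrite mulr_ge0 ?powR_ge0.
Qed.

(** * Interpolating a matrix between two bounds *)

Section Interpolation.
Variables (I J : finType) (a : I -> R) (b : J -> R) (bet : I -> J -> R[i]) (C q : R).
Hypotheses (a0 : forall i, 0 <= a i) (b0 : forall j, 0 <= b j) (C0 : 0 <= C).
Hypotheses (q1 : 1 <= q) (q2 : q <= 2).
Hypothesis bound1 : forall i j, cabs (bet i j) <= C * (a i * b j).
Hypothesis bound2 : forall (x : I -> R[i]) (y : J -> R[i]),
  cabs (\sum_i \sum_j x i * y j * bet i j) ^+ 2 <=
  (\sum_i a i * cabs (x i) ^+ 2) * (\sum_j b j * cabs (y j) ^+ 2).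

Let q0 : 0 < q. Proof. exact: lt_le_trans q1. Qed.
Let sa i := Num.sqrt (a i).
Let sb j := Num.sqrt (b j).
(** The kernel with respect to normalised vectors. Where a weight is 0, [bound1] makes [bet] vanish
    as well, so the default value of the inverse of 0 does no harm. *)
Let gam i j : R[i] := bet i j * ((sa i)^-1 * (sb j)^-1)%:C.

Let saE i : sa i * sa i = a i. Proof. by rewrite -expr2 sqr_sqrtr. Qed.
Let sbE j : sb j * sb j = b j. Proof. by rewrite -expr2 sqr_sqrtr. Qed.

Let betE i j : bet i j = (sa i * sb j)%:C * gam i j.
Proof.
rewrite /gam mulrCA -rmorphM mulrACA.
have [ab0|ab0] := eqVneq (a i * b j) 0.
  suff -> : bet i j = 0 by rewrite mul0r.
  apply/normr0_eq0; rewrite cabsE; congr (_%:C); apply/le_anti.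
  by rewrite cabs_ge0 andbT; apply: le_trans (bound1 _ _) _; rewrite ab0 mulr0.
move: ab0; rewrite mulf_eq0 negb_or -saE -sbE !mulf_eq0 !orbb => /andP[sa0 sb0].
by rewrite !mulfV // mulr1 rmorph1 mulr1.
Qed.

(** Duality: tested on the conjugate of the very vector [z] to be estimated, [bound2] reads
    [Z^2 <= Z * Y]. *)
Let contraction_gam (y : J -> R[i]) :
  \sum_i cabs (\sum_j gam i j * y j) ^+ 2 <= \sum_j cabs (y j) ^+ 2.
Proof.
pose z i := \sum_j gam i j * y j; set Z := \sum_i _; set Y := \sum_j _.
have Z0 : 0 <= Z by apply: sumr_ge0 => i _; apply: sqr_ge0.
have shrink (t w : R) : 0 <= t -> t * (Num.sqrt t)^-1 ^+ 2 * w ^+ 2 <= w ^+ 2.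
  move=> t0; rewrite exprVn sqr_sqrtr //; have [->|tn0] := eqVneq t 0.
    by rewrite !mul0r sqr_ge0.
  by rewrite mulfV // mul1r.
have := bound2 (fun i => (z i)^* * (sa i)^-1%:C) (fun j => y j * (sb j)^-1%:C).
have -> : \sum_i \sum_j (z i)^* * (sa i)^-1%:C * (y j * (sb j)^-1%:C) * bet i j = Z%:C.
  rewrite rmorph_sum /=; apply: eq_bigr => i _; rewrite cabs_sqr -/(z i).
  have -> : z i * (z i)^* = \sum_j (z i)^* * (gam i j * y j) by rewrite mulrC -mulr_sumr.
  by apply: eq_bigr => j _; rewrite /gam rmorphM; ring.
rewrite cabs_real ger0_norm // => le_ZY.
have : Z ^+ 2 <= Z * Y.
  apply: le_trans le_ZY _; apply: ler_pM.
  - by apply: sumr_ge0 => i _; rewrite mulr_ge0 ?sqr_ge0.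
  - by apply: sumr_ge0 => i _; rewrite mulr_ge0 ?sqr_ge0.
  - apply: ler_sum => i _; rewrite cabsM cabs_conj cabs_real exprMn.
    by rewrite real_normK ?num_real // (mulrC (_ ^+ 2)) mulrA shrink.
  - apply: ler_sum => j _; rewrite cabsM cabs_real exprMn.
    by rewrite real_normK ?num_real // (mulrC (_ ^+ 2)) mulrA shrink.
have [->|Zn0] := eqVneq Z 0; first by move=> _; apply: sumr_ge0 => j _; apply: sqr_ge0.
by rewrite expr2 ler_pM2l // lt_neqAle eq_sym Zn0.
Qed.

Section Power.
Variable m : nat.
Implicit Types (f : pow_fin I m) (h : pow_fin J m).

Let wI (S : {ffun I -> 'I_m.+1}) := \sum_(f | pow_type f == S) pow_fun a f.
Let wJ (T : {ffun J -> 'I_m.+1}) := \sum_(h | pow_type h == T) pow_fun b h.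
Let D (S : {ffun I -> 'I_m.+1}) (T : {ffun J -> 'I_m.+1}) :=
  \sum_(f | pow_type f == S) \sum_(h | pow_type h == T) pow_ker bet f h.

Let wI0 S : 0 <= wI S.
Proof. by apply: sumr_ge0 => f _; apply: pow_fun_ge0. Qed.

Let wJ0 T : 0 <= wJ T.
Proof. by apply: sumr_ge0 => h _; apply: pow_fun_ge0. Qed.

Let D_bound1 S T : cabs (D S T) <= C ^+ m * (wI S * wJ T).
Proof.
have le_ker f h : cabs (pow_ker bet f h) <= C ^+ m * (pow_fun a f * pow_fun b h).
  elim: m f h => [|m' IH] f h /=; first by rewrite cabs1 !mulr1.
  rewrite cabsM exprS; apply: le_trans (ler_pM (cabs_ge0 _) (cabs_ge0 _) (bound1 _ _) (IH _ _)) _.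
  by rewrite le_eqVlt; apply/orP; left; apply/eqP; ring.
apply: le_trans (cabs_sum _ _ _) _; rewrite /wI mulr_suml mulr_sumr.
apply: ler_sum => f _; apply: le_trans (cabs_sum _ _ _) _.
by rewrite /wJ !mulr_sumr; apply: ler_sum => h _.
Qed.

Let D_bound2 S T : cabs (D S T) ^+ 2 <= wI S * wJ T.
Proof.
have kerE f h : pow_ker bet f h =
    (pow_fun sa f * pow_fun sb h)%:C * pow_ker gam f h.
  elim: m f h => [|m' IH] f h /=; first by rewrite !mulr1.
  by rewrite IH betE !rmorphM; ring.
pose x f := if pow_type f == S then pow_fun sa f else 0.
pose y h : R := if pow_type h == T then pow_fun sb h else 0.
pose z f := \sum_h pow_ker gam f h * (y h)%:C.
have DE : D S T = \sum_f (x f)%:C * z f.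
  rewrite /D big_mkcond; apply: eq_bigr => f _; rewrite /x; case: eqP => _; last by rewrite mul0r.
  rewrite /z mulr_sumr big_mkcond; apply: eq_bigr => h _; rewrite /y.
  by case: eqP => _; [rewrite kerE rmorphM; ring|rewrite !mulr0].
have xE : \sum_f x f ^+ 2 = wI S.
  rewrite /wI [RHS]big_mkcond; apply: eq_bigr => f _; rewrite /x.
  case: eqP => _; last by rewrite expr0n.
  by rewrite pow_fun_sqr; congr (pow_fun _ f); apply/funext => i; rewrite expr2 saE.
have yE : \sum_h cabs (y h)%:C ^+ 2 = wJ T.
  rewrite /wJ [RHS]big_mkcond; apply: eq_bigr => h _; rewrite cabs_real real_normK ?num_real // /y.
  case: eqP => _; last by rewrite expr0n.
  by rewrite pow_fun_sqr; congr (pow_fun _ h); apply/funext => j; rewrite expr2 sbE.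
have x0 f : 0 <= x f by rewrite /x; case: eqP => // _; apply: pow_fun_ge0 => i; apply: sqrtr_ge0.
apply: (@le_trans _ _ ((\sum_f x f * cabs (z f)) ^+ 2)).
  rewrite ler_pXn2r ?nnegrE ?cabs_ge0 //; last by apply: sumr_ge0 => f _; rewrite mulr_ge0 ?cabs_ge0.
  rewrite DE; apply: le_trans (cabs_sum _ _ _) _; apply: ler_sum => f _.
  by rewrite cabsM cabs_real ger0_norm.
apply: le_trans (cauchy_schwarz _ _) _; rewrite xE ler_wpM2l // -yE.
exact: (pow_contraction contraction_gam (fun h => (y h)%:C)).
Qed.

Let s := 2 / q - 1.

(** The interpolation itself: write the modulus of [D S T] as its power [s] times its power [1 - s],
    estimate the first by [D_bound1] and the second by [D_bound2], and collect the weights with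
    [s + (1 - s) / 2 = q^-1]. *)
Let D_bound S T : cabs (D S T) <= (C `^ s) ^+ m * (wI S `^ q^-1 * wJ T `^ q^-1).
Proof.
have s0 : 0 <= s by rewrite subr_ge0 ler_pdivlMr // mul1r.
have s1 : 0 <= 1 - s.
  by rewrite /s opprB addrA subr_ge0 ler_pdivrMr // -mulr_natl ler_pM2l.
have [->|Dn0] := eqVneq (cabs (D S T)) 0.
  by rewrite !mulr_ge0 ?exprn_ge0 ?powR_ge0.
have -> : cabs (D S T) = cabs (D S T) `^ s * cabs (D S T) `^ (1 - s).
  rewrite -powRD; last by rewrite Dn0 implybT.
  by rewrite addrC subrK powRr1 // cabs_ge0.
have le1 : cabs (D S T) `^ s <= (C ^+ m * (wI S * wJ T)) `^ s.
  by apply: ge0_ler_powR; rewrite ?nnegrE ?cabs_ge0 ?mulr_ge0 ?exprn_ge0.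
have le2 : cabs (D S T) `^ (1 - s) <= (wI S * wJ T) `^ (2^-1 * (1 - s)).
  rewrite powRrM; apply: ge0_ler_powR; rewrite ?nnegrE ?cabs_ge0 ?powR_ge0 //.
  rewrite -(ger0_norm (cabs_ge0 _)) -sqrtr_sqr powR12_sqrt ?mulr_ge0 //.
  by apply: ler_wsqrtr; apply: D_bound2.
apply: le_trans (ler_pM (powR_ge0 _ _) (powR_ge0 _ _) le1 le2) _.
have w0 : 0 <= wI S * wJ T by rewrite mulr_ge0.
have wn0 : wI S * wJ T != 0.
  apply: contraNneq Dn0 => w_eq0; have := D_bound2 S T; rewrite w_eq0 => h.
  by rewrite -sqrf_eq0 -(eqP (_ : cabs (D S T) ^+ 2 == 0)) // eq_le h sqr_ge0.
rewrite powRM ?exprn_ge0 // -mulrA -powRD; last by rewrite wn0 implybT.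
rewrite -powR_exp // -powRM //.
have -> : s + 2^-1 * (1 - s) = q^-1 by rewrite /s; field; rewrite gt_eqF.
by [].
Qed.

Lemma power_bound (x : I -> R) (y : J -> R) :
  (forall i, 0 <= x i) -> (forall j, 0 <= y j) ->
  cabs (\sum_i \sum_j (x i)%:C * (y j)%:C * bet i j) ^+ m <=
  m.+1%:R ^+ (#|I| + #|J|) * (C `^ s *
    ((\sum_i a i * x i `^ q) `^ q^-1 * (\sum_j b j * y j `^ q) `^ q^-1)) ^+ m.
Proof.
move=> x0 y0; set X := _ `^ q^-1; set Y := _ `^ q^-1.
rewrite -cabsX.
have -> : (\sum_i \sum_j (x i)%:C * (y j)%:C * bet i j) ^+ m =
    \sum_(S : {ffun I -> 'I_m.+1}) \sum_(T : {ffun J -> 'I_m.+1})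
      (\prod_i x i ^+ S i * \prod_j y j ^+ T j)%:C * D S T.
  rewrite pow_bilinear (partition_big (@pow_type I m) xpredT) //=.
  apply: eq_bigr => S _.
  transitivity (\sum_(f | pow_type f == S) \sum_(T : {ffun J -> 'I_m.+1})
      \sum_(h | pow_type h == T)
        (\prod_i x i ^+ S i * \prod_j y j ^+ T j)%:C * pow_ker bet f h).
    apply: eq_bigr => f /eqP <-; rewrite (partition_big (@pow_type J m) xpredT) //=.
    apply: eq_bigr => T _; apply: eq_bigr => h /eqP <-.
    by rewrite !pow_fun_complex rmorphM !(pow_fun_type _ (K := R)).
  rewrite exchange_big; apply: eq_bigr => T _.
  by rewrite /D mulr_sumr; apply: eq_bigr => f _; rewrite mulr_sumr.
have Px S : 0 <= \prod_i x i ^+ S i by apply: prodr_ge0 => i _; apply: exprn_ge0.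
have Py T : 0 <= \prod_j y j ^+ T j by apply: prodr_ge0 => i _; apply: exprn_ge0.
have le_term (S : {ffun I -> 'I_m.+1}) (T : {ffun J -> 'I_m.+1}) :
    cabs ((\prod_i x i ^+ S i * \prod_j y j ^+ T j)%:C * D S T) <= (C `^ s * (X * Y)) ^+ m.
  rewrite cabsM cabs_real ger0_norm ?mulr_ge0 //.
  apply: le_trans (ler_wpM2l (mulr_ge0 (Px _) (Py _)) (D_bound S T)) _.
  rewrite mulrCA exprMn ler_wpM2l ?exprn_ge0 ?powR_ge0 // mulrACA exprMn.
  by apply: ler_pM; rewrite ?mulr_ge0 ?powR_ge0 //; apply: pow_type_bound.
apply: (@le_trans _ _ (\sum_(S : {ffun I -> 'I_m.+1}) \sum_(T : {ffun J -> 'I_m.+1})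
    (C `^ s * (X * Y)) ^+ m)).
  apply: le_trans (cabs_sum _ _ _) _; apply: ler_sum => S _.
  by apply: le_trans (cabs_sum _ _ _) _; apply: ler_sum => T _.
by rewrite !sumr_const !card_ffun !card_ord -mulrnA -[leLHS]mulr_natl -expnD natrX addnC.
Qed.

End Power.

Theorem interpolation_bound (x : I -> R) (y : J -> R) :
  (forall i, 0 <= x i) -> (forall j, 0 <= y j) ->
  cabs (\sum_i \sum_j (x i)%:C * (y j)%:C * bet i j) <= C `^ (2 / q - 1) *
    ((\sum_i a i * x i `^ q) `^ q^-1 * (\sum_j b j * y j `^ q) `^ q^-1).
Proof.
move=> x0 y0; apply: (@poly_exp_le _ _ (#|I| + #|J|)); last by move=> m; apply: power_bound.
by rewrite !mulr_ge0 ?powR_ge0.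
Qed.

End Interpolation.

End TensorPower.

(** * Dual norms *)

Section TracialNorms.
Context {R : realType} {M : cstarAlgType R}.
Implicit Types (S : set M) (t : M -> R[i]) (x y u w : M).

Definition lp t (q : R) x : R := complex.Re (t (abs_pow x q)) `^ q^-1.

Lemma orthogonal_sums d (c k : 'I_d -> R[i]) (y z : 'I_d -> M) :
  (forall i j, i != j -> y i * z j = 0) ->
  (\sum_i c i *: y i) * (\sum_i k i *: z i) = \sum_i (c i * k i) *: (y i * z i).
Proof.
move=> yz; rewrite mulr_suml; apply: eq_bigr => i _.
rewrite mulr_sumr (bigD1 i) //= big1 ?addr0 => [|j ij].
  by rewrite -scalerAl -scalerAr scalerA.
by rewrite -scalerAl -scalerAr yz ?scaler0 // eq_sym.
Qed.

Lemma partial_isometry_star u : u * star u * u = u ->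
  star u * star (star u) * star u = star u.
Proof. by move=> h; rewrite starK -[in RHS]h !starM starK mulrA. Qed.

Section OneAlgebra.
Variables (S : set M) (t : M -> R[i]).
Hypothesis hS : traced_algebra S t.

Lemma ta_weight x : S x -> t (star x * x) = (complex.Re (t (star x * x)))%:C.
Proof. exact: (ta_trace_real hS). Qed.

Lemma ta_weight_ge0 x : S x -> 0 <= complex.Re (t (star x * x)).
Proof. by move=> Sx; rewrite -ler0c -ta_weight // (ta_ge0 hS). Qed.

Lemma ta_weight_gt0 x : S x -> x <> 0 -> 0 < complex.Re (t (star x * x)).
Proof.
move=> Sx x0; rewrite lt_neqAle eq_sym ta_weight_ge0 // andbT; apply/eqP => h.
by apply: x0; apply: (ta_eq0 hS Sx); rewrite ta_weight // h.
Qed.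

Lemma ta_weight_star x : S x ->
  complex.Re (t (star (star x) * star x)) = complex.Re (t (star x * x)).
Proof. by move=> Sx; rewrite starK (taC hS) //; apply: ta_star hS _ Sx. Qed.

Lemma ta_cauchy_schwarz y w : S y -> S w ->
  cabs (t (y * w)) ^+ 2 <= complex.Re (t (star y * y)) * complex.Re (t (star w * w)).
Proof.
move=> Sy Sw; have [Ssy Ssw] := (ta_star hS Sy, ta_star hS Sw).
have SM a b : S a -> S b -> S (a * b) by exact: (ta_mul hS).
have SZ c a : S a -> S (c *: a) by exact: (ta_scale hS).
have [->|w0] := pselect (w = 0).
  by rewrite !mulr0 (ta_tr0 hS) cabs0 expr0n /= mulr0.
rewrite -(ta_weight_star Sy); set Y := complex.Re (t (star (star y) * _)).
set W := complex.Re _.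
have W0 : 0 < W by exact: ta_weight_gt0.
pose k := t (star w * star y).
have kE : t (y * w) = k^* by rewrite /k -(taS hS) ?starM ?starK //; apply: SM.
rewrite kE cabs_conj -(@ler_pM2l _ W) //.
have := ta_weight_ge0 (taB hS (SZ W%:C _ Ssy) (SZ k _ Sw)).
rewrite -ler0c -ta_weight; last by apply: (taB hS); apply: SZ.
have -> : star (W%:C *: star y - k *: w) * (W%:C *: star y - k *: w) =
    (W * W)%:C *: (star (star y) * star y) - (W%:C * k) *: (y * w)
    - (W%:C * k^*) *: (star w * star y) + (k * k^*) *: (star w * w).
  by rewrite starB starZr starZ starK; nc_ring.
have Syy : S (star (star y) * star y) by rewrite starK; apply: SM.
rewrite (taD hS) ?(ta_trB hS) ?(taZ hS);
  try by repeat first [assumption|apply: (taB hS)|apply: SZ|apply: SM].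
rewrite (ta_weight Ssy) (ta_weight Sw) kE -/k -/Y -/W.
have -> : (W * W)%:C * Y%:C - W%:C * k * k^* - W%:C * k^* * k + k * k^* * W%:C =
   (W * (Y * W - cabs k ^+ 2))%:C.
  have -> : (W * (Y * W - cabs k ^+ 2))%:C = W%:C * (Y%:C * W%:C - k * k^*) :> R[i].
    by rewrite -cabs_sqr -rmorphM -rmorphB -rmorphM.
  by rewrite rmorphM; ring.
by rewrite ler0c mulrBr subr_ge0.
Qed.

Section Decomposition.
Variables (x : M) (d : nat) (s : 'I_d -> R) (u : 'I_d -> M).
Hypothesis hx : singular_decomposition S t x s u.

Let a i := complex.Re (t (star (u i) * u i)).

Let Su i : S (u i) := sv_mem hx i.
Let Suu i j : S (star (u i) * u j).
Proof. by apply: (ta_mul hS) => //; apply: (ta_star hS). Qed.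

Let tuu i : t (u i * star (u i)) = (a i)%:C.
Proof. by rewrite (taC hS (Su i) (ta_star hS (Su i))); apply: ta_weight. Qed.

Lemma sv_weight_ge0 i : 0 <= a i.
Proof. exact: ta_weight_ge0. Qed.

Lemma sv_weight_le1 : \sum_i a i <= 1.
Proof.
have := sv_weight hx; under eq_bigr => i _ do rewrite (ta_weight (Su i)).
by rewrite -rmorph_sum /= -[X in _ <= X](rmorph1 (real_complex R)) lecR.
Qed.

Let tr_weighted (k : 'I_d -> R) (y : 'I_d -> M) :
  (forall i, S (y i)) -> (forall i, t (y i) = (a i)%:C) ->
  t (\sum_i (k i)%:C *: y i) = (\sum_i a i * k i)%:C.
Proof.
move=> Sy ty; rewrite (ta_tr_sum hS) => [|i]; last exact: (ta_scale hS).
by rewrite rmorph_sum; apply: eq_bigr => i _; rewrite (taZ hS) // ty -rmorphM mulrC.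
Qed.

Let Suus i : S (u i * star (u i)).
Proof. by apply: (ta_mul hS) => //; apply: (ta_star hS). Qed.

Lemma sv_lp q : 0 < q -> lp t q x = (\sum_i a i * s i `^ q) `^ q^-1.
Proof.
move=> q0; rewrite /lp (sv_abs_pow hx) // tr_weighted // => i.
exact: ta_weight.
Qed.

Lemma sv_weight_sum (c : 'I_d -> R[i]) :
  complex.Re (t (star (\sum_i c i *: u i) * (\sum_i c i *: u i))) =
  \sum_i a i * cabs (c i) ^+ 2.
Proof.
rewrite star_sum; under eq_bigr => i _ do rewrite starZ.
rewrite orthogonal_sums => [|i j]; last exact: (sv_final hx).
under eq_bigr => i _ do rewrite mulrC -cabs_sqr.
by rewrite tr_weighted // => i; apply: ta_weight.
Qed.

Lemma sv_weight_sum_star (c : 'I_d -> R[i]) :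
  complex.Re (t (star (\sum_i c i *: star (u i)) * (\sum_i c i *: star (u i)))) =
  \sum_i a i * cabs (c i) ^+ 2.
Proof.
rewrite star_sum; under eq_bigr => i _ do rewrite starZ starK.
rewrite orthogonal_sums => [|i j]; last exact: (sv_initial hx).
under eq_bigr => i _ do rewrite mulrC -cabs_sqr.
by rewrite tr_weighted.
Qed.

Lemma sv_pairing (c : 'I_d -> R) :
  t (x * \sum_i (c i)%:C *: star (u i)) = (\sum_i a i * (s i * c i))%:C.
Proof.
rewrite {1}(sv_sum hx) orthogonal_sums => [|i j]; last exact: (sv_initial hx).
by under eq_bigr => i _ do rewrite -rmorphM; rewrite tr_weighted.
Qed.

End Decomposition.
End OneAlgebra.

(** Young's inequality applied termwise, after normalising by the right-hand side [sg]. A total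
    weight below 1 suffices, since adding the missing mass at the value 0 changes neither side. *)
Lemma power_mean d (a s : 'I_d -> R) (p q : R) : (forall i, 0 <= a i) ->
  \sum_i a i <= 1 -> (forall i, 0 <= s i) -> 0 < q -> q <= p ->
  (\sum_i a i * s i `^ q) `^ q^-1 <= (\sum_i a i * s i `^ p) `^ p^-1.
Proof.
move=> a0 a1 s0 q0 qp; have p0 : 0 < p by apply: lt_le_trans qp.
set Z := \sum_i a i * s i `^ p.
have Z0 : 0 <= Z by apply: sumr_ge0 => i _; rewrite mulr_ge0 ?powR_ge0.
have [Zn0|Z_eq0] := ltP 0 Z; last first.
  have {Z_eq0} Z_eq0 : Z = 0 by apply/le_anti; rewrite Z0 Z_eq0.
  rewrite [X in X `^ q^-1]big1 ?powR0 ?powR_ge0 // ?invr_eq0 ?gt_eqF // => i _.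
  have := psumr_eq0P (fun i _ => mulr_ge0 (a0 i) (powR_ge0 (s i) p)) Z_eq0 (i := i) isT.
  move/eqP; rewrite mulf_eq0 => /orP[/eqP->|]; first by rewrite mul0r.
  by rewrite powR_eq0 => /andP[/eqP-> _]; rewrite powR0 ?mulr0 // gt_eqF.
pose sg := Z `^ p^-1; have sg0 : 0 < sg by apply: powR_gt0.
have sgp : sg `^ p = Z by rewrite -powRrM mulVf ?gt_eqF // powRr1.
suff le_sum : \sum_i a i * s i `^ q <= sg `^ q.
  apply: (@le_trans _ _ ((sg `^ q) `^ q^-1)).
    apply: ge0_ler_powR; rewrite ?nnegrE ?powR_ge0 //; first by rewrite invr_ge0 ltW.
    by apply: sumr_ge0 => i _; rewrite mulr_ge0 ?powR_ge0.
  by rewrite -powRrM mulfV ?gt_eqF // powRr1 // ltW.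
have young i : s i `^ q <= sg `^ q * (q / p * (s i `^ p / Z) + (1 - q / p)).
  pose v := s i / sg; have v0 : 0 <= v by rewrite divr_ge0 // ltW.
  have sE : s i = sg * v by rewrite mulrC divfK // gt_eqF.
  have vp : s i `^ p / Z = v `^ p.
    by rewrite sE powRM ?(ltW sg0) // sgp mulrAC mulfV ?mul1r // gt_eqF.
  rewrite vp {1}sE powRM ?(ltW sg0) // ler_wpM2l ?powR_ge0 //.
  have [pq|pq] := eqVneq q p.
    by rewrite pq divff ?gt_eqF // subrr addr0 mul1r.
  have r1 : 0 < 1 - q / p.
    by rewrite subr_gt0 ltr_pdivrMr // mul1r lt_neqAle pq qp.
  have := @conjugate_powR R (v `^ q) 1 (p / q) ((1 - q / p)^-1) (powR_ge0 _ _) ler01.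
  rewrite divr_gt0 // invr_gt0 r1 invrK invf_div mulr1 powR1 mul1r.
  rewrite -powRrM (mulrC q (p / q)) divfK ?gt_eqF // [v `^ p * _]mulrC.
  by apply => //; rewrite addrC subrK.
apply: (@le_trans _ _ (sg `^ q * (q / p * (Z / Z) + (1 - q / p) * \sum_i a i))).
  have -> : sg `^ q * (q / p * (Z / Z) + (1 - q / p) * \sum_i a i) =
      \sum_i a i * (sg `^ q * (q / p * (s i `^ p / Z) + (1 - q / p))).
    transitivity (\sum_i (sg `^ q * (q / p) / Z * (a i * s i `^ p) +
                          sg `^ q * (1 - q / p) * a i)).
      by rewrite big_split /= -!mulr_sumr -/Z; ring.
    by apply: eq_bigr => i _; ring.
  by apply: ler_sum => i _; apply: ler_wpM2l.
rewrite divff ?gt_eqF // mulr1 ler_piMr ?powR_ge0 //.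
have qp1 : q / p <= 1 by rewrite ler_pdivrMr // mul1r.
have : (1 - q / p) * \sum_i a i <= 1 - q / p by rewrite ler_piMr // subr_ge0.
by move=> le1; lra.
Qed.

(* G is an isometry for the 2-norms, given by the form B; C bounds B on partial
   isometries, hence interpolates between the exponents 2 and (1, +oo). *)
Section Duality.
Variables (S P : set M) (tS tP : M -> R[i]).
Hypotheses (hS : traced_algebra S tS) (hP : traced_algebra P tP).
Variables (G : M -> M) (B : M -> M -> R[i]) (C : R).
Hypothesis C0 : 0 <= C.
Hypothesis PG : forall x, S x -> P (G x).
Hypothesis BE : forall x w, S x -> P w -> tP (G x * w) = B x w.
Hypothesis BD : forall x y w, S x -> S y -> P w -> B (x + y) w = B x w + B y w.
Hypothesis BZ : forall c x w, S x -> P w -> B (c *: x) w = c * B x w.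
Hypothesis plancherel : forall x, S x -> tP (star (G x) * G x) = tS (star x * x).
Hypothesis bound : forall u r, S u -> P r ->
  u * star u * u = u -> r * star r * r = r ->
  cabs (B u r) <= C * (complex.Re (tS (star u * u)) * complex.Re (tP (star r * r))).

Let B0 w : P w -> B 0 w = 0.
Proof. by move=> Pw; rewrite -(scale0r (0 : M)) BZ ?mul0r //; apply: ta0 hS. Qed.

Let B_suml d (c : 'I_d -> R[i]) (u : 'I_d -> M) w : (forall i, S (u i)) -> P w ->
  B (\sum_i c i *: u i) w = \sum_i c i * B (u i) w.
Proof.
move=> Su Pw; have Scu i : S (c i *: u i) by apply: (ta_scale hS).
have : forall l : seq 'I_d, B (\sum_(i <- l) c i *: u i) w = \sum_(i <- l) c i * B (u i) w.
  elim=> [|i l IH]; first by rewrite !big_nil B0.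
  by rewrite !big_cons BD ?BZ ?IH //; apply: (ta_sum hS).
by apply.
Qed.

Let B_sumr d (c : 'I_d -> R[i]) (r : 'I_d -> M) x : S x -> (forall j, P (r j)) ->
  B x (\sum_j c j *: r j) = \sum_j c j * B x (r j).
Proof.
move=> Sx Pr; have Pcr j : P (c j *: r j) by apply: (ta_scale hP).
have PM y w : P y -> P w -> P (y * w) by exact: (ta_mul hP).
rewrite -BE ?mulr_sumr ?(ta_tr_sum hP) //.
- apply: eq_bigr => j _; rewrite -scalerAr (taZ hP) ?BE //.
  by apply: PM => //; apply: PG.
- by move=> j; apply: PM => //; apply: PG.
- exact: (ta_sum hP).
Qed.

Variable x : M.
Hypothesis Sx : S x.

Section Decompositions.
Variables (d d' : nat) (s : 'I_d -> R) (u : 'I_d -> M) (t : 'I_d' -> R) (r : 'I_d' -> M).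
Hypotheses (hx : singular_decomposition S tS x s u).
Hypothesis hy : singular_decomposition P tP (G x) t r.

Let a i := complex.Re (tS (star (u i) * u i)).
Let b j := complex.Re (tP (star (r j) * r j)).
Let bet i j := B (u i) (star (r j)).

Let Su i : S (u i) := sv_mem hx i.
Let Pr j : P (r j) := sv_mem hy j.
Let Psr j : P (star (r j)). Proof. by apply: (ta_star hP). Qed.
Let a0 i : 0 <= a i. Proof. exact: (sv_weight_ge0 hS hx). Qed.
Let b0 j : 0 <= b j. Proof. exact: (sv_weight_ge0 hP hy). Qed.
Let s0 i : 0 <= s i := sv_ge0 hx i.
Let t0 j : 0 <= t j := sv_ge0 hy j.

Let bound1 i j : cabs (bet i j) <= C * (a i * b j).
Proof.
rewrite /b -(ta_weight_star hP (Pr j)); apply: bound => //.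
  exact: (sv_partial_isometry hx).
by apply: partial_isometry_star; apply: (sv_partial_isometry hy).
Qed.

Let bilinearE (xi : 'I_d -> R[i]) (eta : 'I_d' -> R[i]) :
  B (\sum_i xi i *: u i) (\sum_j eta j *: star (r j)) =
  \sum_i \sum_j xi i * eta j * bet i j.
Proof.
rewrite B_suml //; last by apply: (ta_sum hP) => j _; apply: (ta_scale hP).
apply: eq_bigr => i _; rewrite B_sumr // mulr_sumr.
by apply: eq_bigr => j _; rewrite mulrA.
Qed.

Let bound2 (xi : 'I_d -> R[i]) (eta : 'I_d' -> R[i]) :
  cabs (\sum_i \sum_j xi i * eta j * bet i j) ^+ 2 <=
  (\sum_i a i * cabs (xi i) ^+ 2) * (\sum_j b j * cabs (eta j) ^+ 2).
Proof.
have SX : S (\sum_i xi i *: u i) by apply: (ta_sum hS) => i _; apply: (ta_scale hS).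
have PW : P (\sum_j eta j *: star (r j)).
  by apply: (ta_sum hP) => j _; apply: (ta_scale hP).
rewrite -bilinearE -BE //; apply: le_trans (ta_cauchy_schwarz hP (PG SX) PW) _.
by rewrite plancherel // (sv_weight_sum hS hx) (sv_weight_sum_star hP hy).
Qed.

Let pairing (c : 'I_d' -> R) :
  \sum_i \sum_j (s i)%:C * (c j)%:C * bet i j = (\sum_j b j * (t j * c j))%:C.
Proof.
rewrite -bilinearE -(sv_sum hx) -BE ?(sv_pairing hP hy) //.
by apply: (ta_sum hP) => j _; apply: (ta_scale hP).
Qed.

Let square_sum : \sum_i a i * s i ^+ 2 = \sum_j b j * t j ^+ 2.
Proof.
have := congr1 (@complex.Re R) (plancherel Sx).
rewrite {1 2}(sv_sum hy) {1 2}(sv_sum hx) (sv_weight_sum hS hx) (sv_weight_sum hP hy).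
move=> h; transitivity (\sum_i a i * cabs (s i)%:C ^+ 2).
  by apply: eq_bigr => i _; rewrite cabs_real ger0_norm.
by rewrite -h; apply: eq_bigr => j _; rewrite cabs_real ger0_norm.
Qed.

Let powR2 z : 0 <= z -> z `^ 2 = z ^+ 2 :> R.
Proof. by move=> z0; rewrite powR_mulrn. Qed.

Let lp2 : (\sum_i a i * s i `^ 2) `^ 2^-1 = (\sum_j b j * t j `^ 2) `^ 2^-1.
Proof.
congr (_ `^ _); transitivity (\sum_i a i * s i ^+ 2).
  by apply: eq_bigr => i _; rewrite powR2.
by rewrite square_sum; apply: eq_bigr => j _; rewrite powR2.
Qed.

Let lpS q : 0 < q -> lp tS q x = (\sum_i a i * s i `^ q) `^ q^-1.
Proof. exact: (sv_lp hS hx). Qed.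

Let lpP p : 0 < p -> lp tP p (G x) = (\sum_j b j * t j `^ p) `^ p^-1.
Proof. exact: (sv_lp hP hy). Qed.

Lemma dual_lower p q : 0 < q -> q <= 2 -> 2 <= p -> lp tS q x <= lp tP p (G x).
Proof.
move=> q0 q2 p2; have p0 : 0 < p by apply: lt_le_trans p2.
rewrite lpS // lpP //.
apply: (@le_trans _ _ ((\sum_i a i * s i `^ 2) `^ 2^-1)).
  by apply: power_mean => //; apply: (sv_weight_le1 hS hx).
by rewrite lp2; apply: power_mean => //; apply: (sv_weight_le1 hP hy).
Qed.

Lemma dual_lower_sup : lp tS 1 x <= cnorm (G x).
Proof.
rewrite lpS //.
apply: (@le_trans _ _ ((\sum_i a i * s i `^ 2) `^ 2^-1)).
  by apply: power_mean => //; [apply: (sv_weight_le1 hS hx)|lra].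
rewrite lp2; have n0 := cnorm_ge0 (G x).
have -> : cnorm (G x) = (cnorm (G x) `^ 2) `^ 2^-1 by rewrite -powRrM mulfV // powRr1.
apply: ge0_ler_powR; rewrite ?nnegrE ?invr_ge0 ?powR_ge0 //.
  by apply: sumr_ge0 => j _; rewrite mulr_ge0 ?powR_ge0.
apply: (@le_trans _ _ (\sum_j b j * cnorm (G x) `^ 2)).
  apply: ler_sum => j _; rewrite ler_wpM2l //.
  by apply: ge0_ler_powR; rewrite ?nnegrE // (sv_cnorm_ge hy).
by rewrite -mulr_suml ler_piMl ?powR_ge0 //; apply: (sv_weight_le1 hP hy).
Qed.

(** The test vector [t j ^ (p - 1)] is the extremal one in Hoelder's inequality: since
    [(p - 1) q = p], the pairing is [Z] and the norm of the test vector is [Z^(1/q)]; dividing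
    leaves [Z^(1/p)], the norm of [G x]. *)
Lemma dual_upper p q : 1 < q -> q <= 2 -> p^-1 + q^-1 = 1 -> 0 < p ->
  lp tP p (G x) <= C `^ (1 - 2 * p^-1) * lp tS q x.
Proof.
move=> q1 q2 pq p0; have q0 : 0 < q by apply: lt_trans q1.
rewrite lpS // lpP //.
set X := _ `^ q^-1; set Z := \sum_j _.
have Z0 : 0 <= Z by apply: sumr_ge0 => j _; rewrite mulr_ge0 ?powR_ge0.
have pn0 : p != 0 by rewrite gt_eqF.
have qn0 : q != 0 by rewrite gt_eqF.
have pE : (p - 1) * q = p.
  have : p * q * (p^-1 + q^-1) = p * q by rewrite pq mulr1.
  have -> : p * q * (p^-1 + q^-1) = q + p by field; rewrite pn0 qn0.
  by move=> h; rewrite mulrBl mul1r -h addrC addKr.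
have p1 : 0 < p - 1 by rewrite -(pmulr_lgt0 _ q0) pE.
have powE j : t j * t j `^ (p - 1) = t j `^ p.
  have [->|tj0] := eqVneq (t j) 0; first by rewrite mul0r powR0.
  by rewrite -{1}(powRr1 (t0 j)) -powRD ?tj0 ?implybT // [1 + _]addrC subrK.
have := @interpolation_bound _ _ _ a b bet C q a0 b0 C0 (ltW q1) q2 bound1 bound2 s
  (fun j => t j `^ (p - 1)) s0 (fun j => powR_ge0 _ _).
rewrite pairing -/X; under eq_bigr => j _ do rewrite powE.
under [X in _ * (_ * X `^ _)]eq_bigr => j _ do rewrite -powRrM pE.
rewrite -/Z cabs_real ger0_norm //.
have -> : 2 / q - 1 = 1 - 2 * p^-1 by have := pq; lra.
have [->|Zn0] := eqVneq Z 0.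
  by move=> _; rewrite powR0 ?invr_eq0 // mulr_ge0 ?powR_ge0.
have Zp : 0 < Z by rewrite lt_neqAle eq_sym Zn0.
move=> le; rewrite -(ler_pM2r (powR_gt0 q^-1 Zp)) -powRD; last by rewrite Zn0 implybT.
by rewrite pq powRr1 // -mulrA.
Qed.

(** Testing against a single [r j] isolates [b j * t j]. The bound on partial isometries carries the
    same factor [b j], which is positive when [r j] is nonzero and cancels. *)
Lemma dual_upper_sup : cnorm (G x) <= C * lp tS 1 x.
Proof.
have sum0 : 0 <= \sum_i a i * s i by apply: sumr_ge0 => i _; rewrite mulr_ge0.
have -> : lp tS 1 x = \sum_i a i * s i.
  rewrite lpS // invr1 powRr1.
    by apply: eq_bigr => i _; rewrite powRr1.
  by apply: sumr_ge0 => i _; rewrite mulr_ge0 ?powR_ge0.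
apply: (sv_cnorm_le hy); first by rewrite mulr_ge0.
move=> j rj0; have bj0 : 0 < b j by apply: (ta_weight_gt0 hP).
have := pairing (fun k => (k == j)%:R).
have -> : \sum_k b k * (t k * (k == j)%:R) = b j * t j.
  by rewrite (bigD1 j) //= eqxx mulr1 big1 ?addr0 // => k /negPf->; rewrite !mulr0.
move=> h; rewrite -(ler_pM2l bj0).
have -> : b j * t j = cabs (b j * t j)%:C by rewrite cabs_real ger0_norm // mulr_ge0.
have -> : b j * (C * \sum_i a i * s i) = \sum_i s i * (C * (a i * b j)).
  by rewrite !mulr_sumr; apply: eq_bigr => i _; ring.
rewrite -h; apply: le_trans (cabs_sum _ _ _) _.
apply: ler_sum => i _; apply: le_trans (cabs_sum _ _ _) _.
rewrite (bigD1 j) //= eqxx big1 ?addr0; last first.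
  by move=> k /negPf->; rewrite rmorph0 mulr0 mul0r cabs0.
rewrite rmorph1 mulr1 cabsM cabs_real ger0_norm //.
exact: ler_wpM2l (bound1 i j).
Qed.

End Decompositions.

End Duality.

End TracialNorms.

(** * The Fourier transform *)

Lemma powR_half_sqr {R : realType} (x : R) k : 0 < x ->
  (x `^ (- (k%:R / 2))) ^+ 2 * x ^+ k = 1.
Proof.
move=> x0; rewrite -(powR_mulrn _ (ltW x0)) -(powR_mulrn _ (powR_ge0 _ _)) -powRrM.
rewrite -powRD; last by rewrite (gt_eqF x0) implybT.
by have -> : - (k%:R / 2) * 2%:R + k%:R = 0 :> R; [field|rewrite powRr0].
Qed.

(** Each eigenvalue [r i] of [h] satisfies [k * r i <= r i * t (p i) <= t h], that is, [h] is at
    most [t h / k] as an operator. Positivity of [h] is asked only weakly, against projections,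
    since for an average or a conditional expectation this form follows at once from the trace. *)
Lemma trace_mean_bound {R : realType} {M : cstarAlgType R} (S S' : set M)
    (t t' : M -> R[i]) (k : R) (h y : M) :
  traced_algebra S t -> traced_algebra S' t' -> S' `<=` S ->
  (forall x, S' x -> t x = t' x) ->
  0 < k -> (forall q, S' q -> projection q -> q <> 0 -> k%:C <= t' q) ->
  S' h -> star h = h -> (forall q, S' q -> projection q -> 0 <= t (h * q)) -> S y ->
  k%:C * t (h * (star y * y)) <= t h * t (star y * y).
Proof.
move=> hS hS' sub tt' k0 kmin Sh sh hpos Sy.
have Ssy := ta_star hS Sy.
have SM a b : S a -> S b -> S (a * b) by exact: (ta_mul hS).
have [d [r [p [pP orth sum1 hE]]]] := spectral_theorem hS' Sh sh.
have S'p i : S' (p i) by case: (pP i).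
have Sp i : S (p i) by apply: sub.
have pp i : p i * p i = p i by rewrite orth eqxx.
have proj i : projection (p i) by split=> //; case: (pP i).
have hp i : h * p i = (r i)%:C *: p i.
  rewrite hE mulr_suml (bigD1 i) //= big1 ?addr0 => [|j ij].
    by rewrite -scalerAl pp.
  by rewrite -scalerAl orth (negPf ij) scaler0.
have ktp i : k%:C <= t (p i) by rewrite tt' //; apply: kmin => //; case: (pP i).
have tp0 i : 0 < t (p i) by apply: lt_le_trans (ktp i); rewrite (ltcR 0).
have r0 i : 0 <= (r i)%:C :> R[i].
  by have := hpos _ (S'p i) (proj i); rewrite hp (taZ hS) // pmulr_lge0.
have th : t h = \sum_i (r i)%:C * t (p i).
  rewrite {1}hE (ta_tr_sum hS) => [|i]; last exact: (ta_scale hS).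
  by apply: eq_bigr => i _; rewrite (taZ hS).
have kr i : k%:C * (r i)%:C <= t h.
  rewrite th (bigD1 i) //= mulrC; apply: le_trans (ler_wpM2l (r0 i) (ktp i)) _.
  by rewrite lerDl; apply: sumr_ge0 => j _; rewrite mulr_ge0 ?(ltW (tp0 j)).
pose g := star y * y; have Sg : S g by apply: SM.
have tpg i : 0 <= t (p i * g).
  have -> : t (p i * g) = t (star (y * p i) * (y * p i)).
    rewrite starM (proj i).1 -{1}pp -mulrA [LHS](taC hS) //; last exact: SM.
    by rewrite /g !mulrA.
  by apply: (ta_ge0 hS); apply: SM.
have tg : t g = \sum_i t (p i * g).
  by rewrite -{1}(mul1r g) -sum1 mulr_suml (ta_tr_sum hS) // => i; apply: SM.
have thg : t (h * g) = \sum_i (r i)%:C * t (p i * g).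
  rewrite hE mulr_suml (ta_tr_sum hS) => [|i].
    by apply: eq_bigr => i _; rewrite -scalerAl (taZ hS) //; apply: SM.
  by apply: SM => //; apply: (ta_scale hS).
rewrite -/g thg tg !mulr_sumr; apply: ler_sum => i _.
by rewrite mulrA ler_wpM2r.
Qed.

Section FourierTransform.
Context {R : realType} {M : cstarAlgType R}.
Variables (B : set M) (A : nat -> set M) (E : nat -> M -> M) (e : nat -> M) (idx : R).
Hypotheses (hB : simple_algebra B) (hA : simple_algebra (A 0%N)).
Hypothesis hT : jones_tower B A E e idx.
Implicit Types (x y z a b u w r : M) (n m k : nat).

Local Notation tau := (idx^-1%:C : R[i]).
Local Notation N k := (relcommutant B (A k)).
Local Notation Q k := (relcommutant (A 0%N) (A k)).
Local Notation v n := (jones_word e n).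

Lemma tower_ce_relcomm (C : set M) k x : C `<=` A k ->
  relcommutant C (A k.+1) x -> relcommutant C (A k) (E k.+1 x).
Proof.
move=> CA [Ax xC]; have hE := tower_expectation hT k.+1.
split=> [|c Cc]; first exact: (ce_range (exp_cond_exp hE) Ax).
have Ac := CA _ Cc.
by rewrite -(ceMl hE) // -(ceMr hE) // xC.
Qed.

Lemma relcomm_base k x : Q k x -> N k x.
Proof. by move=> [Ax xA]; split=> // b Bb; apply: xA; apply: jt_sub hT _ Bb. Qed.

Lemma relcomm_next (C : set M) k x : relcommutant C (A k) x -> relcommutant C (A k.+1) x.
Proof. by move=> [Ax xC]; split=> //; apply: (tower_sub hT (leqnSn k)). Qed.

Lemma jones_word_relcomm n : N n (v n).
Proof.
by split=> [|b Bb]; [exact: (jones_word_mem hT)|rewrite (jones_word_comm hT)].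
Qed.

Variable l : seq M.
Hypothesis hl : spherical_basis (A 0%N) B (E 0%N) l idx.

(** One formula for all levels of the tower; [trace_cond_exp_average] identifies it with the
    trace-preserving expectation. *)
Definition base_average x : M := tau *: qb_conj l x.
Local Notation theta := base_average.

Let ql : quasi_basis (A 0%N) (E 0%N) l. Proof. by case: hl. Qed.
Let hE0 := tower_expectation hT 0.
Let idxn0 : idx != 0. Proof. by rewrite gt_eqF // (idx_gt0 hB hA hT). Qed.
Let tauK : tau * idx%:C = 1.
Proof. by rewrite -rmorphM mulVf // rmorph1. Qed.

Lemma base_average_relcomm k x : N k x -> Q k (theta x).
Proof.
move=> [Ax xB]; have hk := jt_A hT k; split.
  apply: csub_scale => //; rewrite /qb_conj big_seq; apply: csub_sum => // z zl.
  have Az : A k z by apply: (tower_sub hT (leq0n k)); apply: ql.1.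
  by apply: csub_mul => //; [apply: csub_mul|apply: csub_star].
by move=> a Aa; rewrite /theta -scalerAl -scalerAr (qb_conj_comm hE0 ql xB).
Qed.

Lemma base_average_star x : star (theta x) = theta (star x).
Proof. by rewrite /theta starZr qb_conj_star. Qed.

Lemma base_averageZ (c : R[i]) x : theta (c *: x) = c *: theta x.
Proof. by rewrite /theta qb_conjZ !scalerA mulrC. Qed.

Lemma base_average_mulr x w : (forall a, A 0%N a -> w * a = a * w) ->
  theta (x * w) = theta x * w.
Proof.
move=> wA; rewrite /theta -scalerAl /qb_conj mulr_suml; congr (_ *: _).
apply: eq_big_seq => z zl; rewrite -!mulrA wA //.
by apply: csub_star; [exact: jt_A hT _|exact: ql.1].
Qed.

Lemma base_average_mull x w : (forall a, A 0%N a -> w * a = a * w) ->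
  theta (w * x) = w * theta x.
Proof.
move=> wA; rewrite /theta -scalerAr /qb_conj mulr_sumr; congr (_ *: _).
by apply: eq_big_seq => z zl; rewrite !mulrA wA //; exact: ql.1.
Qed.

Lemma base_average_jones : theta (e 1%N) = tau%:A.
Proof.
have hE1 := tower_expectation hT 1.
by rewrite /theta /qb_conj (bc_unit hE0 hE1 (jt_basic hT 0) ql).
Qed.

(** The quasi-basis lies in [A_0], so the higher expectations pass through the conjugation; at the
    bottom, sphericality of [E_0] evaluates it. *)
Lemma comp_exp_qb_conj k x : N k x ->
  comp_exp E k (qb_conj l x) = idx%:C *: comp_exp E k x.
Proof.
elim: k x => [|k IH] x hx.
  have [_ _ sph] := hl; rewrite /= sph // (ceZ hE0); last first.
    by apply: (exp_subset hE0); apply: (ce_range (exp_cond_exp hE0)) hx.1.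
  by rewrite (ce_id (exp_cond_exp hE0)) //; apply: (ce_range (exp_cond_exp hE0)) hx.1.
have hE := tower_expectation hT k.+1.
have Al z : z \in l -> A k z by move=> /ql.1; apply: (tower_sub hT (leq0n k)).
have Asl z : z \in l -> A k (star z).
  by move=> zl; apply: csub_star; [exact: jt_A hT _|exact: Al].
have sub := tower_sub hT (leqnSn k); have hk := jt_A hT k.+1.
rewrite /= -IH; last by apply: tower_ce_relcomm => //; apply: (tower_subB hT).
congr (comp_exp E k _); rewrite /qb_conj (ce_sum hE) => [|z zl].
  apply: eq_big_seq => z zl.
  by rewrite (ce_bimod (exp_cond_exp hE)) ?hx.1 //; [apply: Al|case: hx|apply: Asl].
apply: csub_mul => //; last by apply: sub; apply: Asl.
by apply: csub_mul => //; [apply: sub; apply: Al|case: hx].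
Qed.

Lemma tr_base_average k x : N k x -> tr E k (theta x) = tr E k x.
Proof.
move=> hx; have [Ax _] := base_average_relcomm hx.
have hE := comp_exp_expectation hT k.
apply: tr_unique; rewrite -(trE hB hT hx) /theta (ceZ hE) ?comp_exp_qb_conj //.
  by rewrite scalerA tauK scale1r.
have -> : qb_conj l x = idx%:C *: theta x by rewrite /theta scalerA mulrC tauK scale1r.
by apply: csub_scale => //; exact: jt_A hT _.
Qed.

(** Both maps preserve the trace and are linear over [A' :&: A_k], so the difference of their values
    at [x] is orthogonal to [A' :&: A_k], where it lies. *)
Lemma trace_cond_exp_average k F x :
  trace_cond_exp E k (N k) (Q k) F -> N k x -> F x = theta x.
Proof.
move=> [hF trF] hx; have hQ := tower_traced_sub hB hA hT k.
have hN := tower_traced hB hA hT k.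
have QF := ce_range hF hx; have Qth := base_average_relcomm hx.
have Qd : Q k (F x - theta x) by apply: (taB hQ).
apply/eqP; rewrite -subr_eq0; apply/eqP; apply: (ta_eq0 hQ) => //.
have Qsd := ta_star hQ Qd; rewrite (taC hQ) //.
set w := star _ in Qsd *.
have Nxw : N k (x * w) by apply: (ta_mul hN) => //; apply: relcomm_base.
have Fw : F x * w = F (x * w).
  rewrite -[x * w]mul1r mulrA (ce_bimod hF) ?mul1r //.
  exact: (ta_one hQ).
rewrite mulrBl (ta_trB hQ); [|exact: (ta_mul hQ)|exact: (ta_mul hQ)].
rewrite Fw trF // -base_average_mulr; last by case: Qsd.
by rewrite tr_base_average // subrr.
Qed.

(** Push-down and [jones_word_star_mul] collapse the argument of [theta] to [tau^(n+1) w e_1]; the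
    average of [e_1] supplies the last [tau]. *)
Lemma fourier_kernel_left n w : Q n.+1 w ->
  theta (E n.+1 (w * star (v n.+1)) * v n.+1) = tau ^+ n.+2 *: w.
Proof.
move=> [Aw wA]; have hk := jt_A hT n.+1.
have Av : A n.+1 (star (v n)).
  by apply: csub_star => //; apply: (tower_sub hT (leqnSn n)); apply: (jones_word_mem hT).
have -> : E n.+1 (w * star (v n.+1)) * v n.+1 = tau ^+ n.+1 *: (w * e 1%N).
  rewrite [in LHS]/= starM (jones_star hB hA hT) !mulrA (jones_push_right hT); last first.
    exact: csub_mul.
  rewrite exprS -scalerA -scalerAl; congr (_ *: _).
  rewrite scalerAr -(jones_word_star_mul hB hA hT) /= starM (jones_star hB hA hT).
  by rewrite -!mulrA (mulrA (e n.+1) (e n.+1)) (jones_idem hT).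
rewrite scalerAl base_average_mull => [|a Aa]; last by rewrite -scalerAl -scalerAr wA.
by rewrite base_average_jones -scalerAl -scalerAr mulr1 scalerA -exprSr.
Qed.

(** [jones_word_conj] turns each term of the average into [z E_0 (star z) x e_(n+1)] up to powers of
    [tau], and these sum to [x e_(n+1)]; the expectation of [e_(n+1)] supplies the last [tau]. *)
Lemma fourier_kernel_right n x : N n x ->
  E n.+1 (theta (x * v n.+1) * star (v n.+1)) = tau ^+ n.+2 *: x.
Proof.
move=> [Ax xB]; have hE := tower_expectation hT n.+1; have hk := jt_A hT n.+1.
have -> : theta (x * v n.+1) * star (v n.+1) = tau ^+ n.+1 *: (x * e n.+1).
  rewrite /theta -scalerAl exprS -scalerA; congr (_ *: _); rewrite /qb_conj mulr_suml.
  transitivity (\sum_(z <- l) tau ^+ n *: (z * E 0%N (star z * 1) * x * e n.+1)).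
    apply: eq_big_seq => z zl; have Az := ql.1 _ zl.
    have Asz : A 0%N (star z) by apply: csub_star => //; exact: jt_A hT _.
    have -> : z * (x * v n.+1) * star z * star (v n.+1) =
        z * x * (v n.+1 * star z * star (v n.+1)) by rewrite !mulrA.
    rewrite (jones_word_conj hB hA hT) // -scalerAr mulr1 !mulrA; congr (_ *: (_ * _)).
    by rewrite -!mulrA -xB //; apply: (ce_range (exp_cond_exp hE0)).
  rewrite -scaler_sumr -!mulr_suml (qb_left ql) ?mul1r //.
  by apply: csub_one; exact: jt_A hT _.
have Ae := jones_mem hT n; have Ax' := tower_sub hT (leqnSn n) Ax.
rewrite (ceZ hE); last exact: csub_mul.
by rewrite (ceMl hE) // (jones_expectation hT) -scalerAr mulr1 scalerA -exprSr.
Qed.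

Lemma tr_average_mul k x w : N k x -> Q k w -> tr E k (theta x * w) = tr E k (x * w).
Proof.
move=> hx hw; rewrite -base_average_mulr; last by case: hw.
rewrite tr_base_average //; apply: (ta_mul (tower_traced hB hA hT k)) => //.
exact: relcomm_base.
Qed.

Lemma tr_exp_mul k x w : N k.+1 x -> A k w -> tr E k (E k.+1 x * w) = tr E k.+1 (x * w).
Proof.
by move=> [Ax _] Aw; rewrite -(ceMr (tower_expectation hT k.+1)).
Qed.

(** * The endpoint bound on partial isometries *)

Section Bound.
Variables (m : nat) (kp km : R).
Hypothesis hkp : min_proj_trace E m (N m) kp.
Hypothesis hkm : min_proj_trace E m.+1 (Q m.+1) km.

Let t := tr E m.+2.
Let hS : traced_algebra (N m.+2) t := tower_traced hB hA hT m.+2.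

Lemma min_proj_trace_gt0 (D : set M) k c : (forall x, D x -> N k x) ->
  min_proj_trace E k D c -> 0 < c.
Proof.
move=> DN [[x [Dx [sx xx] x0 trx]] _]; have hk := tower_traced hB hA hT k.
rewrite -(ltcR 0) -trx lt_neqAle eq_sym -{2}xx -{2}sx (ta_ge0 hk (DN _ Dx)) andbT.
apply/eqP => tx0; apply: x0; apply: (ta_eq0 hk (DN _ Dx)).
by rewrite sx xx.
Qed.

(** Inserting the initial projection [p] of [u] and the final projection [f] of [r] makes the
    pairing the trace of [(r * u) * (p * v * f)], and Cauchy-Schwarz leaves two squares. The first
    contains [theta (u * star u)], in [A' :&: A_(m+1)], and yields [km]; the second contains
    [E_(m+1) p], in [B' :&: A_m], and yields [kp]. *)
Lemma fourier_pairing_bound u r : N m.+1 u -> Q m.+2 r ->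
  u * star u * u = u -> r * star r * r = r ->
  kp * km * cabs (t (u * v m.+2 * r)) ^+ 2 <=
  idx^-1 ^+ m.+2 *
    (complex.Re (tr E m.+1 (star u * u)) * complex.Re (t (star r * r))) ^+ 2.
Proof.
move=> hu hr uuu rrr.
have hN := tower_traced hB hA hT m.+1.
have hQ : traced_algebra (Q m.+2) t := tower_traced_sub hB hA hT m.+2.
have kp0 : 0 < kp by apply: min_proj_trace_gt0 hkp.
have km0 : 0 < km by apply: min_proj_trace_gt0 hkm => x; apply: relcomm_base.
have SM a b : N m.+2 a -> N m.+2 b -> N m.+2 (a * b) by exact: (ta_mul hS).
have tS x : A m.+1 x -> t x = tr E m.+1 x by exact: (trS hT).
have tavg x y : N m.+2 x -> Q m.+2 y -> t (theta x * y) = t (x * y).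
  exact: tr_average_mul.
have tth x : N m.+2 x -> t (theta x) = t x by exact: tr_base_average.
set a := complex.Re (tr E m.+1 _); set b := complex.Re (t _).
have taE : t (star u * u) = a%:C.
  by rewrite tS; [exact: (ta_weight hN)|case: (ta_mul hN (ta_star hN hu) hu)].
have tbE : t (star r * r) = b%:C by exact: (ta_weight hQ).
(* Opaque abbreviations: [p], [f] and [w] are not convertible to their values, so rewriting does not
   see through them. *)
have [p pE] : exists p, p = star u * u by exists (star u * u).
have [f fE] : exists f, f = r * star r by exists (r * star r).
have [w wE] : exists w, w = v m.+2 by exists (v m.+2).
have Su : N m.+2 u by apply: relcomm_next.
have Ssu := ta_star hS Su.
have Sr : N m.+2 r by apply: relcomm_base.
have Ssr := ta_star hS Sr.
have Sw : N m.+2 w by rewrite wE; apply: jones_word_relcomm.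
have Ssw := ta_star hS Sw.
have Sp : N m.+2 p by rewrite pE; apply: (SM).
have Sf : N m.+2 f by rewrite fE; apply: (SM).
have pp : p * p = p by rewrite pE mulrA -(mulrA _ u) -mulrA uuu.
have ff : f * f = f by rewrite fE mulrA rrr.
have sp : star p = p by rewrite pE starM starK.
have sf : star f = f by rewrite fE starM starK.
have tE : t (u * v m.+2 * r) = t ((r * u) * (p * w * f)).
  rewrite -wE; have -> : r * u * (p * w * f) = r * (u * w * f) by rewrite -{2}uuu pE !mulrA.
  rewrite [RHS](taC hS) //; last by apply: (SM) => //; apply: (SM).
  by rewrite -[u * w * f * r]mulrA fE rrr.
(* [star r * r] commutes with [A_0], so under the trace [u * star u] may be replaced by its average,
   whose trace is again [a]. *)
have le1 : km%:C * t (star (r * u) * (r * u)) <= a%:C * b%:C.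
  have Suu : N m.+1 (u * star u) by apply: (ta_mul hN) => //; apply: (ta_star hN).
  have Suu' : N m.+2 (u * star u) by apply: (SM).
  have -> : t (star (r * u) * (r * u)) = t (theta (u * star u) * (star r * r)).
    rewrite starM -mulrA [LHS](taC hS) //; last by do 2 apply: (SM) => //.
    rewrite tavg //; last by apply: (ta_mul hQ) => //; apply: (ta_star hQ).
    rewrite [RHS](taC hS) ?mulrA //; exact: SM.
  have th : t (theta (u * star u)) = a%:C.
    by rewrite tth // (taC hS).
  rewrite -th -tbE; have hQ1 := tower_traced_sub hB hA hT m.+1.
  apply: (trace_mean_bound hS hQ1) => //.
  - by move=> x Qx; apply: relcomm_next; apply: relcomm_base.
  - by move=> x [Ax _]; apply: tS.
  - by move=> q Qq; apply: hkm.2.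
  - exact: base_average_relcomm.
  - by rewrite base_average_star starM starK.
  move=> q Qq [sq qq]; have Qq2 : Q m.+2 q by apply: relcomm_next.
  have Sq := relcomm_base Qq2.
  rewrite tavg // -qq mulrA [X in 0 <= X](taC hS) //; last exact: SM.
  have -> : q * (u * star u * q) = star (star u * q) * (star u * q).
    by rewrite starM starK sq !mulrA.
  by apply: (ta_ge0 hS); apply: (SM).
(* Compression by [e_(m+2)] replaces [p] by [h = E_(m+1) p] inside [star w * p * w]. The other
   factor is the trace of [star w * w * f], where [star w * w = tau^(m+1) e_1], and averaging [e_1]
   adds one more [tau]. *)
have le2 : kp%:C * t (star (p * w * f) * (p * w * f)) <= a%:C * (tau ^+ m.+2 * b%:C).
  pose h := E m.+1 p; have Np : N m.+1 p by rewrite pE; apply: (ta_mul hN) => //; apply: (ta_star hN).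
  have Nh : N m h by apply: tower_ce_relcomm => //; apply: (tower_subB hT).
  have Sh : N m.+2 h by do 2 apply: relcomm_next.
  have thm x : A m x -> t x = tr E m x.
    by move=> Ax; rewrite tS ?(trS hT) //; apply: (tower_sub hT (leqnSn m)).
  have th : t h = a%:C.
    by rewrite thm; [rewrite -taE -pE tS //; case: Np|case: Nh].
  have wpw : star w * p * w = star w * h * w.
    rewrite wE [v m.+2]/= starM (jones_star hB hA hT); case: Np => Ap _.
    have hc : h * e m.+2 = e m.+2 * h by apply: (jones_comm hT); case: Nh.
    have epe : e m.+2 * p * e m.+2 = e m.+2 * h * e m.+2.
      by rewrite (jones_compress hT) // -hc -mulrA (jones_idem hT).
    have assoc y c : star y * e m.+2 * c * (e m.+2 * y) = star y * (e m.+2 * c * e m.+2) * y.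
      by rewrite !mulrA.
    by rewrite !assoc epe.
  have -> : t (star (p * w * f) * (p * w * f)) =
      t (h * (star (f * star w) * (f * star w))).
    have -> : star (p * w * f) * (p * w * f) = f * (star w * p * w * f).
      by rewrite (starM (p * w)) (starM p) sf sp !mulrA -(mulrA _ p p) pp.
    rewrite [LHS](taC hS) //; last by do 3 apply: (SM) => //.
    rewrite -mulrA ff wpw (starM f) starK sf.
    have -> : star w * h * w * f = star w * (h * w * f) by rewrite !mulrA.
    rewrite [LHS](taC hS) //; last by do 2 apply: (SM) => //.
    by rewrite !mulrA -(mulrA _ f f) ff.
  have -> : tau ^+ m.+2 * b%:C = t (star (f * star w) * (f * star w)).
    rewrite (starM f) starK sf.
    have -> : w * f * (f * star w) = w * (f * star w) by rewrite !mulrA -(mulrA _ f f) ff.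
    have -> : t (w * (f * star w)) = t (star w * w * f).
      rewrite [LHS](taC hS) //; last exact: SM.
      by rewrite -mulrA [LHS](taC hS) //; apply: SM.
    rewrite wE (jones_word_star_mul hB hA hT) -(scalerAl _ (e 1%N) f).
    have Se : N m.+2 (e 1%N).
      split; first by apply: (tower_sub hT _ (jones_mem hT 0)).
      by move=> c Bc; rewrite -(jones_comm hT (n := 0)).
    have tef : t (e 1%N * f) = tau * b%:C.
      rewrite -tavg // fE; last by apply: (ta_mul hQ) => //; apply: (ta_star hQ).
      rewrite base_average_jones mulr_algl (taZ hS) -?fE // fE (taC hS) // tbE //.
    by rewrite (taZ hS) ?tef ?mulrA -?exprSr //; apply: SM.
  rewrite -th; apply: (trace_mean_bound hS (tower_traced hB hA hT m)) => //.
  - by move=> x Nx; do 2 apply: relcomm_next.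
  - by move=> x [Ax _]; apply: thm.
  - by move=> q Nq; apply: hkp.2.
  - by rewrite /h -(ce_star (tower_expectation hT m.+1)) ?sp //; case: Np.
  - move=> q Nq [sq qq]; have Nq1 : N m.+1 q by apply: relcomm_next.
    rewrite thm; last by case: (ta_mul (tower_traced hB hA hT m) Nh Nq).
    rewrite tr_exp_mul //; last by case: Nq.
    rewrite -qq mulrA (taC hN) //; last exact: (ta_mul hN).
    have -> : q * (p * q) = star (u * q) * (u * q) by rewrite (starM u) sq pE !mulrA.
    by apply: (ta_ge0 hN); apply: (ta_mul hN).
  - exact: SM.
move: le1 le2; have Sru : N m.+2 (r * u) by apply: (SM).
have Spf : N m.+2 (p * w * f) by apply: (SM) => //; apply: (SM).
have := ta_cauchy_schwarz hS Sru Spf; rewrite -tE.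
have := ta_weight_ge0 hS Sru; have := ta_weight_ge0 hS Spf.
rewrite (ta_weight hS Sru) (ta_weight hS Spf) -!rmorphXn -!rmorphM /= !lecR.
set X := complex.Re _; set Y := complex.Re _; move=> X0 Y0 cs le1 le2.
apply: (@le_trans _ _ ((km * Y) * (kp * X))).
  have -> : km * Y * (kp * X) = kp * km * (Y * X) by ring.
  by rewrite ler_wpM2l // mulr_ge0 // ltW.
have -> : idx^-1 ^+ m.+2 * (a * b) ^+ 2 = a * b * (a * (idx^-1 ^+ m.+2 * b)) by ring.
exact: ler_pM (mulr_ge0 (ltW km0) Y0) (mulr_ge0 (ltW kp0) X0) le1 le2.
Qed.

Let kk : R := idx^-1 `^ (- (m.+3%:R / 2)).

Let kk_sqr : kk ^+ 2 * idx^-1 ^+ m.+3 = 1.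
Proof. by apply: powR_half_sqr; rewrite invr_gt0 (idx_gt0 hB hA hT). Qed.

(** The square of the normalisation is [tau^-(m+3)] against [tau^(m+2)] in the pairing bound: one
    factor [tau^-1 = idx] survives, and its root is the numerator [delta]. *)
Lemma fourier_form_bound u r : N m.+1 u -> Q m.+2 r ->
  u * star u * u = u -> r * star r * r = r ->
  cabs (kk%:C * t (u * v m.+2 * r)) <= Num.sqrt idx / Num.sqrt (kp * km) *
    (complex.Re (tr E m.+1 (star u * u)) * complex.Re (t (star r * r))).
Proof.
move=> hu hr uuu rrr; have := fourier_pairing_bound hu hr uuu rrr.
have kp0 : 0 < kp by apply: min_proj_trace_gt0 hkp.
have km0 : 0 < km by apply: min_proj_trace_gt0 hkm => x; apply: relcomm_base.
have kpm : 0 < kp * km by apply: mulr_gt0.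
have i0 := idx_gt0 hB hA hT.
have a0 := ta_weight_ge0 (tower_traced hB hA hT m.+1) hu.
have b0 := ta_weight_ge0 hS (relcomm_base hr).
have ab0 := mulr_ge0 a0 b0; move: ab0.
set ab := complex.Re _ * complex.Re _; set c := cabs (t _) => ab0 le.
rewrite cabsM cabs_real ger0_norm ?powR_ge0 // -/c.
rewrite -(@ler_pXn2r _ 2) ?nnegrE ?mulr_ge0 ?powR_ge0 ?cabs_ge0 ?divr_ge0 ?sqrtr_ge0 //.
rewrite !exprMn exprVn !sqr_sqrtr ?(ltW kpm) ?(ltW i0) // [X in _ <= X]mulrAC ler_pdivlMr //.
have -> : kk ^+ 2 * c ^+ 2 * (kp * km) = kk ^+ 2 * (kp * km * c ^+ 2) by ring.
apply: le_trans (ler_wpM2l (sqr_ge0 _) le) _.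
have -> : kk ^+ 2 * (idx^-1 ^+ m.+2 * ab ^+ 2) = kk ^+ 2 * idx^-1 ^+ m.+3 * (idx * ab ^+ 2).
  by rewrite (exprS _ m.+2); field; rewrite gt_eqF.
by rewrite kk_sqr mul1r /ab exprMn.
Qed.

End Bound.

(** * Inversion and the Plancherel identity *)

Section Duality.
Variables (n : nat) (F : M -> M).
Hypothesis hF : trace_cond_exp E n.+1 (N n.+1) (Q n.+1) F.

Local Notation kk := (idx^-1 `^ (- (n.+2%:R / 2))).
Let G := fourier e idx^-1 F n.
Let H := fourier_inv e idx^-1 E n.
Let hN : traced_algebra (N n) (tr E n) := tower_traced hB hA hT n.
Let hN1 : traced_algebra (N n.+1) (tr E n.+1) := tower_traced hB hA hT n.+1.
Let hQ : traced_algebra (Q n.+1) (tr E n.+1) := tower_traced_sub hB hA hT n.+1.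

Let kk_sqr : kk%:C * kk%:C * tau ^+ n.+2 = 1.
Proof.
rewrite -!rmorphM -rmorphXn -rmorphM -expr2 /= powR_half_sqr ?rmorph1 //.
by rewrite invr_gt0 (idx_gt0 hB hA hT).
Qed.

Let Nxv x : N n x -> N n.+1 (x * v n.+1).
Proof.
move=> hx; apply: (ta_mul hN1); first exact: relcomm_next.
exact: jones_word_relcomm.
Qed.

Let Nwv w : Q n.+1 w -> N n.+1 (w * star (v n.+1)).
Proof.
move=> hw; apply: (ta_mul hN1); first exact: relcomm_base.
by apply: (ta_star hN1); exact: jones_word_relcomm.
Qed.

Lemma fourierE x : N n x -> G x = kk%:C *: theta (x * v n.+1).
Proof. by move=> hx; rewrite /G /fourier (trace_cond_exp_average hF) //; apply: Nxv. Qed.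

Lemma fourier_relcomm x : N n x -> Q n.+1 (G x).
Proof.
move=> hx; rewrite fourierE //; apply: (ta_scale hQ).
by apply: base_average_relcomm; apply: Nxv.
Qed.

Lemma fourier_inv_relcomm w : Q n.+1 w -> N n (H w).
Proof.
move=> hw; apply: (ta_scale hN); apply: tower_ce_relcomm; first exact: (tower_subB hT).
exact: Nwv.
Qed.

Lemma fourier_invK w : Q n.+1 w -> G (H w) = w.
Proof.
move=> hw; rewrite fourierE; last exact: fourier_inv_relcomm.
rewrite /H /fourier_inv -scalerAl base_averageZ fourier_kernel_left // !scalerA.
by rewrite kk_sqr scale1r.
Qed.

Lemma fourierK x : N n x -> H (G x) = x.
Proof.
move=> hx; rewrite fourierE // /H /fourier_inv -scalerAl (ceZ (tower_expectation hT n.+1)).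
  by rewrite fourier_kernel_right // !scalerA kk_sqr scale1r.
have hk := jt_A hT n.+1; have [Aw _] := base_average_relcomm (Nxv hx).
by apply: csub_mul => //; apply: csub_star => //; apply: (jones_word_mem hT).
Qed.

Lemma tr_fourier x w : N n x -> Q n.+1 w ->
  tr E n.+1 (G x * w) = kk%:C * tr E n.+1 (x * v n.+1 * w).
Proof.
move=> hx hw; have Qth := base_average_relcomm (Nxv hx).
rewrite fourierE // -scalerAl (taZ hQ); last exact: (ta_mul hQ).
by rewrite tr_average_mul //; apply: Nxv.
Qed.

Lemma tr_fourier_inv w x : Q n.+1 w -> N n x ->
  tr E n (H w * x) = kk%:C * tr E n.+1 (w * star (v n.+1) * x).
Proof.
move=> hw hx; have Nw := Nwv hw.
rewrite /H /fourier_inv -scalerAl (taZ hN).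
  by rewrite tr_exp_mul //; case: hx.
by apply: (ta_mul hN) => //; apply: tower_ce_relcomm => //; apply: (tower_subB hT).
Qed.

(** The inverse transform is the adjoint for the trace inner products: both sides are the same trace
    involving [v_(n+1)], up to conjugation. Together with [fourierK] this is unitarity. *)
Lemma tr_fourier_adjoint x w : N n x -> Q n.+1 w ->
  tr E n.+1 (G x * star w) = (tr E n (H w * star x))^*.
Proof.
move=> hx hw; have [hsw hsx] := (ta_star hQ hw, ta_star hN hx).
rewrite tr_fourier // tr_fourier_inv // rmorphM /= conj_real -(taS hN1) -/(v n.+1).
  by rewrite (starM _ (star x)) (starM w) !starK mulrA.
by apply: (ta_mul hN1); [exact: Nwv|exact: relcomm_next].
Qed.

Lemma fourier_plancherel x : N n x ->
  tr E n.+1 (star (G x) * G x) = tr E n (star x * x).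
Proof.
move=> hx; have QG := fourier_relcomm hx; have sx := ta_star hN hx.
rewrite (taC hQ) //; last exact: (ta_star hQ).
rewrite tr_fourier_adjoint // fourierK // -(taS hN) ?starM ?starK.
  by rewrite (taC hN).
exact: (ta_mul hN).
Qed.

Lemma fourier_inv_plancherel w : Q n.+1 w ->
  tr E n (star (H w) * H w) = tr E n.+1 (star w * w).
Proof.
by move=> hw; rewrite -fourier_plancherel ?fourier_invK //; apply: fourier_inv_relcomm.
Qed.

End Duality.

End FourierTransform.

(** The endpoint [p = +oo] is split off because [lpnorm] is the operator norm there, with no trace
    formula. *)
Lemma conjugate_exponents {R : realType} (p q : \bar R) :
  (2%:E <= p)%E -> (p^-1 + q^-1 = 1)%E ->
  (p = +oo%E /\ q = 1%:E) \/
  exists r s, [/\ p = r%:E, q = s%:E, 2 <= r, 1 < s <= 2 & r^-1 + s^-1 = 1].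
Proof.
case: p => [r||] // hp hpq; last first.
  left; split=> //; move: hpq; rewrite invey add0e => h.
  by rewrite -(inveK q) h inve1.
right; have r2 : 2 <= r by rewrite -lee_fin.
have r0 : 0 < r by apply: lt_le_trans r2.
have rV : r^-1 <= 2^-1 by rewrite lef_pV2 ?posrE.
move: hpq; rewrite inver (gt_eqF r0).
case: q => [s||]; rewrite ?invey ?inveNy ?inver //; last by rewrite adde0 => -[]; lra.
case: eqVneq => [//|s0] [rs].
have rV0 : 0 < r^-1 by rewrite invr_gt0.
have sV : s^-1 = 1 - r^-1 by lra.
have s_gt0 : 0 < s by rewrite -invr_gt0 sV; lra.
exists r, s; split=> //; apply/andP; split.
  by rewrite -ltf_pV2 ?posrE // invr1 sV; lra.
by rewrite -lef_pV2 ?posrE // sV; lra.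
Qed.

Lemma dual_lpnorm {R : realType} {M : cstarAlgType R} (E : nat -> M -> M) (j k : nat)
    (S P : set M) (G : M -> M) (B : M -> M -> R[i]) (C : R) (p q : \bar R) (x : M) :
  traced_algebra S (tr E j) -> traced_algebra P (tr E k) -> 0 <= C ->
  (forall x, S x -> P (G x)) ->
  (forall x w, S x -> P w -> tr E k (G x * w) = B x w) ->
  (forall x y w, S x -> S y -> P w -> B (x + y) w = B x w + B y w) ->
  (forall c x w, S x -> P w -> B (c *: x) w = c * B x w) ->
  (forall x, S x -> tr E k (star (G x) * G x) = tr E j (star x * x)) ->
  (forall u r, S u -> P r -> u * star u * u = u -> r * star r * r = r ->
   cabs (B u r) <=
     C * (complex.Re (tr E j (star u * u)) * complex.Re (tr E k (star r * r)))) ->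
  S x -> (2%:E <= p)%E -> (p^-1 + q^-1 = 1)%E ->
  lpnorm E j q x <= lpnorm E k p (G x) /\
  lpnorm E k p (G x) <= C `^ (1 - 2 * fine (p^-1)%E) * lpnorm E j q x.
Proof.
move=> hS hP C0 PG BE BD BZ planch bnd Sx hp hpq.
have [d [s [u hx]]] := singular_value_decomposition hS Sx.
have [d' [t [v hy]]] := singular_value_decomposition hP (PG _ Sx).
have [[-> ->]|[r [r' [-> -> r2 /andP[r1 r12] rr]]]] := conjugate_exponents hp hpq.
  split; first exact: (dual_lower_sup hS hP planch Sx hx hy).
  rewrite invey mulr0 subr0 powRr1 //.
  exact: (dual_upper_sup hS hP C0 PG BE BD BZ bnd Sx hx hy).
have r0 : 0 < r by apply: lt_le_trans r2.
rewrite inver (gt_eqF r0) /=; split.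
  by apply: (dual_lower hS hP planch Sx hx hy) => //; apply: lt_trans r1.
exact: (dual_upper hS hP C0 PG BE BD BZ planch bnd Sx hx hy).
Qed.

Theorem theorem4p7 (R : realType) (M : cstarAlgType R)
  (B : set M) (A : nat -> set M) (E : nat -> M -> M) (e : nat -> M) (idx : R)
  (hB : simple_algebra B) (hA : simple_algebra (A 0%N))
  (hT : jones_tower B A E e idx)
  (n : nat) (hn : (1 <= n)%N)
  (F : M -> M)
  (hF : trace_cond_exp E n.+1 (relcommutant B (A n.+1))
          (relcommutant (A 0%N) (A n.+1)) F)
  (kp km : R)
  (hkp : min_proj_trace E n.-1 (relcommutant B (A n.-1)) kp)
  (hkm : min_proj_trace E n (relcommutant (A 0%N) (A n)) km)
  (p q : \bar R) (hp : (2%:E <= p)%E) (hpq : (p^-1 + q^-1 = 1)%E) :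
  let tau := idx^-1 in
  let delta := Num.sqrt idx in
  let kappa := Num.sqrt (kp * km) in
  let K := (delta / kappa) `^ (1 - 2 * fine (p^-1)%E) in
  (forall x : M, relcommutant B (A n) x ->
     lpnorm E n q x <= lpnorm E n.+1 p (fourier e tau F n x) /\
     lpnorm E n.+1 p (fourier e tau F n x) <= K * lpnorm E n q x) /\
  (forall w : M, relcommutant (A 0%N) (A n.+1) w ->
     lpnorm E n.+1 q w <= lpnorm E n p (fourier_inv e tau E n w) /\
     lpnorm E n p (fourier_inv e tau E n w) <= K * lpnorm E n.+1 q w).
Proof.
case: n hn F hF hkp hkm => [//|m] _ F hF hkp hkm tau delta kappa K.
have [l hl] := tower_base_spherical hB hA hT.
have hN := tower_traced hB hA hT m.+1; have hN2 := tower_traced hB hA hT m.+2.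
have hQ := tower_traced_sub hB hA hT m.+2.
have C0 : 0 <= delta / kappa by rewrite divr_ge0 ?sqrtr_ge0.
pose v := jones_word e m.+2; pose c := (tau `^ (- (m.+3%:R / 2)))%:C : R[i].
have Nv := jones_word_relcomm hT m.+2 : relcommutant B (A m.+2) v.
have NM a b : relcommutant B (A m.+2) a -> relcommutant B (A m.+2) b ->
  relcommutant B (A m.+2) (a * b) by exact: (ta_mul hN2).
have Nsv := ta_star hN2 Nv.
have N12 a : relcommutant B (A m.+1) a -> relcommutant B (A m.+2) a.
  exact: (relcomm_next hT).
have QN a : relcommutant (A 0%N) (A m.+2) a -> relcommutant B (A m.+2) a.
  exact: (relcomm_base hT).
split=> [x hx|w hw].
  apply: (@dual_lpnorm _ _ _ _ _ _ _ _ (fun x w => c * tr E m.+2 (x * v * w))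
           _ _ _ _ hN hQ) => //.
  - exact: (fourier_relcomm hB hA hT hl hF).
  - exact: (tr_fourier hB hA hT hl hF).
  - move=> a b d Na Nb Qd; rewrite !mulrDl (taD hN2) 1?mulrDr //;
    by apply: (NM) => //; [apply: (NM) => //; apply: N12|apply: QN].
  - move=> k a d Na Qd; rewrite -!scalerAl (taZ hN2) 1?[LHS]mulrCA //.
    by apply: (NM) => //; [apply: (NM) => //; apply: N12|apply: QN].
  - exact: (fourier_plancherel hB hA hT hl hF).
  - exact: (fourier_form_bound hB hA hT hl hkp hkm).
(* Part (ii) is the same duality with the two algebras exchanged. *)
apply: (@dual_lpnorm _ _ _ _ _ _ _ _ (fun w x => c * tr E m.+2 (w * star v * x))
         _ _ _ _ hQ hN) => //.
- exact: (fourier_inv_relcomm hB hA hT).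
- exact: (tr_fourier_inv hB hA hT).
- move=> a b d Na Nb Qd; rewrite !mulrDl (taD hN2) 1?mulrDr //;
  by apply: (NM) => //; [apply: (NM) => //; apply: QN|apply: N12].
- move=> k a d Na Qd; rewrite -!scalerAl (taZ hN2) 1?[LHS]mulrCA //.
  by apply: (NM) => //; [apply: (NM) => //; apply: QN|apply: N12].
- exact: (fourier_inv_plancherel hB hA hT hl hF).
move=> u r Qu Nr uuu rrr.
have [Qsu Nsr] := (ta_star hQ Qu, ta_star hN Nr).
have := fourier_form_bound hB hA hT hl hkp hkm Nsr Qsu
  (partial_isometry_star rrr) (partial_isometry_star uuu).
rewrite (ta_weight_star hN Nr) (ta_weight_star hQ Qu) -/tau -/c -/v.
(* The form of the inverse transform at [u], [r] is the conjugate of the first form at [star r],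
   [star u], so the bound carries over. *)
suff -> : tr E m.+2 (u * star v * r) = (tr E m.+2 (star r * v * star u))^*.
  by rewrite !cabsM cabs_conj (mulrC (complex.Re (tr E m.+1 _))).
rewrite -(taS hN2); last by apply: (NM); [apply: (NM) => //; apply: N12|apply: QN].
by rewrite (starM _ (star u)) (starM (star r)) !starK mulrA.
Qed.
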